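(* Let $(M,\mathcal J,\mathcal J_\psi)$ be a compact generalized Kähler manifold of symplectic type. Then the real Lie subalgebra $\mathfrak g_0^{\mathbb R}$ of the Lie algebra $\mathfrak g_0$ of reduced automorphisms is a reductive Lie algebra.
   Context: On $T_M\oplus T_M^*$ put $\langle v+\xi,u+\eta\rangle=\frac12(\xi(u)+\eta(v))$ and the Courant bracket $[u+\xi,v+\eta]_{co}=[u,v]+\mathcal L_u\eta-\mathcal L_v\xi-\frac12(d\,i_u\eta-d\,i_v\xi)$. A generalized complex structure $\mathcal J$ is a section of $SO(T_M\oplus T_M^* )$ with $\mathcal J^2=-\mathrm{id}$ whose $(-\sqrt{-1})$-eigenbundle $L_{\mathcal J}$ is closed under $[\,,]_{co}$; $\overline L_{\mathcal J}$ is the $(+\sqrt{-1})$-eigenbundle. $v+\theta$ acts on forms by $(v+\theta)\cdot\alpha=i_v\alpha+\theta\wedge\alpha$. A generalized Kähler structure is a pair of commuting generalized complex structures $(\mathcal J_1,\mathcal J_2)$ with $\langle-\mathcal J_1\mathcal J_2\,\cdot,\cdot\rangle$ positive definite; it is of symplectic type if it is $(\mathcal J,\mathcal J_\psi)$ with $\psi=e^{b-\sqrt{-1}\omega}$, $b$ real closed, $\omega$ symplectic, where $L_{\mathcal J_\psi}=\{e:e\cdot\psi=0\}$. Identify $\overline L_{\mathcal J}\cong L_{\mathcal J}^*$ via $2\langle\,,\rangle$; $\bar\partial_{\mathcal J}:\Gamma(\wedge^p\overline L_{\mathcal J})\to\Gamma(\wedge^{p+1}\overline L_{\mathcal J})$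 is the Lie algebroid differential of $L_{\mathcal J}$ (on functions $\bar\partial_{\mathcal J}u$ is the $\overline L_{\mathcal J}$-component of $du$). The Courant bracket makes $\mathfrak g_{\mathcal J}:=\ker\bar\partial_{\mathcal J}|_{\Gamma(\overline L_{\mathcal J})}/\bar\partial_{\mathcal J}C^\infty(M,\mathbb C)$ a Lie algebra. $\mathfrak g_0\subset\mathfrak g_{\mathcal J}$ is the image of $\{\mathcal J_\psi\bar\partial_{\mathcal J}u:u\in C^\infty(M,\mathbb C),\ \bar\partial_{\mathcal J}\mathcal J_\psi\bar\partial_{\mathcal J}u=0\}$ (which injects into $\mathfrak g_{\mathcal J}$ for compact $M$), and $\mathfrak g_0^{\mathbb R}$ is the real Lie subalgebra of those elements $\mathcal J_\psi\bar\partial_{\mathcal J}u\in\mathfrak g_0$ with $u\in C^\infty(M,\mathbb R)$. A Lie algebra is reductive if its radical equals its center. *)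

(* Defs.v *)
From HB Require Import structures.
From mathcomp Require Import all_boot all_order all_algebra all_fingroup.
From mathcomp Require Import generic_quotient ring_quotient.
From mathcomp Require Import all_classical all_reals all_analysis.
From mathcomp Require Import complex ring.

Set Implicit Arguments.
Unset Strict Implicit.
Unset Printing Implicit Defensive.

Import Order.TTheory GRing.Theory Num.Theory numFieldNormedType.Exports.
Import Quotient.Exports.

Local Open Scope classical_set_scope.
Local Open Scope complex_scope.
Local Open Scope ring_scope.

Section Smoothness.
Variables (R : realType) (n : nat).
Implicit Types (U : set 'rV[R]_n) (f g : 'rV[R]_n -> R).

Fixpoint Ck (k : nat) U f : Prop :=
  (forall x, U x -> {for x, continuous f}) /\
  if k is k'.+1 then
    forall i : 'I_n, (forall x, U x -> derivable f x (delta_mx 0 i)) /\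
                     Ck k' U ('D_(delta_mx 0 i) f)
  else True.

Definition smooth_on U f := forall k, Ck k U f.

Lemma Ck_eq k U f g : open U -> (forall x, U x -> f x = g x) ->
  Ck k U f -> Ck k U g.
Proof.
move=> oU; elim: k f g => [|k IH] f g fg [cf df]; have nfg x : U x ->
    \forall y \near x, f y = g y.
- by move=> Ux; apply: filterS (open_nbhs_nbhs (conj oU Ux)) => y /fg.
- split=> // x Ux; rewrite /prop_for /continuous_at -fg//.
  exact: cvg_trans (near_eq_cvg (nfg x Ux)) (cf x Ux).
- by move=> Ux; apply: filterS (open_nbhs_nbhs (conj oU Ux)) => y /fg.
split=> [x Ux|i].
  rewrite /prop_for /continuous_at -fg//.
  exact: cvg_trans (near_eq_cvg (nfg x Ux)) (cf x Ux).
have [dfi Ci] := df i; split=> [x Ux|].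
  exact: near_eq_derivable (nfg x Ux) (dfi x Ux).
by apply: IH Ci => x Ux; apply: near_eq_derive; exact: nfg.
Qed.

Lemma CkS k U f : Ck k.+1 U f -> Ck k U f.
Proof.
elim: k f => [|k IH] f [cf df]; split => // i.
by have [dfi Ci] := df i; split=> //; exact: IH.
Qed.

Lemma Ck_cst k U c : Ck k U (cst c).
Proof.
elim: k c => [|k IH] c; split => //;
  do ?by move=> x _; exact: (@cst_continuous _ _ c x).
move=> i; split=> [x _|]; first exact: derivable_cst.
rewrite (_ : 'D_(delta_mx 0 i) _ = cst 0)//.
by apply/funext => x; rewrite derive_cst.
Qed.

Lemma CkB k U f g : open U -> Ck k U f -> Ck k U g -> Ck k U (f \- g).
Proof.
move=> oU; elim: k f g => [|k IH] f g [cf df] [cg dg].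
  by split=> // x Ux; exact: (@cvgB _ _ _ _ _ f g _ _ (cf _ Ux) (cg _ Ux)).
split=> [x Ux|i]; first by exact: (@cvgB _ _ _ _ _ f g _ _ (cf _ Ux) (cg _ Ux)).
have [dfi Cfi] := df i; have [dgi Cgi] := dg i; split=> [x Ux|].
  by apply: derivableB; [exact: dfi|exact: dgi].
apply: (Ck_eq oU) (IH _ _ Cfi Cgi) => x Ux.
by rewrite /= deriveB//; [exact: dfi|exact: dgi].
Qed.

Lemma CkD k U f g : open U -> Ck k U f -> Ck k U g -> Ck k U (f \+ g).
Proof.
move=> oU Cf Cg; have C0 := CkB oU (@Ck_cst k U 0) Cg.
by apply: (Ck_eq oU) (CkB oU Cf C0) => x _ /=; rewrite sub0r opprK.
Qed.

Lemma CkM k U f g : open U -> Ck k U f -> Ck k U g -> Ck k U (f \* g).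
Proof.
move=> oU; elim: k f g => [|k IH] f g Cf Cg.
  have [cf _] := Cf; have [cg _] := Cg.
  by split=> // x Ux; exact: (@cvgM _ _ _ _ f g _ _ (cf _ Ux) (cg _ Ux)).
have [cf df] := Cf; have [cg dg] := Cg.
split=> [x Ux|i]; first by exact: (@cvgM _ _ _ _ f g _ _ (cf _ Ux) (cg _ Ux)).
have [dfi Cfi] := df i; have [dgi Cgi] := dg i; split=> [x Ux|].
  by apply: derivableM; [exact: dfi|exact: dgi].
apply: (Ck_eq oU) (CkD oU (IH _ _ (CkS Cf) Cgi) (IH _ _ (CkS Cg) Cfi)) => x Ux.
by rewrite /= deriveM//; [exact: dfi|exact: dgi].
Qed.

End Smoothness.

Record manifold (R : realType) (n : nat) := Manifold {
  points :> topologicalType;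
  hausdorff_points : hausdorff_space points;
  second_countable_points : @second_countable points;
  chart : Type;
  dom : chart -> set points;
  coord : chart -> points -> 'rV[R]_n;
  param : chart -> 'rV[R]_n -> points;
  dom_cover : forall p, exists i, dom i p;
  open_dom : forall i, open (dom i);
  open_codom : forall i, open (coord i @` dom i);
  coordK : forall i p, dom i p -> param i (coord i p) = p;
  continuous_coord : forall i p, dom i p -> {for p, continuous (coord i)};
  continuous_param : forall i y, (coord i @` dom i) y ->
    {for y, continuous (param i)};
  smooth_transition : forall i j k,
    smooth_on (coord i @` (dom i `&` dom j))
      (fun y => coord j (param i y) 0 k)
}.

Section Functions.
Variables (R : realType) (n : nat) (M : manifold R n).

Definition smooth (f : M -> R[i]) := forall i : chart M,
  smooth_on (coord i @` dom i) (fun y => complex.Re (f (param i y))) /\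
  smooth_on (coord i @` dom i) (fun y => complex.Im (f (param i y))).

Definition smooth_pred : {pred M -> R[i]} := fun f => `[< smooth f >].

Lemma smooth_cst c : smooth (cst c).
Proof. by move=> i; split=> k; exact: Ck_cst. Qed.

Lemma smooth_subring : subring_closed smooth_pred.
Proof.
split=> [|f g /asboolP sf /asboolP sg|f g /asboolP sf /asboolP sg].
- by apply/asboolP; exact: smooth_cst.
- apply/asboolP => i; have oU := @open_codom _ _ M i.
  have [rf jf] := sf i; have [rg jg] := sg i.
  by split=> k; [apply: (Ck_eq oU) (CkB oU (rf k) (rg k))
                |apply: (Ck_eq oU) (CkB oU (jf k) (jg k))] => x _ /=;
    rewrite !fctE; case: (f _) => ? ?; case: (g _).
- apply/asboolP => i; have oU := @open_codom _ _ M i.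
  have [rf jf] := sf i; have [rg jg] := sg i.
  split=> k.
    apply: (Ck_eq oU)
      (CkB oU (CkM oU (rf k) (rg k)) (CkM oU (jf k) (jg k))) => x _ /=.
    by rewrite !fctE; case: (f _) => ? ?; case: (g _).
  apply: (Ck_eq oU)
    (CkD oU (CkM oU (rf k) (jg k)) (CkM oU (jf k) (rg k))) => x _ /=.
  by rewrite !fctE; case: (f _) => ? ?; case: (g _).
Qed.
HB.instance Definition _ :=
  GRing.isSubringClosed.Build _ smooth_pred smooth_subring.

(* C^oo(M, C) *)
Record Cinf := MkCinf { Cinf_fun :> M -> R[i]; _ : Cinf_fun \in smooth_pred }.
HB.instance Definition _ := [isSub for Cinf_fun].
HB.instance Definition _ := [Choice of Cinf by <:].
HB.instance Definition _ := 
  GRing.SubChoice_isSubComPzRing.Build _ _ Cinf smooth_subring.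
HB.instance Definition _ := GRing.Lmodule.copy Cinf Cinf^o.

Lemma constf_subproof c : cst c \in smooth_pred.
Proof. by apply/asboolP; exact: smooth_cst. Qed.
Definition constf c : Cinf := MkCinf (constf_subproof c).

Definition real_fun (u : Cinf) := forall p, complex.Im (u p) = 0.

End Functions.

Notation "c %:Cst" := (constf _ c) (at level 1, format "c %:Cst") : ring_scope.

Section Tensors.
Variables (R : realType) (n : nat) (M : manifold R n).
Local Notation A := (Cinf M).

Definition derivation (X : A -> A) :=
  (forall (c : R[i]) f g, X (c%:Cst * f + g) = c%:Cst * X f + X g) /\
  (forall f g, X (f * g) = X f * g + f * X g).

Definition der_pred : {pred A -> A} := fun X => `[< derivation X >].

Lemma der_submod : submod_closed der_pred.
Proof.
have E0 f : (0 : A -> A) f = 0 by [].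
split=> [|a X Y /asboolP[lX mX] /asboolP[lY mY]].
  apply/asboolP; split=> *; rewrite !E0; ring.
have E f : (a *: X + Y) f = a * X f + Y f by [].
by apply/asboolP; split=> *; rewrite !E ?lX ?lY ?mX ?mY; ring.
Qed.

(* Gamma(T_M (x) C), as the module of C-linear derivations of C^oo(M, C) *)
Record Vec := MkVec { Vec_fun :> A -> A; _ : Vec_fun \in der_pred }.
HB.instance Definition _ := [isSub for Vec_fun].
HB.instance Definition _ := [Choice of Vec by <:].
HB.instance Definition _ := GRing.SubChoice_isSubLmodule.Build _ _ _ Vec
  (GRing.submod_closed_semi der_submod).

Definition form1_pred : {pred Vec -> A} := fun a => `[< linear a >].

Lemma form1_submod : submod_closed form1_pred.
Proof.
split=> [|f a b /asboolP la /asboolP lb]; apply/asboolP => g X Y.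
  have E0 Z : (0 : Vec -> A) Z = 0 by [].
  by rewrite !E0 scaler0 addr0.
have E Z : (f *: a + b) Z = f * a Z + b Z by [].
by rewrite !E la lb /GRing.scale/=; ring.
Qed.

(* Gamma(T_M^* (x) C) *)
Record Form1 :=
  MkForm1 { Form1_fun :> Vec -> A; _ : Form1_fun \in form1_pred }.
HB.instance Definition _ := [isSub for Form1_fun].
HB.instance Definition _ := [Choice of Form1 by <:].
HB.instance Definition _ := GRing.SubChoice_isSubLmodule.Build _ _ _ Form1
  (GRing.submod_closed_semi form1_submod).

Lemma VecP (X : Vec) : derivation X.
Proof. by case: X => X XP /=; apply/asboolP. Qed.

Lemma Form1P (a : Form1) : linear a.
Proof. by case: a => a aP /=; apply/asboolP. Qed.

Lemma VecD (X : Vec) f g : X (f + g) = X f + X g.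
Proof.
have [lX _] := VecP X; have := lX 1 f g.
by rewrite (_ : 1%:Cst = 1) ?mul1r//; exact: val_inj.
Qed.

Lemma comm_subproof (X Y : Vec) : (fun f => X (Y f) - Y (X f)) \in der_pred.
Proof.
have [lX mX] := VecP X; have [lY mY] := VecP Y.
by apply/asboolP; split=> *;
  rewrite ?(lX, lY) ?(mX, mY) ?VecD ?(lX, lY) ?(mX, mY); ring.
Qed.
Definition comm (X Y : Vec) : Vec := MkVec (comm_subproof X Y).

Lemma dfun_subproof (f : A) : (fun X : Vec => X f) \in form1_pred.
Proof. by apply/asboolP. Qed.
Definition dfun (f : A) : Form1 := MkForm1 (dfun_subproof f).

Lemma comm_lin (X Y Z : Vec) (g : A) :
  comm X (g *: Y + Z) = g *: comm X Y + (X g *: Y + comm X Z).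
Proof.
have [lX mX] := VecP X; have [lY mY] := VecP Y.
apply: val_inj; apply/funext => f.
have E (a : A) (U V : Vec) h : (a *: U + V) h = a * U h + V h by [].
have -> : val (comm X (g *: Y + Z)) f =
    X ((g *: Y + Z) f) - (g *: Y + Z) (X f) by [].
have -> : val (g *: comm X Y + (X g *: Y + comm X Z)) f =
    g * (X (Y f) - Y (X f)) + (X g * Y f + (X (Z f) - Z (X f))) by [].
by rewrite !E VecD mX; ring.
Qed.

Lemma lie_subproof (X : Vec) (a : Form1) :
  (fun Y : Vec => X (a Y) - a (comm X Y)) \in form1_pred.
Proof.
have [lX mX] := VecP X; apply/asboolP => g Y Z.
by rewrite comm_lin !(Form1P a) VecD /GRing.scale/= mX; ring.
Qed.
Definition lie (X : Vec) (a : Form1) : Form1 := MkForm1 (lie_subproof X a).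

Definition real_vec (X : Vec) := forall u, real_fun u -> real_fun (X u).
Definition real_form1 (a : Form1) := forall X, real_vec X -> real_fun (a X).

Definition form2 (b : Vec -> Vec -> A) :=
  (forall X : Vec, b X X = 0) /\
  (forall (f : A) (X Y Z : Vec), b (f *: X + Y) Z = f * b X Z + b Y Z).

Definition real_form2 (b : Vec -> Vec -> A) :=
  forall X Y, real_vec X -> real_vec Y -> real_fun (b X Y).

Definition closed_form2 (b : Vec -> Vec -> A) := forall X Y Z : Vec,
  X (b Y Z) + Y (b Z X) + Z (b X Y)
  - b (comm X Y) Z - b (comm Y Z) X - b (comm Z X) Y = 0.

Definition vec_vanish (p : M) (X : Vec) := forall f, X f p = 0.

Definition nondegenerate (b : Vec -> Vec -> A) := forall (p : M) (X : Vec),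
  (forall Y, b X Y p = 0) -> vec_vanish p X.

Definition symplectic (w : Vec -> Vec -> A) :=
  [/\ form2 w, real_form2 w, closed_form2 w & nondegenerate w].

End Tensors.

Section Forms.
Variables (R : realType) (n : nat) (M : manifold R n).
Local Notation A := (Cinf M).
Local Notation Vec := (Vec M).

(* A (mixed) form is the family of its homogeneous components, its component of
   degree k being given by its values on k vector fields. *)
Definition pform (k : nat) := ('I_k -> Vec) -> A.
Definition mixed := forall k, pform k.

Definition mixed1 : mixed := fun k =>
  if k is 0 then fun _ => 1 else fun _ => 0.

Definition mixed_of_form1 (a : Form1 M) : mixed := fun k =>
  match k return pform k with
  | 1 => fun X => a (X ord0)
  | _ => fun _ => 0
  end.

Definition mixed_of_form2 (b : Vec -> Vec -> A) : mixed := fun k =>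
  match k return pform k with
  | 2 => fun X => b (X ord0) (X ord_max)
  | _ => fun _ => 0
  end.

Definition first_args (k : nat) (p : 'I_k.+1) (i : 'I_p) : 'I_k :=
  cast_ord (subnKC (leq_ord p)) (lshift (k - p) i).
Definition last_args (k : nat) (p : 'I_k.+1) (j : 'I_(k - p)) : 'I_k :=
  cast_ord (subnKC (leq_ord p)) (rshift p j).

Definition wedge (a b : mixed) : mixed := fun k X =>
  \sum_(p < k.+1) (((p`! * (k - p)`!)%:R)^-1)%:Cst *
    \sum_(s : 'S_k) (-1) ^+ (s : bool) *
      (a p (fun i => X (s (first_args i))) *
       b (k - p)%N (fun j => X (s (last_args j)))).

(* e^a, for a with no component of degree 0: then a^j has no component of
   degree k < j. *)
Definition mixed_exp (a : mixed) : mixed := fun k X =>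
  \sum_(j < k.+1) ((j`!%:R)^-1)%:Cst * iter j (wedge a) mixed1 k X.

Definition interior (v : Vec) (a : mixed) : mixed := fun k X =>
  a k.+1 (fun i => oapp X v (unlift ord0 i)).

End Forms.

Section Generalized.
Variables (R : realType) (n : nat) (M : manifold R n).
Local Notation A := (Cinf M).

(* Gamma((T_M (+) T_M^* ) (x) C) *)
Definition Sec := (Vec M * Form1 M)%type.
HB.instance Definition _ := GRing.Lmodule.on Sec.

Implicit Types (e : Sec) (u : A) (J : {linear Sec -> Sec}).

Definition real_sec e := real_vec e.1 /\ real_form1 e.2.

Definition pairing (e f : Sec) : A :=
  (2^-1)%:Cst * (e.2 f.1 + f.2 e.1).

Definition courant (e f : Sec) : Sec :=
  (comm e.1 f.1,
   lie e.1 f.2 - lie f.1 e.2 -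
     (2^-1)%:Cst *: (dfun (f.2 e.1) - dfun (e.2 f.1))).

Definition clifford e (a : mixed M) : mixed M := fun k X =>
  interior e.1 a X + wedge (mixed_of_form1 e.2) a X.

Definition sec_vanish (p : M) e :=
  vec_vanish p e.1 /\ forall X, e.2 X p = 0.

(* The fibres of (T_M (+) T_M^* ) (x) C have dimension 2n, so that 2n linearly
   independent vectors form a basis. *)
Definition frame_at (p : M) (e : 'I_(n + n) -> Sec) :=
  forall c : 'I_(n + n) -> R[i],
    sec_vanish p (\sum_i (c i)%:Cst *: e i) -> forall i, c i = 0.

Definition matrix_at (p : M) J (e : 'I_(n + n) -> Sec) (B : 'M[R[i]]_(n + n)) :=
  forall j, sec_vanish p (J (e j) - \sum_i (B i j)%:Cst *: e i).

(* A real bundle endomorphism is given by the C^oo(M, C)-linear map that it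
   induces on complex sections. *)
Definition SO_section J :=
  [/\ forall e, real_sec e -> real_sec (J e),
      forall e f, pairing (J e) (J f) = pairing e f
    & forall p (e : 'I_(n + n) -> Sec) B,
        frame_at p e -> matrix_at p J e B -> \det B = 1].

(* Gamma(L_J) and Gamma(\bar L_J): L_J is the (-i)-eigenbundle. *)
Definition eigenL J : set Sec := [set e | J e = - ('i%C%:Cst *: e)].
Definition eigenLbar J : set Sec := [set e | J e = 'i%C%:Cst *: e].

Definition generalized_complex J :=
  [/\ SO_section J, forall e, J (J e) = - e
    & forall e f, eigenL J e -> eigenL J f -> eigenL J (courant e f)].

Definition generalized_kahler J1 J2 :=
  [/\ generalized_complex J1, generalized_complex J2,
      forall e, J1 (J2 e) = J2 (J1 e)
    & forall p e, real_sec e -> ~ sec_vanish p e ->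
        0 < pairing (- J1 (J2 e)) e p].

Definition annihilates e (a : mixed M) := forall k X, clifford e a (k := k) X = 0.

Definition symplectic_type J := exists b w : Vec M -> Vec M -> A,
  [/\ form2 b, real_form2 b, closed_form2 b, symplectic w
    & let psi := mixed_exp
        (mixed_of_form2 (fun X Y => b X Y - 'i%C%:Cst * w X Y)) in
      eigenL J = [set e | annihilates e psi]].

Definition dsec u : Sec := (0, dfun u).

(* (e - iJe)/2 is the component of e in \bar L_J along L_J. *)
Definition dbar0 J u : Sec :=
  (2^-1)%:Cst *: (dsec u - 'i%C%:Cst *: J (dsec u)).

(* \bar\partial_J a as an alternating form on L_J, where \bar L_J is the dual
   of L_J by 2<,>. *)
Definition dbar1 J (a e f : Sec) : A :=
  e.1 (2%:R * pairing a f) - f.1 (2%:R * pairing a e)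
  - 2%:R * pairing a (courant e f).

Definition ker_dbar J : set Sec := [set a | eigenLbar J a /\
  forall e f, eigenL J e -> eigenL J f -> dbar1 J a e f = 0].

Definition exact J : {pred Sec} := fun a => `[< exists u, a = dbar0 J u >].

Lemma dsecB u v : dsec (u - v) = dsec u - dsec v.
Proof.
congr pair; first by rewrite subr0.
apply: val_inj; apply/funext => X.
have -> : val (dfun u - dfun v) X = X u - X v by [].
by rewrite -{2}(subrK v u) (VecD X (u - v)) addrK.
Qed.

Lemma dbar0B J u v : dbar0 J (u - v) = dbar0 J u - dbar0 J v.
Proof.
have E (V : lmodType A) (a i : A) (x y z w : V) :
    a *: (x - y - i *: (z - w)) = a *: (x - i *: z) - a *: (y - i *: w).
  by rewrite -[RHS]scalerBr; congr (_ *: _);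
    rewrite scalerBr !opprD !opprK addrACA.
by rewrite /dbar0 dsecB (linearB J); exact: E.
Qed.

Lemma exact_zmod J : zmod_closed (exact J).
Proof.
split; first by apply/asboolP; exists 0; have := dbar0B J 0 0; rewrite !subrr.
move=> _ _ /asboolP[u ->] /asboolP[v ->].
by apply/asboolP; exists (u - v); rewrite dbar0B.
Qed.
HB.instance Definition _ J :=
  GRing.isZmodClosed.Build _ (exact J) (exact_zmod J).

(* The real vector space of complex sections modulo \bar\partial_J C^oo(M, C);
   g_J is the image in it of ker \bar\partial_J. *)
Definition SecQ J := Quotient.quot (exact J).
HB.instance Definition _ J := GRing.Zmodule.on (SecQ J).

Definition cl J (e : Sec) : SecQ J := (\pi_(SecQ J) e)%qT.

Lemma clP J e f : cl J e = cl J f <-> exact J (e - f).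
Proof.
have E : exact J (e - f) = (cl J e == cl J f) := Quotient.idealrBE (exact J) e f.
by split=> [h|h]; [rewrite E h | apply/eqP; rewrite -E].
Qed.

Lemma cl_repr J (x : SecQ J) : cl J (repr x) = x.
Proof. exact: reprK. Qed.

Lemma clD J e f : cl J (e + f) = cl J e + cl J f.
Proof. exact: (Quotient.pi_add (exact J) e f). Qed.

Lemma dbar0Z J c u : dbar0 J (c%:Cst * u) = c%:Cst *: dbar0 J u.
Proof.
have E (V : lmodType A) (a b i : A) (x y : V) :
    a *: (b *: x - i *: (b *: y)) = b *: (a *: (x - i *: y)).
  by rewrite !scalerBr !scalerA; congr (_ *: _ - _ *: _); ring.
rewrite /dbar0 (_ : dsec (c%:Cst * u) = c%:Cst *: dsec u).
  by rewrite (linearZ_LR J); exact: E.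
congr pair; first by rewrite scaler0.
apply: val_inj; apply/funext => X; have [lX _] := VecP X.
have X0 : X 0 = 0 by apply: (addrI (X 0)); rewrite -VecD !addr0.
by have := lX c u 0; rewrite X0 !addr0.
Qed.

Definition SecQ_scale J (r : R) (x : SecQ J) : SecQ J :=
  cl J ((r%:C)%:Cst *: repr x).

Lemma SecQ_scaleE J r e : SecQ_scale r (cl J e) = cl J ((r%:C)%:Cst *: e).
Proof.
have /clP/asboolP[u eu] := cl_repr (cl J e).
by apply/clP/asboolP; exists ((r%:C)%:Cst * u); rewrite -scalerBr eu dbar0Z.
Qed.

Lemma SecQ_scaleA J r s x :
  @SecQ_scale J r (SecQ_scale s x) = SecQ_scale (r * s) x.
Proof.
rewrite -(cl_repr x) !SecQ_scaleE scalerA; congr (cl J (_ *: _)).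
by apply: val_inj; apply/funext => p /=; rewrite rmorphM.
Qed.

Lemma SecQ_scale1 J : left_id 1 (@SecQ_scale J).
Proof.
move=> x; rewrite -(cl_repr x) SecQ_scaleE.
by rewrite (_ : 1%:C%:Cst = 1) ?scale1r//; exact: val_inj.
Qed.

Lemma SecQ_scaleDr J : right_distributive (@SecQ_scale J) +%R.
Proof.
move=> r x y; rewrite -(cl_repr x) -(cl_repr y).
by rewrite -clD !SecQ_scaleE scalerDr clD.
Qed.

Lemma SecQ_scaleDl J x : {morph (@SecQ_scale J)^~ x : r s / r + s}.
Proof.
move=> r s; rewrite -(cl_repr x) !SecQ_scaleE -clD -scalerDl.
congr (cl J (_ *: _)); apply: val_inj; apply/funext => p /=.
by rewrite rmorphD.
Qed.

HB.instance Definition _ J := GRing.Zmodule_isLmodule.Build R (SecQ J)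
  (@SecQ_scaleA J) (@SecQ_scale1 J) (@SecQ_scaleDr J) (@SecQ_scaleDl J).

(* On g_J, this does not depend on the chosen representatives. *)
Definition brQ J (x y : SecQ J) : SecQ J := cl J (courant (repr x) (repr y)).

Definition reduced J Jpsi : set A :=
  [set u | ker_dbar J (Jpsi (dbar0 J u))].

Definition gJ J : set (SecQ J) := cl J @` ker_dbar J.

Definition g0 J Jpsi : set (SecQ J) :=
  [set cl J (Jpsi (dbar0 J u)) | u in reduced J Jpsi].

Definition g0R J Jpsi : set (SecQ J) :=
  [set cl J (Jpsi (dbar0 J u)) | u in reduced J Jpsi `&` @real_fun R n M].

End Generalized.

Arguments brQ {R n M} J x y.
Arguments gJ {R n M} J _.
Arguments g0 {R n M} J Jpsi _.
Arguments g0R {R n M} J Jpsi _.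

Lemma g0_sub (R : realType) (n : nat) (M : manifold R n)
  (J Jpsi : {linear Sec M -> Sec M}) : g0 J Jpsi `<=` gJ J.
Proof. by move=> _ [u ku <-]; exists (Jpsi (dbar0 J u)). Qed.

Section LieAlgebras.
Variables (R : fieldType) (V : lmodType R) (br : V -> V -> V).
Implicit Types g h : set V.

Definition subspace h :=
  h 0 /\ forall (a : R) x y, h x -> h y -> h (a *: x + y).

Definition span (S : set V) : set V :=
  [set x | forall h, subspace h -> S `<=` h -> h x].

Definition lie_algebra g :=
  [/\ subspace g,
      forall x y, g x -> g y -> g (br x y),
      forall (a : R) x y z, g x -> g y -> g z ->
        br (a *: x + y) z = a *: br x z + br y z,
      forall x, g x -> br x x = 0
    & forall x y z, g x -> g y -> g z ->
        br x (br y z) + br y (br z x) + br z (br x y) = 0].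

Definition lie_subalgebra g h :=
  [/\ h `<=` g, subspace h & forall x y, h x -> h y -> h (br x y)].

Definition ideal g h :=
  [/\ h `<=` g, subspace h & forall x y, g x -> h y -> h (br x y)].

Definition derived h : set V := span [set br x y | x in h & y in h].

Definition solvable h := exists k, iter k derived h `<=` [set 0].

Definition center g : set V := [set x | g x /\ forall y, g y -> br x y = 0].

Definition is_radical g r :=
  [/\ ideal g r, solvable r &
      forall h, ideal g h -> solvable h -> h `<=` r].

Definition reductive g := exists2 r, is_radical g r & r = center g.

End LieAlgebras.

(* Main.v *)
From HB Require Import structures.
Require Import Defs.
From mathcomp Require Import all_boot all_order all_algebra.
From mathcomp Require Import all_classical all_reals all_analysis.
From mathcomp Require Import complex ring lra.
Import Defs.

(** Call a real function [u] a potential when its Hamiltonian section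
    [ham u = J_psi (d u)] is an infinitesimal symmetry of [J] for the Dorfman
    bracket ([preserves]).  The elements of the Lie algebra are the classes of
    the components [red u] of [ham u] in [\bar L_J], for [u] a potential, and
    their bracket is induced by the Poisson bracket [pb u v], the derivative of
    [v] along the vector part of [ham u] ([cl_bracket], [brQ_red]).  The
    axioms of a Lie algebra follow from those of the Poisson bracket, because
    Hamiltonian sections are symmetries of [J_psi] ([preserves_J_dsec]).

    Reductivity comes from one property ([g0R_ad_nil]):
    [x, [x, y]] = 0 implies [x, y] = 0.  It makes every abelian ideal [h]
    central, since [y, [y, x]] lies in [h, h] for [y] in [h]; an induction on
    the derived length then makes every solvable ideal central
    ([reductive_ad_nil]).

    To prove the property, let [f = {u, v}] and [w = {u, f}], where [w] has the
    class 0.  That class vanishes only if [J_psi (\bar\partial w)] is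
    [\bar\partial s] for some [s].  Then [s - i w] is holomorphic for [I_+],
    the complex structure of the bihermitian geometry whose antiholomorphic
    fields are the vector parts of the common (-i)-eigensections of [J] and
    [J_psi].  On a compact manifold it has zero differential, so [ds = i dw];
    this forces [J_psi dw = J dw], and the positive metric
    [G = - J J_psi] gives [G(dw, dw) = <dw, dw> = 0], whence [dw = 0]
    ([exact_hamiltonian]).  So the Hamiltonian field [X] of [u] satisfies
    [X f = w] and [X w = 0].  On a compact manifold this implies [w = 0], and
    then [X v = f], [X f = 0] imply [f = 0]: at a maximum of [v + N f^2] the
    derivative [f] of that function vanishes, so the maximum is at most the
    maximum of [v] whatever [N] is ([nilpotent_derivative]).

    The analytic input is therefore that a holomorphic function
    [alpha + i beta] on a compact manifold is locally constant
    ([holomorphic_locally_constant]).  This is Hopf's boundary argument: for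
    each real section [e], two real fields [v] and [w] satisfy
    [v alpha = w beta] and [v beta = - w alpha], so that [v v + w w] maps
    [alpha] to the first-order expression [comm v w beta], and
    [beta] has the same gradient norm as [alpha].  If [alpha] is not locally
    constant, a ball touches one of its level sets {alpha = max} at a single
    point ([touching_function]), and a barrier built on that ball contradicts
    the conditions at an interior maximum.

    Vector fields are derivations of the algebra of smooth functions, so the
    conditions at a maximum, [X h = 0] and [X (X h) <= 0], are proved for
    derivations.  Hadamard's lemma, used twice in a chart and multiplied by
    bump functions, writes the second-order Taylor formula as an identity
    between global functions, to which a derivation can be applied
    ([min_taylor]). *)

Set Implicit Arguments.
Unset Strict Implicit.
Unset Printing Implicit Defensive.

Import Order.TTheory GRing.Theory Num.Theory numFieldNormedType.Exports.

Local Open Scope classical_set_scope.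
Local Open Scope complex_scope.
Local Open Scope ring_scope.

(** * Calculus of smooth functions on open sets of a coordinate space *)

Section Calculus.
Variables (R : realType) (n : nat).
Implicit Types (U V : set 'rV[R]_n) (f g : 'rV[R]_n -> R).

Lemma CkW k U V f : V `<=` U -> Ck k U f -> Ck k V f.
Proof.
move=> VU; elim: k f => [|k IH] f [cf df]; split => //.
- by move=> x /VU /cf.
- by move=> x /VU /cf.
move=> i; have [dfi Ci] := df i; split=> [x /VU /dfi//|]; exact: IH.
Qed.

Lemma Ck_local k U f :
  (forall x, U x -> exists2 V, V x & Ck k V f) -> Ck k U f.
Proof.
elim: k f => [|k IH] f H; split => //.
- by move=> x /H[V Vx [cf _]]; exact: cf.
- by move=> x /H[V Vx [cf _]]; exact: cf.
move=> i; split=> [x /H[V Vx [_ /(_ i)[d _]]]|]; first exact: d.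
by apply: IH => x /H[V Vx [_ /(_ i)[_ d]]]; exists V.
Qed.

Lemma smooth_onM U f g : open U -> smooth_on U f -> smooth_on U g ->
  smooth_on U (f \* g).
Proof. by move=> oU sf sg k; exact: CkM. Qed.

Lemma Ck_sum k m (F : 'I_m -> 'rV[R]_n -> R) U : open U ->
  (forall i, Ck k U (F i)) -> Ck k U (fun x => \sum_i F i x).
Proof.
move=> oU; elim: m F => [|m IH] F sF.
  by apply: (Ck_eq oU) (@Ck_cst _ _ k U 0) => x _; rewrite big_ord0.
apply: (Ck_eq oU) (CkD oU (IH (fun i => F (widen_ord (leqnSn m) i)) _) (sF ord_max)) => //.
by move=> x _; rewrite big_ord_recr.
Qed.

Lemma smooth_on_sum m (F : 'I_m -> 'rV[R]_n -> R) U : open U ->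
  (forall i, smooth_on U (F i)) -> smooth_on U (fun x => \sum_i F i x).
Proof. by move=> oU sF k; apply: Ck_sum => // i; exact: sF. Qed.

Lemma smooth_on_D i U f : smooth_on U f -> smooth_on U ('D_(delta_mx 0 i) f).
Proof. by move=> sf k; have [_ /(_ i)[]] := sf k.+1. Qed.

Lemma smooth_on_coord U i : smooth_on U (fun x : 'rV[R]_n => x 0 i).
Proof.
move=> k; apply: (@CkW _ setT) => //.
have dcoord j (x : 'rV[R]_n) :
    is_derive x (delta_mx 0 j) (fun y : 'rV[R]_n => y 0 i) (i == j)%:R.
  have d : differentiable (fun y : 'rV[R]_n => y 0 i) x by exact: differentiable_coord.
  apply: DeriveDef; first exact: diff_derivable.
  rewrite deriveE//.
  have lin : linear (fun y : 'rV[R]_n => y 0 i : R^o).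
    by move=> a u v; rewrite !mxE.
  pose L : {linear 'rV[R]_n -> R^o} := HB.pack (fun y : 'rV[R]_n => y 0 i : R^o)
    (GRing.isLinear.Build _ _ _ _ _ lin).
  rewrite (_ : (fun _ => _) = L)// diff_lin//; last exact: coord_continuous.
  by rewrite /L/= mxE eqxx /= eq_sym.
have ccoord x : {for x, continuous (fun y : 'rV[R]_n => y 0 i)}.
  exact: coord_continuous.
case: k => [|k]; split=> // j; split=> [x _|].
  by have [] := dcoord j x.
apply: (Ck_eq openT) (@Ck_cst _ _ _ _ (i == j)%:R) => x _.
by have [_ ->] := dcoord j x.
Qed.

End Calculus.

Section Line.
Variables (R : realType) (V : normedModType R).

Lemma line_derive (f : V -> R) (x v : V) (s : R) (d : R) :
  is_derive (x + s *: v) v f d -> is_derive s 1 (fun t => f (x + t *: v)) d.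
Proof.
move=> [df <-].
have E : (fun h : R => h^-1 *: (((fun t : R => f (x + t *: v)) \o shift s) (h *: 1) - f (x + s *: v))) =
         (fun h : R => h^-1 *: ((f \o shift (x + s *: v)) (h *: v) - f (x + s *: v))).
  apply/funext => h /=; congr (_ *: (f _ - _)).
  rewrite -[h *: 1]/(h * 1) mulr1 scalerDl [LHS]addrCA; congr (_ + _).
by apply: DeriveDef; rewrite /derivable /derive E.
Qed.

(** The bounds on absolute values let the sign of [a] be arbitrary, as the
    increments along the coordinate axes require. *)
Lemma MVT_line (f : V -> R) (x v : V) (a : R) :
  (forall s, `|s| <= `|a| -> derivable f (x + s *: v) v) ->
  exists2 c, `|c| <= `|a| & f (x + a *: v) - f x = a * 'D_v f (x + c *: v).
Proof.
move=> df; pose F (t : R) : R := f (x + t *: v); pose dF (t : R) : R := 'D_v f (x + t *: v).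
have dFP (s : R) : `|s| <= `|a| -> is_derive s (1 : R) F (dF s).
  by move=> sa; apply: line_derive; apply: DeriveDef => //; exact: df.
have Fx : F 0 = f x by rewrite /F scale0r addr0.
have cF (u w : R) : `|u| <= `|a| -> `|w| <= `|a| -> {within `[u, w], continuous F}.
  move=> ua wa; apply: derivable_within_continuous => s.
  rewrite in_itv/= => /andP[us sw]; have /dFP [] // : `|s| <= `|a|.
  rewrite ler_norml; move: ua wa; rewrite !ler_norml => /andP[? ?] /andP[? ?]; lra.
have n0 : `|0 : R| <= `|a| by rewrite normr0.
have [a0|a0] := leP 0 a.
  have dI (s : R) : s \in `]0, a[ -> is_derive s (1 : R) F (dF s).
    rewrite in_itv/= => /andP[s0 sa]; apply: dFP.
    by rewrite !ger0_norm// ltW.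
  have [c] := MVT_segment a0 dI (cF 0 a n0 (lexx _)).
  rewrite in_itv/= => /andP[c0 ca]; rewrite Fx subr0 mulrC => E; exists c => //.
  by rewrite !ger0_norm.
have dI (s : R) : s \in `]a, 0[ -> is_derive s (1 : R) F (dF s).
  rewrite in_itv/= => /andP[s0 sa]; apply: dFP.
  by rewrite !ler0_norm ?(ltW a0) ?(ltW sa)// lerN2 ltW.
have [c] := MVT_segment (ltW a0) dI (cF a 0 (lexx _) n0).
rewrite in_itv/= => /andP[c0 ca]; rewrite Fx => E; exists c => //.
  by rewrite !ler0_norm ?(ltW a0)// lerN2.
have -> : f (x + a *: v) - f x = - (f x - F a) by rewrite opprB.
by rewrite E sub0r mulrN opprK mulrC.
Qed.

End Line.

Section Differentiability.
Variables (R : realType) (n : nat).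
Implicit Types (U V : set 'rV[R]_n) (f g : 'rV[R]_n -> R).

Lemma norm_delta (i : 'I_n) : `|delta_mx 0 i : 'rV[R]_n| <= 1.
Proof.
rewrite [leLHS]/Num.norm/= mx_normrE; apply/bigmax_leP; split => // -[j k] _ /=.
by rewrite mxE; case: (_ && _); rewrite ?normr1 ?normr0.
Qed.

Lemma norm_coord (x : 'rV[R]_n) i : `|x 0 i| <= `|x|.
Proof.
rewrite [leRHS]/Num.norm/= mx_normrE.
by have := @le_bigmax _ _ _ 0 (fun ij : 'I_1 * 'I_n => `|x ij.1 ij.2|) (0, i).
Qed.

Definition grad f (x h : 'rV[R]_n) : R := \sum_i h 0 i * 'D_(delta_mx 0 i) f x.

Lemma grad_lin f x : linear (grad f x : 'rV[R]_n -> R^o).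
Proof.
move=> a u v; rewrite /grad scaler_sumr -big_split/=; apply: eq_bigr => i _.
by rewrite !mxE mulrDl -[a *: _]/(a * _) mulrA.
Qed.
HB.instance Definition _ f x := GRing.isLinear.Build _ _ _ _ (grad f x) (@grad_lin f x).

Lemma grad_le f x h : `|grad f x h| <= (\sum_i `|'D_(delta_mx 0 i) f x|) * `|h|.
Proof.
rewrite /grad mulr_suml (le_trans (ler_norm_sum _ _ _))//; apply: ler_sum => i _.
by rewrite normrM mulrC ler_wpM2l// norm_coord.
Qed.

Lemma grad_cont f x : continuous (grad f x : 'rV[R]_n -> R^o).
Proof.
apply: bounded_linear_continuous; apply/linear_boundedP.
near=> r => h; apply: le_trans (grad_le f x h) _; apply: ler_wpM2r => //.
Unshelve. all: by end_near. Qed.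

(* The path from x to h + x along the axes has the vertices trunc h l + x. *)
Let trunc (h : 'rV[R]_n) (l : nat) : 'rV[R]_n := \row_j (h 0 j *+ (j < l)%N).

Let truncS h (l : 'I_n) : trunc h l.+1 = trunc h l + h 0 l *: delta_mx 0 l.
Proof.
apply/rowP => j; rewrite !mxE/= ltnS leq_eqVlt -val_eqE/=.
have [jl|jl] := eqVneq (j : nat) l; last by rewrite /= mulr0 addr0.
by rewrite jl ltnn mulr0n add0r mulr1 (val_inj jl).
Qed.

Let trunc_norm h l : `|trunc h l| <= `|h|.
Proof.
rewrite [leLHS]/Num.norm/= mx_normrE; apply/bigmax_leP; split => // -[j k] _ /=.
by rewrite mxE; case: (_ < _)%N; rewrite ?mulr1n ?mulr0n ?normr0 ?norm_coord.
Qed.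

(** The increment is split along the coordinate directions, and the mean value
    theorem is applied to each piece. *)
Lemma C1_increment f (x : 'rV[R]_n) :
  (\forall y \near x, forall i, derivable f y (delta_mx 0 i)) ->
  (forall i, {for x, continuous ('D_(delta_mx 0 i) f)}) ->
  forall e, 0 < e ->
  \forall h \near (0 : 'rV[R]_n), `|f (h + x) - f x - grad f x h| <= e * `|h|.
Proof.
move=> df cf e e0; pose e' := e / n.+1%:R.
have e'0 : 0 < e' by rewrite divr_gt0.
have /nbhs_ballP[d /= d0 Bd] : \forall y \near x, forall i,
    derivable f y (delta_mx 0 i) /\
    `|'D_(delta_mx 0 i) f x - 'D_(delta_mx 0 i) f y| <= e'.
  have H : \forall y \near x, forall i,
      `|'D_(delta_mx 0 i) f x - 'D_(delta_mx 0 i) f y| <= e'.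
    have := @filter_forall _ 'I_n (fun i y =>
      `|'D_(delta_mx 0 i) f x - 'D_(delta_mx 0 i) f y| <= e') (nbhs x) _.
    apply=> i; by have /cvgrPdist_le/(_ _ e'0) := cf i.
  by apply: filterS2 df H => y dy Hy i; split; [exact: dy|exact: Hy].
have d20 : 0 < d / 2 by rewrite divr_gt0.
near=> h; have hd : `|h| < d / 2 by near: h; have := @nbhs0_lt R 'rV[R]_n (d / 2) d20; apply.
have step (l : 'I_n) : `|f (trunc h l.+1 + x) - f (trunc h l + x) -
     h 0 l * 'D_(delta_mx 0 l) f x| <= e' * `|h|.
  have close (s : R) : `|s| <= `|h 0 l| -> ball x d (trunc h l + x + s *: delta_mx 0 l).
    move=> sh; rewrite -ball_normE/= addrAC opprD addrCA subrr addr0 normrN.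
    apply: le_lt_trans (ler_normD _ _) _.
    rewrite [ltRHS](splitr d); apply: ler_ltD.
      by apply: le_trans (trunc_norm h l) (ltW hd).
    rewrite normrZ; apply: le_lt_trans hd.
    apply: (le_trans _ (norm_coord h l)); rewrite -[leRHS]mulr1.
    by apply: ler_pM => //; exact: norm_delta.
  have [|c ch E] := @MVT_line _ _ f (trunc h l + x) (delta_mx 0 l) (h 0 l).
    by move=> s /close /Bd /(_ l)[].
  rewrite truncS (addrAC (trunc h l)) E -mulrBr normrM mulrC.
  apply: ler_pM => //; last exact: norm_coord.
  by rewrite distrC; have /Bd/(_ l)[] := close _ ch.
have -> : f (h + x) - f x - grad f x h =
   \sum_(l < n) (f (trunc h l.+1 + x) - f (trunc h l + x) - h 0 l * 'D_(delta_mx 0 l) f x).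
  rewrite sumrB; congr (_ - _).
  rewrite -(big_mkord xpredT (fun l => f (trunc h l.+1 + x) - f (trunc h l + x))).
  rewrite telescope_sumr//; congr (f (_ + x) - f _).
    by apply/rowP => j; rewrite mxE ltn_ord.
  by rewrite -[LHS]add0r; congr (_ + _); apply/rowP => j; rewrite !mxE.
apply: le_trans (ler_norm_sum _ _ _) _.
apply: (@le_trans _ _ (\sum_(l < n) e' * `|h|)); first by apply: ler_sum => l _; exact: step.
rewrite sumr_const card_ord -mulr_natl mulrA ler_wpM2r//.
rewrite /e' mulrCA -[leRHS]mulr1 ler_pM2l// ler_pdivrMr// mul1r ler_nat.
exact: leqnSn.
Unshelve. all: by end_near. Qed.

Lemma C1_diff f (x : 'rV[R]_n) :
  (\forall y \near x, forall i, derivable f y (delta_mx 0 i)) ->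
  (forall i, {for x, continuous ('D_(delta_mx 0 i) f)}) ->
  is_diff x f (grad f x).
Proof.
move=> df cf.
have E : f \o shift x = cst (f x) + (grad f x : 'rV[R]_n -> R^o) +o_ (0 : 'rV[R]_n) id.
  apply/eqaddoP => e e0; apply: filterS (C1_increment df cf e0) => h.
  by rewrite -[(_ - _ : _ -> _) _]/(_ - _) -![(_ + _ : _ -> _) _]/(_ + _) opprD addrA.
have D := diff_unique (@grad_cont f x) E.
by apply: DiffDef => //; apply/diff_locallyP; rewrite D; split => //; exact: grad_cont.
Qed.

Lemma smooth_diff U f x : open U -> smooth_on U f -> U x -> is_diff x f (grad f x).
Proof.
move=> oU sf Ux; apply: C1_diff.
  by apply: filterS (open_nbhs_nbhs (conj oU Ux)) => y Uy i; have [_ /(_ i)[d _]] := sf 1%N; exact: d.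
by move=> i; have [_ /(_ i)[_ [c _]]] := sf 1%N; exact: c.
Qed.

Lemma curve_derive f (c : R -> 'rV[R]_n) (c' : 'rV[R]_n) (s : R) :
  is_diff (c s) f (grad f (c s)) ->
  (forall i, is_derive s (1 : R) (fun t => c t 0 i) (c' 0 i)) ->
  is_derive s (1 : R) (fun t => f (c t)) (grad f (c s) c').
Proof.
move=> [df vf] dc.
have cd : derivable c s 1.
  by apply/derivable_mxP => i j; rewrite ord1; have [] := dc j.
have cD : 'D_1 c s = c'.
  by rewrite derive_mx//; apply/rowP => j; rewrite mxE; have [_ ->] := dc j.
have cd' : differentiable c s by exact/derivable1_diffP.
have fcd : differentiable (f \o c) s by exact: differentiable_comp.
apply: DeriveDef; first by apply/derivable1_diffP.
rewrite (_ : (fun _ => _) = f \o c)// deriveE// diff_comp//= vf; congr (grad f _ _).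
by rewrite -deriveE.
Qed.

End Differentiability.

Lemma derive_line (R : realType) (V : normedModType R) (f : V -> R) (x v : V) (d : R) :
  is_derive (0 : R) (1 : R) (fun t : R => f (x + t *: v)) d -> is_derive x v f d.
Proof.
move=> [df <-].
have E : (fun h : R => h^-1 *: (((fun t : R => f (x + t *: v)) \o shift (0 : R)) (h *: 1) - f (x + (0 : R) *: v))) =
         (fun h : R => h^-1 *: ((f \o shift x) (h *: v) - f x)).
  apply/funext => h /=; rewrite scale0r !addr0; congr (_ *: (f _ - _)).
  by rewrite -[h *: 1]/(h * 1) mulr1 addrC.
by move: df; rewrite /derivable /derive /= E => df; apply: DeriveDef.
Qed.

Section Composition.
Variables (R : realType) (m n : nat).
Implicit Types (U : set 'rV[R]_m) (V : set 'rV[R]_n).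

Lemma continuous_row (T : 'rV[R]_m -> 'rV[R]_n) x :
  (forall l, {for x, continuous (fun y => T y 0 l)}) -> {for x, continuous T}.
Proof.
move=> cT. apply/(@cvgrPdist_le _ _ _ _ (nbhs_filter x)) => e e0.
have H : \forall y \near x, forall l, `|T x 0 l - T y 0 l| <= e.
  have := @filter_forall _ 'I_n (fun l y => `|T x 0 l - T y 0 l| <= e) (nbhs x) (nbhs_filter x).
  by apply=> l; have /(@cvgrPdist_le _ _ _ _ (nbhs_filter x))/(_ _ e0) := cT l.
apply: filterS H => y Hy; rewrite [leLHS]/Num.norm/= mx_normrE.
by apply/bigmax_leP; split; [exact: ltW|move=> -[i j] _ /=; rewrite ord1 !mxE].
Qed.

(** The partial derivatives of [g \o T] are sums of products of partial
    derivatives of [T] with functions of the same form [g' \o T], which allows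
    an induction on the order of smoothness for all [g] at once. *)
Lemma smooth_comp U V (g : 'rV[R]_n -> R) (T : 'rV[R]_m -> 'rV[R]_n) :
  open U -> open V -> (forall x, U x -> V (T x)) ->
  (forall l, smooth_on U (fun x => T x 0 l)) -> smooth_on V g ->
  smooth_on U (g \o T).
Proof.
move=> oU oV UV sT + k; elim: k g => [|k IH] g sg.
  split=> // x Ux; apply: continuous_comp; last by have [c _] := sg 0%N; exact/c/UV.
  by apply: continuous_row => l; have [c _] := sT l 0%N; exact: c.
have D x i : U x -> is_derive x (delta_mx 0 i) (g \o T)
    (\sum_l 'D_(delta_mx 0 i) (fun y => T y 0 l) x * 'D_(delta_mx 0 l) g (T x)).
  move=> Ux; apply: derive_line => /=.
  have c0 : x + (0 : R) *: delta_mx 0 i = x by rewrite scale0r addr0.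
  rewrite (_ : \sum_l _ = grad g (T (x + (0 : R) *: delta_mx 0 i))
     (\row_l 'D_(delta_mx 0 i) (fun y => T y 0 l) x)); last first.
    by rewrite c0; apply: eq_bigr => l _; rewrite mxE.
  apply: (@curve_derive _ _ g (fun t => T (x + t *: delta_mx 0 i))).
    by rewrite c0; apply: (smooth_diff oV sg); exact: UV.
  move=> l; rewrite mxE; apply: (@line_derive _ _ (fun y => T y 0 l)).
  rewrite c0; apply: DeriveDef => //.
  by have [_ /(_ i)[d _]] := sT l 1%N; exact: d.
split=> [x Ux|i].
  apply: continuous_comp; last by have [c _] := sg 0%N; exact/c/UV.
  by apply: continuous_row => l; have [c _] := sT l 0%N; exact: c.
split=> [x Ux|]; first by have [] := D x i Ux.
apply: (@Ck_eq _ _ k U (fun x => \sum_l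
    'D_(delta_mx 0 i) (fun y => T y 0 l) x * 'D_(delta_mx 0 l) g (T x))) => //.
  by move=> x Ux; have [_ ->] := D x i Ux.
apply: Ck_sum => // l; apply: CkM => //; first exact: (smooth_on_D i (sT l)).
by apply: (IH ('D_(delta_mx 0 l) g)); exact: smooth_on_D.
Qed.

End Composition.

(** * Bump functions *)

Section Bump.
Variable R : realType.

(** The family of all [t^-m * exp (- 1 / t)] is used because the derivative of
    each member is a combination of others ([flat_derive]): smoothness follows
    by induction for all [m] together. *)
Definition flat (m : nat) (t : R) : R :=
  if 0 < t then t^-1 ^+ m * expR (- t^-1) else 0.

Lemma flat_ge0 m t : 0 <= flat m t.
Proof. by rewrite /flat; case: ifP => // t0; rewrite mulr_ge0 ?expR_ge0// exprn_ge0// invr_ge0 ltW. Qed.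

Lemma flat_le0 m t : t <= 0 -> flat m t = 0.
Proof. by rewrite /flat ltNge => ->. Qed.

(** A linear bound near 0 suffices: applied to [flat m.+1], which is the
    difference quotient of [flat m] at 0, it shows that the derivative at 0
    is 0. *)
Lemma flat_le m t : 0 <= t -> flat m t <= (m.+1)`!%:R * t.
Proof.
rewrite le_eqVlt => /predU1P[<-|t0]; first by rewrite flat_le0// mulr0.
rewrite /flat t0; set s := t^-1; have s0 : 0 < s by rewrite invr_gt0.
have k0 : 0 < (m.+1)`!%:R :> R by rewrite ltr0n fact_gt0.
have H : s ^+ m.+1 / (m.+1)`!%:R <= expR s.
  by apply: le_trans (expR_ge1Dxn m (ltW s0)); rewrite lerDr.
rewrite expRN ler_pdivrMr ?expR_gt0//.
have -> : s ^+ m = s ^+ m.+1 / (m.+1)`!%:R * ((m.+1)`!%:R * t).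
  by rewrite mulrA divfK ?gt_eqF// exprSr -mulrA /s mulVf ?mulr1// gt_eqF.
by rewrite mulrC ler_wpM2l// mulr_ge0 ?ltW.
Qed.

Lemma flat_derive m t : is_derive t (1 : R) (flat m) (- m%:R * flat m.+1 t + flat m.+2 t).
Proof.
have [t0|t0|<-] := ltgtP 0 t.
- have E : \forall s \near t, (fun s : R => s^-1 ^+ m * expR (- s^-1)) s = flat m s.
    near=> s; have s0 : 0 < s by near: s; exact: lt_nbhsr.
    by rewrite /flat s0.
  apply: near_eq_is_derive E _.
  have tn0 : t != 0 by rewrite gt_eqF.
  have dV : is_derive t (1 : R) (fun s : R => s^-1) (- t ^- 2 *: (1 : R)).
    exact: is_deriveV.
  have dX := is_deriveX m dV.
  have dN : is_derive t (1 : R) (fun s : R => - s^-1) _ := is_deriveN dV.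
  have dE : is_derive t (1 : R) (fun s : R => expR (- s^-1)) _ :=
    @is_derive1_comp _ expR (fun s : R => - s^-1) t _ _ (is_derive_expR _) dN.
  have dM := is_deriveM dX dE.
  rewrite (_ : (fun s : R => _) = [eta GRing.inv] ^+ m * (fun s : R => expR (- s^-1))); last first.
    by apply/funext => s; rewrite mulrfctE exprfctE.
  apply: (is_derive_eq dM).
  rewrite /flat t0 /GRing.scale/= !mulr1.
  rewrite exprfctE; clear dX dN dE dM dV; case: m => [|m] /=; rewrite -?exprVn.
    by rewrite !expr0; ring.
  by rewrite !exprS; ring.
- have E : \forall s \near t, cst 0 s = flat m s.
    near=> s; have s0 : s < 0 by near: s; exact: lt_nbhsl.
    by rewrite flat_le0// ltW.
  rewrite !flat_le0 ?(ltW t0)// mulr0 addr0.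
  exact: near_eq_is_derive E _.
rewrite !flat_le0// mulr0 addr0.
have L : (fun h => h^-1 *: ((flat m \o shift (0 : R)) (h *: (1 : R)) - flat m 0)) @ (0 : R)^' --> (0 : R).
  apply/cvgrPdist_le => e e0.
  near=> h; rewrite /= sub0r normrN (flat_le0 _ (lexx 0)) subr0 addr0 [h *: _]mulr1.
  have [h0|h0] := leP h 0; first by rewrite flat_le0// scaler0 normr0 ltW.
  have -> : h^-1 *: flat m h = flat m.+1 h.
    by rewrite /flat h0 /GRing.scale/= mulrA -exprS.
  rewrite ger0_norm ?flat_ge0//; apply: le_trans (flat_le _ (ltW h0)) _.
  have c0 : 0 < (m.+2)`!%:R :> R by rewrite ltr0n fact_gt0.
  rewrite -ler_pdivlMl//.
  have : `|h| <= ((m.+2)`!%:R)^-1 * e.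
    near: h; apply: dnbhs0_le; rewrite mulr_gt0// invr_gt0//.
  by rewrite ger0_norm// ltW.
apply: DeriveDef; first by apply/cvg_ex; exists 0.
exact: cvg_lim L.
Unshelve. all: by end_near. Qed.

Lemma derive_comp1 (V : normedModType R) (F : R -> R) (h : V -> R) (x v : V) (F' h' : R) :
  is_derive (h x) (1 : R) F F' -> is_derive x v h h' ->
  is_derive x v (F \o h) (F' * h').
Proof.
move=> dF dh; apply: derive_line => /=.
have dh0 : is_derive (0 : R) (1 : R) (fun t : R => h (x + t *: v)) h'.
  by apply: line_derive; rewrite scale0r addr0.
have dF0 : is_derive (h (x + (0 : R) *: v)) (1 : R) F F' by rewrite scale0r addr0.
rewrite mulrC; have := @is_derive1_comp _ F (fun t : R => h (x + t *: v)) 0 F' h' dF0 dh0.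
by rewrite mulrC.
Qed.

Variable n : nat.

Lemma flat_smooth U (h : 'rV[R]_n -> R) m : open U -> smooth_on U h ->
  smooth_on U (flat m \o h).
Proof.
move=> oU sh k; elim: k m => [|k IH] m.
  split=> // x Ux; apply: continuous_comp; first by have [c _] := sh 0%N; exact: c.
  apply: differentiable_continuous; apply/derivable1_diffP.
  by have [] := flat_derive m (h x).
split=> [x Ux|i].
  apply: continuous_comp; first by have [c _] := sh 0%N; exact: c.
  apply: differentiable_continuous; apply/derivable1_diffP.
  by have [] := flat_derive m (h x).
have D x : U x -> is_derive x (delta_mx 0 i) (flat m \o h)
    ((- m%:R * flat m.+1 (h x) + flat m.+2 (h x)) * 'D_(delta_mx 0 i) h x).
  move=> Ux; apply: derive_comp1 (flat_derive m (h x)) _; apply: DeriveDef => //.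
  by have [_ /(_ i)[d _]] := sh 1%N; exact: d.
split=> [x Ux|]; first by have [] := D x Ux.
apply: (Ck_eq oU (f := (fun x => (cst (- m%:R) x * (flat m.+1 \o h) x + (flat m.+2 \o h) x)) \* 'D_(delta_mx 0 i) h)).
  by move=> x Ux; have [_ ->] := D x Ux.
apply: CkM => //; last exact: (smooth_on_D i sh).
by apply: CkD => //; apply: CkM => //; exact: Ck_cst.
Qed.

(** The norm of ['rV[R]_n] is the sup norm, whose square is not smooth. *)
Definition dist2 (x y : 'rV[R]_n) : R := \sum_i (x 0 i - y 0 i) ^+ 2.

Lemma dist2_smooth c U : open U -> smooth_on U (dist2 ^~ c).
Proof.
move=> oU; apply: smooth_on_sum => // i k.
have := CkB oU (smooth_on_coord U i k) (@Ck_cst _ _ k U (c 0 i)).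
by move=> H; have := CkM oU H H; apply: Ck_eq => // x _ /=; rewrite expr2.
Qed.

Lemma dist2_ge0 x y : 0 <= dist2 x y.
Proof. by apply: sumr_ge0 => i _; exact: sqr_ge0. Qed.

Lemma dist2xx x : dist2 x x = 0.
Proof. by rewrite /dist2 big1// => i _; rewrite subrr expr0n. Qed.

Lemma norm_le_dist2 x y (r : R) : 0 <= r -> dist2 x y <= r ^+ 2 -> `|x - y| <= r.
Proof.
move=> r0 H; rewrite [leLHS]/Num.norm/= mx_normrE.
apply/bigmax_leP; split => // -[i j] _ /=; rewrite ord1 !mxE.
rewrite -(@ler_pXn2r _ 2)// ?nnegrE// real_normK ?num_real//.
apply: le_trans H; rewrite /dist2 (bigD1 j)//= lerDl; apply: sumr_ge0 => *.
exact: sqr_ge0.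
Qed.

Definition bumpf (c : 'rV[R]_n) (r : R) (x : 'rV[R]_n) : R := flat 0 (r ^+ 2 - dist2 x c).

Lemma bumpf_smooth c r : smooth_on setT (bumpf c r).
Proof.
apply: (@flat_smooth _ (fun x => r ^+ 2 - dist2 x c)); first exact: openT.
move=> k; apply: CkB; [exact: openT|exact: Ck_cst|].
by apply: dist2_smooth; exact: openT.
Qed.

Lemma bumpf_gt0 c r : 0 < r -> 0 < bumpf c r c.
Proof.
move=> r0; rewrite /bumpf /flat dist2xx subr0 exprn_gt0//.
by rewrite expr0 mul1r expR_gt0.
Qed.

Lemma bumpf_ge0 c r x : 0 <= bumpf c r x. Proof. exact: flat_ge0. Qed.

Lemma bumpf_out c r x : 0 <= r -> r < `|x - c| -> bumpf c r x = 0.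
Proof.
move=> r0 rx; rewrite /bumpf flat_le0// subr_le0 leNgt; apply/negP => /ltW.
by move/(norm_le_dist2 r0); rewrite leNgt rx.
Qed.

End Bump.

(** * Hadamard's lemma *)

Lemma affine_derive (R : realType) (b c s : R) :
  is_derive s (1 : R) (fun t : R => b + t * c) c.
Proof.
have H := is_deriveD (is_derive_cst b s (1 : R))
  (is_deriveM (is_derive_id s (1 : R)) (is_derive_cst c s (1 : R))).
by apply: (is_derive_eq H); rewrite /GRing.scale/=; ring.
Qed.

Section Hadamard.
Variables (R : realType) (n : nat).
Implicit Types (f g : 'rV[R]_n -> R) (a x y : 'rV[R]_n).

Definition cball a (r : R) : set 'rV[R]_n := [set y | `|y - a| <= r].

Lemma cball_closed a r : closed (cball a r).
Proof.
rewrite (_ : cball a r = (fun y => `|y - a|) @^-1` [set t | t <= r]).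
  apply: preimage_closed; last exact: closed_le.
  move=> y _; apply: continuous_comp; last exact: norm_continuous.
  by apply: continuousB => //; exact: cst_continuous.
by [].
Qed.

Lemma cball_compact a r : compact (cball a r).
Proof.
apply: bounded_closed_compact (@cball_closed a r).
exists (r + `|a|); split; first exact: num_real.
move=> M rM y /= yr; apply: le_trans (ltW rM).
rewrite -[y in leLHS](subrK a); apply: le_trans (ler_normD _ _) _.
exact: lerD.
Qed.

Lemma continuous_bounded f r : continuous f ->
  exists2 C, 0 <= C & forall y, `|y| <= r -> `|f y| <= C.
Proof.
move=> cf; have K := @cball_compact 0 r.
have /compact_bounded[M [_ HM]] : compact (f @` cball 0 r).
  by apply: continuous_compact => //; exact: continuous_subspaceT.
exists (`|M| + 1); first by rewrite addr_ge0.
move=> y yr; apply: (HM (`|M| + 1)); first by rewrite ltr_pwDr ?ler_norm.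
by exists y => //; rewrite /cball/= subr0.
Qed.

Lemma smooth_continuous g : smooth_on setT g -> continuous g.
Proof. by move=> sg x; have [c _] := sg 0%N; exact: c. Qed.

(** The uniform modulus of continuity that makes averages continuous; the ball
    is convex, so the mean value theorem applies on its segments. *)
Lemma lipschitz_ball g r : smooth_on setT g ->
  exists2 C, 0 <= C &
    forall x y, `|x| <= r -> `|y| <= r -> `|g x - g y| <= C * `|x - y|.
Proof.
move=> sg.
have H i := @continuous_bounded ('D_(delta_mx 0 i) g) r
  (smooth_continuous (smooth_on_D i sg)).
have [C HC] : exists C : 'I_n -> R, forall i, 0 <= C i /\
    forall y, `|y| <= r -> `|'D_(delta_mx 0 i) g y| <= C i.
  have /choice[C HC] : forall i, exists Ci, 0 <= Ci /\
    forall y, `|y| <= r -> `|'D_(delta_mx 0 i) g y| <= Ci.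
    by move=> i; have [Ci ? ?] := H i; exists Ci.
  by exists C.
exists (\sum_i C i); first by apply: sumr_ge0 => i _; have [] := HC i.
move=> x y xr yr.
have D s : is_diff (y + s *: (x - y)) g (grad g (y + s *: (x - y))).
  by apply: (smooth_diff openT sg).
have Dv s : is_derive s (1 : R) (fun t : R => g (y + t *: (x - y)))
    (grad g (y + s *: (x - y)) (x - y)).
  apply: curve_derive => // i.
  have -> : (fun t : R => (y + t *: (x - y)) 0 i) =
      (fun t : R => y 0 i + t * (x - y) 0 i).
    by apply/funext => t; rewrite !mxE.
  exact: affine_derive.
have cF : {within `[0, 1], continuous (fun t : R => g (y + t *: (x - y)))}.
  by apply: derivable_within_continuous => s _; have [] := Dv s.
have [c c01] := MVT_segment ler01 (fun s _ => Dv s) cF.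
rewrite subr0 mulr1 scale1r scale0r addr0 (addrC y) subrK => ->.
apply: le_trans (grad_le _ _ _) _; rewrite ler_wpM2r//; apply: ler_sum => i _.
have [_] := HC i; apply.
have -> : y + c *: (x - y) = (1 - c) *: y + c *: x.
  by rewrite scalerBr scalerBl scale1r addrCA addrC.
move: c01; rewrite in_itv/= => /andP[c0 c1].
apply: le_trans (ler_normD _ _) _; rewrite !normrZ !ger0_norm ?subr_ge0//.
have -> : r = (1 - c) * r + c * r by ring.
by apply: lerD; apply: ler_wpM2l; rewrite ?subr_ge0.
Qed.

Variable a : 'rV[R]_n.
Let I01 : set R := `[0, 1]%classic.
Let pt x (t : R) := a + t *: (x - a).

(** The mean of [g] on the segment from [a] to [x], with weight [t ^+ m]: each
    derivation in [x] brings out one factor [t], by the chain rule, so that the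
    partial derivatives of averages are averages ([average_derive]). *)
Definition average m g x : R :=
  \int[lebesgue_measure]_(t in I01) (t ^+ m * g (pt x t)).

Let mI : measurable (I01 : set (measurableTypeR R)). Proof. exact: measurable_itv. Qed.

Let pt_norm x t : I01 t -> `|pt x t| <= `|a| + `|x - a|.
Proof.
rewrite /I01/= in_itv/= => /andP[t0 t1].
apply: le_trans (ler_normD _ _) _; rewrite lerD2l normrZ ger0_norm//.
by rewrite ler_piMl.
Qed.

Let integrand_cont m g x : smooth_on setT g ->
  continuous (fun t : R => t ^+ m * g (pt x t)).
Proof.
move=> sg t; apply: cvgM; first exact: exprn_continuous.
apply: continuous_comp; last exact: smooth_continuous.
apply: cvgD; first exact: cvg_cst.
by apply: cvgZr_tmp; exact: cvg_id.
Qed.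

Let integrand_int m g x : smooth_on setT g ->
  lebesgue_measure.-integrable I01 (EFin \o (fun t : R => t ^+ m * g (pt x t))).
Proof.
move=> sg; apply: continuous_compact_integrable; first exact: segment_compact.
by apply: continuous_subspaceT; exact: integrand_cont.
Qed.

(** Differentiation under the integral sign, the derivative of the integrand
    being bounded near [x] by compactness. *)
Lemma average_derive m g x i : smooth_on setT g ->
  is_derive x (delta_mx 0 i) (average m g) (average m.+1 ('D_(delta_mx 0 i) g) x).
Proof.
move=> sg; apply: derive_line.
set e := delta_mx 0 i.
pose f (s t : R) := t ^+ m * g (pt (x + s *: e) t).
have gradE p t : grad g p (t *: e) = t * 'D_e g p.
  rewrite /grad (bigD1 i)//= big1 ?addr0; first by rewrite !mxE !eqxx mulr1.
  by move=> j ji; rewrite !mxE eqxx (negbTE ji) mulr0 mul0r.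
have df s t : is_derive s (1 : R) (f ^~ t) (t ^+ m.+1 * 'D_e g (pt (x + s *: e) t)).
  have D : is_derive s (1 : R) (fun s => g (pt (x + s *: e) t))
      (grad g (pt (x + s *: e) t) (t *: e)).
    apply: (@curve_derive _ _ g (fun s => pt (x + s *: e) t)).
      exact: (smooth_diff openT sg).
    move=> j; have -> : (fun u : R => pt (x + u *: e) t 0 j) =
        (fun u : R => (a 0 j + t * (x 0 j - a 0 j)) + u * (t *: e) 0 j).
      by apply/funext => u; rewrite /pt !mxE; ring.
    exact: affine_derive.
  have := @is_deriveZ _ _ _ _ (t ^+ m) _ _ _ D.
  by rewrite gradE exprSr -mulrA.
have I0 : [set` `]-1, 1[ ] (0 : R) by rewrite /= in_itv/= ltrN10 ltr01.
have sD : smooth_on setT ('D_e g) := smooth_on_D i sg.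
have [C C0 HC] := @continuous_bounded _ (`|a| + (`|x - a| + 1)) (smooth_continuous sD).
have ub s t : [set` `]-1, 1[ ] s -> I01 t -> `|partial1of2 f s t| <= cst C t.
  move=> s1 t1; rewrite partial1of2E; have [_ ->] := df s t.
  rewrite normrM -[leRHS]mul1r; apply: ler_pM => //.
    move: t1; rewrite /I01/= in_itv/= => /andP[t0 t1].
    by rewrite ger0_norm ?exprn_ge0// exprn_ile1.
  apply: HC; apply: le_trans (pt_norm _ t1) _; rewrite lerD2l addrAC.
  apply: le_trans (ler_normD _ _) _; rewrite lerD2l normrZ -[leRHS]mul1r.
  apply: ler_pM => //; last exact: norm_delta.
  by move: s1; rewrite /= in_itv/= ler_norml => /andP[/ltW-> /ltW->].
have intf s : [set` `]-1, 1[ ] s -> lebesgue_measure.-integrable I01 (EFin \o f s).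
  by move=> _; exact: integrand_int.
have intC : lebesgue_measure.-integrable I01 (EFin \o cst C).
  apply: continuous_compact_integrable; first exact: segment_compact.
  by apply: continuous_subspaceT; exact: cst_continuous.
have dv s t : [set` `]-1, 1[ ] s -> I01 t -> derivable (f ^~ t) s 1.
  by move=> _ _; have [] := df s t.
have C0' (t : R) : 0 <= cst C t by [].
have H1 := derivable_under_integral (mu := lebesgue_measure) mI I0 intf dv C0' intC ub.
have H2 := differentiation_under_integral (mu := lebesgue_measure) mI I0 intf dv C0' intC ub.
apply: DeriveDef; first exact: H1.
rewrite -derive1E H2; apply: eq_Rintegral => t _.
by rewrite partial1of2E; have [_ ->] := df 0 t; rewrite scale0r addr0.
Qed.

Lemma average_continuous m g : smooth_on setT g -> continuous (average m g).
Proof.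
move=> sg x; have [C C0 HC] := @lipschitz_ball g (`|a| + (`|x - a| + 1)) sg.
apply/(@cvgrPdist_le _ _ _ _ (nbhs_filter x)) => e e0.
have d0 : 0 < Num.min 1 (e / (C + 1)).
  by rewrite lt_min ltr01 divr_gt0// ltr_wpDl.
apply/nbhs_ballP; exists (Num.min 1 (e / (C + 1))) => // y; rewrite -ball_normE/=.
rewrite lt_min => /andP[xy1 xye].
rewrite /average -RintegralB//; [|exact: integrand_int..].
have iB : lebesgue_measure.-integrable I01
    (EFin \o (fun t => t ^+ m * g (pt x t) - t ^+ m * g (pt y t))).
  have := integrableB mI (integrand_int m x sg) (integrand_int m y sg).
  by apply: eq_integrable => // t _; rewrite /= EFinB.
apply: le_trans (le_normr_Rintegral mI iB) _.
have le1 t : I01 t -> `|t ^+ m * g (pt x t) - t ^+ m * g (pt y t)| <= e.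
  move=> t1; have := t1; rewrite /I01/= in_itv/= => /andP[t0 t1'].
  rewrite -mulrBr normrM ger0_norm ?exprn_ge0//.
  have H : `|g (pt x t) - g (pt y t)| <= C * `|pt x t - pt y t|.
    apply: HC; (apply: le_trans (pt_norm _ t1) _; rewrite lerD2l).
      by rewrite lerDl.
    rewrite -[y](subrK x) -addrA addrC; apply: le_trans (ler_normD _ _) _.
    by rewrite lerD2l distrC ltW.
  have E : `|pt x t - pt y t| <= `|x - y|.
    rewrite /pt opprD addrACA subrr add0r -scalerBr opprB addrA subrK.
    by rewrite normrZ ger0_norm// ler_piMl.
  apply: (@le_trans _ _ (1 * (C * (e / (C + 1))))).
    apply: ler_pM; rewrite ?exprn_ge0 ?exprn_ile1//.
    apply: le_trans H _; apply: ler_pM => //.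
    by apply: le_trans E _; exact: ltW.
  rewrite mul1r mulrCA -[leRHS]mulr1 ler_pM2l// ler_pdivrMr ?mul1r ?lerDl//.
  by rewrite ltr_wpDl.
have intC : lebesgue_measure.-integrable I01 (EFin \o cst e).
  apply: continuous_compact_integrable; first exact: segment_compact.
  by apply: continuous_subspaceT; exact: cst_continuous.
have iN := integrable_norm iB.
apply: le_trans (le_Rintegral mI iN intC le1) _.
have m1 : @lebesgue_measure R I01 = 1%E.
  by rewrite lebesgue_measure_itv/= lte01 oppr0 addr0.
rewrite Rintegral_cst//; have -> : fine (@lebesgue_measure R I01) = 1 by rewrite m1.
by rewrite mulr1.
Qed.

Lemma average_smooth m g : smooth_on setT g -> smooth_on setT (average m g).
Proof.
move=> + k; elim: k m g => [|k IH] m g sg.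
  by split=> // x _; exact: average_continuous.
split=> [x _|i]; first exact: average_continuous.
have D x := average_derive m x i sg.
split=> [x _|]; first by have [] := D x.
apply: (Ck_eq openT) (IH m.+1 _ (smooth_on_D i sg)) => x _.
by have [_ ->] := D x.
Qed.

(** The quotients are the averages of the partial derivatives: integrate the
    derivative of [t |-> g (a + t (x - a))] from 0 to 1. *)
Lemma hadamard g : smooth_on setT g ->
  exists2 q : 'I_n -> 'rV[R]_n -> R, forall i, smooth_on setT (q i) &
    forall x, g x = g a + \sum_i (x 0 i - a 0 i) * q i x.
Proof.
move=> sg; exists (fun i => average 0 ('D_(delta_mx 0 i) g)).
  by move=> i; apply/average_smooth/smooth_on_D.
move=> x.
have Dv s : is_derive s (1 : R) (fun t : R => g (pt x t)) (grad g (pt x s) (x - a)).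
  apply: curve_derive; first exact: (smooth_diff openT sg).
  move=> i; have -> : (fun t : R => pt x t 0 i) = (fun t : R => a 0 i + t * (x - a) 0 i).
    by apply/funext => t; rewrite !mxE.
  exact: affine_derive.
pose G t := grad g (pt x t) (x - a).
have GE t : G t = \sum_i (x 0 i - a 0 i) * (t ^+ 0 * 'D_(delta_mx 0 i) g (pt x t)).
  by apply: eq_bigr => i _; rewrite !mxE expr0 mul1r.
pose h i t := (x 0 i - a 0 i) * (t ^+ 0 * 'D_(delta_mx 0 i) g (pt x t)).
have hc i : continuous (h i).
  move=> t; apply: cvgM; first exact: cvg_cst.
  exact: (@integrand_cont 0 _ x (smooth_on_D i sg)).
have hint (r : seq 'I_n) :
    lebesgue_measure.-integrable I01 (EFin \o (fun t => \sum_(i <- r) h i t)) /\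
    \sum_(i <- r) \int[lebesgue_measure]_(t in I01) h i t =
    \int[lebesgue_measure]_(t in I01) \sum_(i <- r) h i t.
  have cint (f : R -> R) : continuous f -> lebesgue_measure.-integrable I01 (EFin \o f).
    move=> cf; apply: continuous_compact_integrable; first exact: segment_compact.
    exact: continuous_subspaceT.
  elim: r => [|i r [IH1 IH2]].
    split; first by apply: cint => t; under eq_fun do rewrite big_nil; exact: cvg_cst.
    rewrite big_nil; under eq_Rintegral do rewrite big_nil.
    by rewrite Rintegral_cst// mul0r.
  have iD := integrableD mI (cint _ (hc i)) IH1.
  split.
    by apply: eq_integrable iD => // t _; rewrite /= big_cons EFinD.
  rewrite big_cons IH2 -RintegralD//; last exact: cint.
  by apply: eq_Rintegral => t _; rewrite big_cons.
have E : \sum_i (x 0 i - a 0 i) * average 0 ('D_(delta_mx 0 i) g) x =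
    \int[lebesgue_measure]_(t in I01) G t.
  rewrite (eq_bigr (fun i => \int[lebesgue_measure]_(t in I01) h i t)).
    by rewrite (hint _).2; apply: eq_Rintegral => t _; rewrite GE.
  by move=> i _; rewrite /average -RintegralZl//; have := @integrand_int 0 _ x (smooth_on_D i sg); apply.
have cG : {within `[0, 1], continuous G}.
  apply: continuous_subspaceT => t.
  rewrite (_ : G = (fun t => \sum_i h i t)); last by apply/funext => u; exact: GE.
  have H (r : seq 'I_n) : {for t, continuous (fun t => \sum_(i <- r) h i t)}.
    elim: r => [|i r IH]; rewrite /prop_for /continuous_at.
      by rewrite big_nil; under eq_fun do rewrite big_nil; exact: cvg_cst.
    rewrite big_cons; under eq_fun do rewrite big_cons.
    by apply: cvgD; [exact: hc|exact: IH].
  exact: H.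
have cP : continuous (fun t => g (pt x t)).
  by move=> t; apply: differentiable_continuous; apply/derivable1_diffP; have [] := Dv t.
have dF : derivable_oo_LRcontinuous (fun t => g (pt x t)) 0 1.
  split; [by move=> t _; have [] := Dv t|exact: cvg_at_right_filter (cP 0)|].
  exact: cvg_at_left_filter (cP 1).
have FG : {in `]0, 1[, derive1 (fun t => g (pt x t)) =1 G}.
  by move=> t _; rewrite derive1E; have [_ ->] := Dv t.
rewrite E /Rintegral (continuous_FTC2 ltr01 cG dF FG) /= /pt.
by rewrite scale1r scale0r addr0 (addrC a) [x - a + a]subrK [RHS]addrC subrK.
Qed.

End Hadamard.

(** * Extension by zero from a chart *)

Section Charts.
Variables (R : realType) (n : nat) (M : manifold R n).
Local Notation A := (Cinf M).
Implicit Types (i j : chart M).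

Definition chart_image (i : chart M) : set 'rV[R]_n := coord i @` dom i.

Lemma chart_image_param i y : chart_image i y -> dom i (param i y) /\ coord i (param i y) = y.
Proof. by move=> [p ip <-]; rewrite coordK. Qed.

Lemma coord_chart_image i (p : M) : dom i p -> chart_image i (coord i p).
Proof. by move=> ip; exists p. Qed.

Lemma near_chart_image i y : chart_image i y -> \forall z \near y, chart_image i z.
Proof. by move=> yi; exact: open_nbhs_nbhs (conj (@open_codom _ _ M i) yi). Qed.

Lemma near_dom i (p : M) : dom i p -> \forall q \near p, dom i q.
Proof. by move=> ip; exact: open_nbhs_nbhs (conj (@open_dom _ _ M i) ip). Qed.

Lemma near_param i y (P : set M) : chart_image i y -> nbhs (param i y) P ->
  \forall z \near y, P (param i z).
Proof. by move=> yi Py; exact: (continuous_param yi). Qed.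

Lemma near_coord i (p : M) (P : set 'rV[R]_n) : dom i p -> nbhs (coord i p) P ->
  \forall q \near p, P (coord i q).
Proof. by move=> yi Py; exact: (continuous_coord yi). Qed.

Lemma CinfP (u : A) : smooth (u : M -> R[i]).
Proof. by case: u => u su /=; exact/asboolP. Qed.

Lemma Re_smooth (u : A) i : smooth_on (chart_image i) (fun y => complex.Re (u (param i y))).
Proof. by have [] := CinfP u i. Qed.

Lemma Im_smooth (u : A) i : smooth_on (chart_image i) (fun y => complex.Im (u (param i y))).
Proof. by have [] := CinfP u i. Qed.

Lemma chart_ball i (p : M) : dom i p -> exists2 r, 0 < r & cball (coord i p) r `<=` chart_image i.
Proof.
move=> /coord_chart_image/near_chart_image /nbhs_ballP[r /= r0 H].
exists (r / 2); first by rewrite divr_gt0.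
move=> y /= yr; apply: H; rewrite -ball_normE/= distrC.
by apply: le_lt_trans yr _; rewrite ltr_pdivrMr// ltr_pMr// ltr1n.
Qed.

Section Extension.
Variables (i : chart M) (c : 'rV[R]_n) (r : R).
Hypotheses (r0 : 0 < r) (rK : cball c r `<=` chart_image i).

Definition extend (g : 'rV[R]_n -> R) (p : M) : R :=
  if `[< dom i p >] then g (coord i p) else 0.

Let image_closed : closed (param i @` cball c r).
Proof.
apply: compact_closed; first exact: hausdorff_points.
apply: continuous_compact; last exact: cball_compact.
apply: continuous_in_subspaceT => y /set_mem yK.
by apply: continuous_param; exact: rK.
Qed.

(** Near a point outside the domain of the chart [i], the extension vanishes
    because the compact image of the ball is closed in the Hausdorff space
    [M]. *)
Lemma extend_smooth g j : smooth_on setT g -> (forall y, ~ cball c r y -> g y = 0) ->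
  smooth_on (chart_image j) (fun y => extend g (param j y)).
Proof.
move=> sg g0 k; apply: Ck_local => y yj.
have [ip|nip] := pselect (dom i (param j y)).
- pose W := coord j @` (dom j `&` dom i).
  have oW : open W.
    rewrite openE => z [q [jq iq] <-].
    have zj := coord_chart_image jq.
    have H : \forall z' \near coord j q, dom i (param j z').
      by apply: near_param => //; rewrite coordK//; exact: near_dom.
    apply: filterS2 (near_chart_image zj) H => z' z'j z'i.
    have [? E] := chart_image_param z'j.
    by exists (param j z').
  exists W; first by have [jy yE] := chart_image_param yj; exists (param j y).
  have H := @smooth_comp _ _ _ W setT g (fun z => coord i (param j z)) oW openT
    (fun _ _ => I) (fun l => @smooth_transition _ _ M j i l) sg.
  apply: (Ck_eq oW) (H k) => z [q [jq iq] <-].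
  by rewrite /extend /= coordK// asboolT.
pose W := [set z | chart_image j z /\ ~ (param i @` cball c r) (param j z)].
have oW : open W.
  rewrite openE => z [zj nz].
  have H : \forall z' \near z, ~ (param i @` cball c r) (param j z').
    apply: (near_param (P := ~` (param i @` cball c r))) => //.
    by apply: open_nbhs_nbhs; split => //; exact: closed_openC.
  by apply: filterS2 (near_chart_image zj) H.
exists W.
  split=> // -[x xK E]; apply: nip; rewrite -E.
  by have [] := chart_image_param (rK xK).
apply: (Ck_eq oW) (@Ck_cst _ _ k W 0) => z [zj nz].
rewrite /extend; case: asboolP => // iz; rewrite g0// => K; apply: nz.
by exists (coord i (param j z)) => //; rewrite coordK.
Qed.

Local Notation phi := (bumpf c r).

Let phi_out y : ~ cball c r y -> phi y = 0.
Proof. by move=> /negP; rewrite -ltNge; apply: bumpf_out; exact: ltW. Qed.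

(** Global functions form a subtype, so that the default value of [insubd] is
    met only when the extension is not smooth, which [globalizeE] excludes for
    smooth [g]. *)
Definition globalize (g : 'rV[R]_n -> R) : A :=
  insubd 0 (fun p : M => (extend (phi \* g) p)%:C : R[i]).

Lemma globalizeE g p : smooth_on setT g -> globalize g p = (extend (phi \* g) p)%:C.
Proof.
move=> sg; rewrite /globalize /insubd insubT//.
apply/asboolP => j; split => /=.
  apply: extend_smooth; first exact: smooth_onM openT (@bumpf_smooth _ _ _ _) sg.
  by move=> y /phi_out /= ->; rewrite mul0r.
by move=> k; exact: Ck_cst.
Qed.

Lemma globalize_dom g p : smooth_on setT g -> dom i p ->
  globalize g p = (phi (coord i p) * g (coord i p))%:C.
Proof. by move=> sg ip; rewrite globalizeE// /extend asboolT. Qed.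

Lemma globalize_out g p : smooth_on setT g -> ~ dom i p -> globalize g p = 0.
Proof. by move=> sg ip; rewrite globalizeE// /extend asboolF. Qed.

Lemma globalize_real g : smooth_on setT g -> real_fun (globalize g).
Proof. by move=> sg p; rewrite globalizeE. Qed.

Lemma globalize_sum m (g : 'I_m -> 'rV[R]_n -> R) : (forall l, smooth_on setT (g l)) ->
  forall p, globalize (fun x => \sum_l g l x) p = \sum_l globalize (g l) p.
Proof.
move=> sg p; have sS := smooth_on_sum openT sg.
have [ip|nip] := pselect (dom i p); last first.
  by rewrite globalize_out// big1// => l _; rewrite globalize_out.
rewrite globalize_dom// mulr_sumr rmorph_sum; apply: eq_bigr => l _.
by rewrite globalize_dom.
Qed.

(** Both sides carry the factor [phi^2]; without [globalize (cst 1)] the left one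
    would have only one factor [phi]. *)
Lemma globalizeM g h p : smooth_on setT g -> smooth_on setT h ->
  globalize (cst 1) p * globalize (g \* h) p = globalize g p * globalize h p.
Proof.
move=> sg sh; have s1 : smooth_on setT (cst 1 : 'rV[R]_n -> R).
  by move=> k; exact: Ck_cst.
have sgh : smooth_on setT (g \* h) := smooth_onM openT sg sh.
have [ip|nip] := pselect (dom i p); last by rewrite !globalize_out// !mulr0.
by rewrite !globalize_dom// -!rmorphM/=; congr (_%:C); ring.
Qed.

(** The inverse passage to [globalize]: a function that is smooth only on the image
    of the chart becomes smooth on the whole coordinate space. *)
Definition cutoff (g : 'rV[R]_n -> R) := phi \* g.

Lemma cutoff_smooth g : smooth_on (chart_image i) g -> smooth_on setT (cutoff g).
Proof.
move=> sg k; apply: Ck_local => y _.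
have [yi|nyi] := pselect (chart_image i y).
  exists (chart_image i) => //; apply: CkM; [exact: open_codom| |exact: sg].
  by apply: (@CkW _ _ _ setT) => //; exact: bumpf_smooth.
exists (~` cball c r); first by move=> /rK.
apply: (Ck_eq _) (@Ck_cst _ _ k _ 0) => [|z /phi_out zE].
  exact/closed_openC/cball_closed.
by rewrite /cutoff /= zE mul0r.
Qed.

End Extension.
End Charts.

(** * Values of smooth functions *)

Section Functions.
Variables (R : realType) (n : nat) (M : manifold R n).
Local Notation A := (Cinf M).
Implicit Types (f g u : A) (p : M) (X : Vec M).

Lemma CinfPext f g : (forall p, f p = g p) -> f = g.
Proof. by move=> fg; apply/val_inj/funext. Qed.

Lemma evD f g p : (f + g) p = f p + g p. Proof. by []. Qed.
Lemma evN f p : (- f) p = - f p. Proof. by []. Qed.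
Lemma evB f g p : (f - g) p = f p - g p. Proof. by []. Qed.
Lemma evM f g p : (f * g) p = f p * g p. Proof. by []. Qed.
Lemma ev0 p : (0 : A) p = 0. Proof. by []. Qed.
Lemma ev1 p : (1 : A) p = 1. Proof. by []. Qed.
Lemma evC (c : R[i]) p : (c%:Cst : A) p = c. Proof. by []. Qed.
Lemma evX f k p : (f ^+ k) p = f p ^+ k.
Proof. by elim: k => [|k IH] //; rewrite !exprS evM IH. Qed.
Lemma ev_sum m (F : 'I_m -> A) p : (\sum_i F i) p = \sum_i F i p.
Proof. exact: (big_morph (fun f : A => f p) (fun f g => evD f g p) (ev0 p)). Qed.
Definition evE := (evD, evN, evM, ev0, ev1, evC, evX).

Lemma CstN (c : R[i]) : (- c)%:Cst = - c%:Cst :> A.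
Proof. exact: CinfPext. Qed.
Lemma CstM (c d : R[i]) : (c * d)%:Cst = c%:Cst * d%:Cst :> A.
Proof. exact: CinfPext. Qed.
Lemma Cst1 : 1%:Cst = 1 :> A. Proof. exact: CinfPext. Qed.
Lemma Cst0 : 0%:Cst = 0 :> A. Proof. exact: CinfPext. Qed.

Lemma VecM X f g : X (f * g) = X f * g + f * X g.
Proof. by have [_ ->] := VecP X. Qed.

Lemma Vec0 X : X 0 = 0.
Proof. by apply: (addrI (X 0)); rewrite -VecD !addr0. Qed.

Lemma VecZ X c f : X (c%:Cst * f) = c%:Cst * X f.
Proof. by have [l _] := VecP X; have := l c f 0; rewrite Vec0 !addr0. Qed.

Lemma VecN X f : X (- f) = - X f.
Proof. by apply: (addrI (X f)); rewrite -VecD !subrr Vec0. Qed.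

Lemma VecB X f g : X (f - g) = X f - X g.
Proof. by rewrite VecD VecN. Qed.

Lemma Vec1 X : X 1 = 0.
Proof.
have := VecM X 1 1; rewrite !mulr1 mul1r => H.
by apply: (addrI (X 1)); rewrite -H addr0.
Qed.

Lemma VecC X c : X c%:Cst = 0.
Proof. by rewrite -[c%:Cst]mulr1 VecZ Vec1 mulr0. Qed.

Lemma Vec_sum m (F : 'I_m -> A) X : X (\sum_i F i) = \sum_i X (F i).
Proof. exact: (big_morph X (VecD X) (Vec0 X)). Qed.

Lemma real_funE f p : real_fun f -> f p = (complex.Re (f p))%:C.
Proof. by move=> rf; move: (rf p); case: (f p) => a b /= ->. Qed.

Lemma real_funD f g : real_fun f -> real_fun g -> real_fun (f + g).
Proof. by move=> rf rg p; rewrite evD real_funE// (real_funE p rg)/= addr0. Qed.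
Lemma real_funN f : real_fun f -> real_fun (- f).
Proof. by move=> rf p; rewrite evN real_funE//= oppr0. Qed.
Lemma real_funB f g : real_fun f -> real_fun g -> real_fun (f - g).
Proof. by move=> rf rg; apply: real_funD => //; exact: real_funN. Qed.
Lemma real_funM f g : real_fun f -> real_fun g -> real_fun (f * g).
Proof. by move=> rf rg p; rewrite evM real_funE// (real_funE p rg)/= mulr0 mul0r addr0. Qed.
Lemma real_funC (c : R) : real_fun (c%:C%:Cst : A).
Proof. by []. Qed.
Lemma real_fun0 : real_fun (0 : A). Proof. by []. Qed.

Definition rv f p : R := complex.Re (f p).

Lemma rvD f g p : rv (f + g) p = rv f p + rv g p.
Proof. by rewrite /rv evD; case: (f p) (g p) => ? ? []. Qed.
Lemma rvN f p : rv (- f) p = - rv f p.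
Proof. by rewrite /rv evN; case: (f p). Qed.
Lemma rvB f g p : rv (f - g) p = rv f p - rv g p.
Proof. by rewrite rvD rvN. Qed.
Lemma rvM f g p : real_fun f -> rv (f * g) p = rv f p * rv g p.
Proof. by move=> rf; rewrite /rv evM (real_funE p rf); case: (g p) => a b /=; rewrite mul0r subr0. Qed.
Lemma rvC (c : R) p : rv (c%:C%:Cst : A) p = c. Proof. by []. Qed.

Lemma real_eq f g : real_fun f -> real_fun g -> (forall p, rv f p = rv g p) -> f = g.
Proof.
move=> rf rg fg; apply: CinfPext => p.
by rewrite real_funE// [RHS]real_funE// -/(rv f p) fg.
Qed.

Lemma rv_continuous f : continuous (rv f).
Proof.
move=> p; have [i ip] := dom_cover p.
have cu : {for coord i p, continuous (fun y => complex.Re (f (param i y)))}.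
  by have [c _] := Re_smooth f i 0%N; apply: c; exact: coord_chart_image.
have H : {for p, continuous ((fun y => complex.Re (f (param i y))) \o coord i)}.
  by apply: continuous_comp => //; exact: continuous_coord.
rewrite /prop_for /continuous_at (_ : rv f p = ((fun y => complex.Re (f (param i y))) \o coord i) p); last by rewrite /= coordK.
apply: cvg_trans H; apply: near_eq_cvg.
by apply: filterS (near_dom ip) => q iq; rewrite /= coordK.
Qed.

End Functions.

Section OneVariable.
Variable R : realType.

(** Dividing by [t > 0] and by [t < 0] gives two opposite inequalities in the
    limit. *)
Lemma mulr_ge0_near0 (psi : R -> R) : {for 0, continuous psi} ->
  (\forall t \near 0, 0 <= t * psi t) -> psi 0 = 0.
Proof.
move=> c H; apply/eqP; rewrite eq_le; apply/andP; split; rewrite leNgt; apply/negP => p0.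
  have Hp : \forall t \near (0 : R), 0 < psi t by have := @cvgr_gt R R _ (nbhs_filter (0 : R)) psi (psi 0) c 0 p0.
  have /nbhs_ballP[e /= e0 B] : \forall t \near (0 : R), 0 <= t * psi t /\ 0 < psi t by exact: filterI.
  have [] := B (- (e / 2)).
    rewrite /ball/= sub0r opprK ger0_norm ?divr_ge0// ?ltW//.
    by rewrite ltr_pdivrMr// ltr_pMr// ltr1n.
  by rewrite mulNr oppr_ge0 pmulr_rle0 ?divr_gt0// leNgt => /negbTE->.
have Hp : \forall t \near (0 : R), psi t < 0 by have := @cvgr_lt R R _ (nbhs_filter (0 : R)) psi (psi 0) c 0 p0.
have /nbhs_ballP[e /= e0 B] : \forall t \near (0 : R), 0 <= t * psi t /\ psi t < 0 by exact: filterI.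
have [] := B (e / 2).
  rewrite /ball/= sub0r normrN ger0_norm ?divr_ge0// ?ltW//.
  by rewrite ltr_pdivrMr// ltr_pMr// ltr1n.
by rewrite pmulr_rge0 ?divr_gt0// leNgt => /negbTE->.
Qed.

Lemma sqr_ge0_near0 (psi : R -> R) : {for 0, continuous psi} ->
  (\forall t \near 0, 0 <= t ^+ 2 * psi t) -> 0 <= psi 0.
Proof.
move=> c H; rewrite leNgt; apply/negP => p0.
have Hp : \forall t \near (0 : R), psi t < 0 by have := @cvgr_lt R R _ (nbhs_filter (0 : R)) psi (psi 0) c 0 p0.
have /nbhs_ballP[e /= e0 B] : \forall t \near (0 : R), 0 <= t ^+ 2 * psi t /\ psi t < 0 by exact: filterI.
have [] := B (e / 2).
  rewrite /ball/= sub0r normrN ger0_norm ?divr_ge0// ?ltW//.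
  by rewrite ltr_pdivrMr// ltr_pMr// ltr1n.
by rewrite pmulr_rge0 ?exprn_gt0 ?divr_gt0// leNgt => /negbTE->.
Qed.

End OneVariable.

(** * Derivations at a local maximum *)

Section LocalMax.
Variables (R : realType) (n : nat) (M : manifold R n).
Local Notation A := (Cinf M).
Implicit Types (f g u h : A) (p : M) (X : Vec M).

Lemma line_continuous (g : 'rV[R]_n -> R) x v : smooth_on setT g ->
  {for 0, continuous (fun t : R => g (x + t *: v))}.
Proof.
move=> sg; apply: differentiable_continuous; apply/derivable1_diffP.
have [d _] : is_derive (0 : R) (1 : R) (fun t : R => g (x + t *: v))
    (grad g (x + (0 : R) *: v) v).
  apply: curve_derive; first exact: (smooth_diff openT sg).
  move=> i; have -> : (fun t : R => (x + t *: v) 0 i) = (fun t => x 0 i + t * v 0 i).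
    by apply/funext => t; rewrite !mxE.
  exact: affine_derive.
exact: d.
Qed.

Lemma near_line (P : set 'rV[R]_n) (x v : 'rV[R]_n) : nbhs x P ->
  \forall t \near (0 : R), P (x + t *: v).
Proof.
move=> Px; have c : {for (0 : R), continuous (fun t : R => x + t *: v)}.
  apply: cvgD; first exact: cvg_cst.
  by apply: cvgZr_tmp; exact: cvg_id.
by apply: c; rewrite scale0r addr0.
Qed.

(** The second-order Taylor formula of a nonnegative [k] vanishing at [p], as an
    identity between global functions, so that abstract derivations can be
    applied to it.  With [xi_j] the coordinates centred at [p], Hadamard's lemma
    writes the product of [k] with a bump function as [sum_j xi_j Q_j] and, the
    [Q_j] vanishing at [p] as [k] has a minimum there, it writes [Q_j] as
    [sum_l xi_l Ac_jl].  Multiplication by the bump function [Phi], whose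
    value at [p] is [c], globalizes all these functions; the powers of [Phi]
    balance the number of bump functions on each side.  The quadratic form of
    [a] is a positive multiple of the Hessian of [k]. *)
Lemma min_taylor (k : A) p : real_fun k -> k p = 0 ->
  (\forall q \near p, 0 <= rv k q) ->
  exists (c : R) (Phi : A) (xi Q : 'I_n -> A) (Ac : 'I_n -> 'I_n -> A)
    (a : 'I_n -> 'I_n -> R),
  [/\ [/\ 0 < c, Phi p = c%:C, (forall j, real_fun (xi j)) & (forall j, xi j p = 0)],
      forall j, Q j p = 0,
      Phi ^+ 3 * k = \sum_j xi j * Q j,
      forall j, Phi * Q j = \sum_l xi l * Ac j l
    & (forall j l, Ac j l p = (c * a j l)%:C) /\
      forall v : 'rV[R]_n, 0 <= \sum_j \sum_l v 0 j * (v 0 l * a j l)].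
Proof.
move=> rk kp kge0; have [i ip] := dom_cover p; have [r r0 rK] := chart_ball ip.
set x0 := coord i p in rK *.
have s1 : smooth_on setT (cst 1 : 'rV[R]_n -> R) by move=> m; exact: Ck_cst.
have sx j : smooth_on setT (fun x : 'rV[R]_n => x 0 j - x0 0 j).
  move=> m; apply: CkB; [exact: openT|exact: smooth_on_coord|exact: Ck_cst].
pose G := cutoff x0 r (fun y => rv k (param i y)).
have sG : smooth_on setT G by apply: cutoff_smooth (r0) rK _ _; exact: Re_smooth.
have Gge0 : \forall x \near x0, 0 <= G x.
  apply: filterS (near_param (coord_chart_image ip) _) => [x|]; last first.
    by rewrite coordK//; exact: kge0.
  by move=> /= H; rewrite /G /cutoff/= mulr_ge0// bumpf_ge0.
have G0 : G x0 = 0 by rewrite /G /cutoff/= coordK// /rv kp mulr0.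
have [q sq GE] := hadamard x0 sG.
have {}GE x : G x = \sum_j (x 0 j - x0 0 j) * q j x by rewrite GE G0 add0r.
(* along the j-th axis, G = t * q_j is nonnegative for both signs of t *)
have q0 j : q j x0 = 0.
  have := @mulr_ge0_near0 R (fun t => q j (x0 + t *: delta_mx 0 j)) (line_continuous (sq j)) _.
  rewrite scale0r addr0; apply; apply: filterS (near_line (delta_mx 0 j) Gge0) => t.
  rewrite GE (bigD1 j)//= big1 ?addr0; first by rewrite !mxE !eqxx mulr1 addrAC subrr add0r.
  by move=> l lj; rewrite !mxE eqxx (negbTE lj) mulr0 addr0 subrr mul0r.
have [a aP] : exists a : 'I_n -> 'I_n -> 'rV[R]_n -> R, forall j,
    (forall l, smooth_on setT (a j l)) /\
    forall x, q j x = \sum_l (x 0 l - x0 0 l) * a j l x.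
  have /choice[a aP] : forall j, exists aj : 'I_n -> 'rV[R]_n -> R,
      (forall l, smooth_on setT (aj l)) /\
      forall x, q j x = \sum_l (x 0 l - x0 0 l) * aj l x.
    move=> j; have [aj saj E] := hadamard x0 (sq j); exists aj; split=> // x.
    by rewrite E q0 add0r.
  by exists a.
have sa j l : smooth_on setT (a j l) by have [] := aP j.
have qE j x : q j x = \sum_l (x 0 l - x0 0 l) * a j l x by have [] := aP j.
pose gl := globalize i x0 r.
exists (bumpf x0 r x0), (gl (cst 1)), (fun j => gl (fun x => x 0 j - x0 0 j)),
  (fun j => gl (q j)), (fun j l => gl (a j l)), (fun j l => a j l x0).
have sM j (g : 'rV[R]_n -> R) : smooth_on setT g -> smooth_on setT (fun x => (x 0 j - x0 0 j) * g x).
  by move=> sg; exact: (smooth_onM openT (sx j) sg).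
split.
- split; first exact: bumpf_gt0.
  + by rewrite /gl globalize_dom// mulr1.
  + by move=> j; apply: globalize_real.
  + by move=> j; rewrite /gl globalize_dom// -/x0 subrr mulr0.
- by move=> j; rewrite /gl globalize_dom// -/x0 q0 mulr0.
- apply: CinfPext => z; rewrite evM evX ev_sum.
  have -> : gl (cst 1) z ^+ 3 * k z = gl (cst 1) z * gl G z.
    have [iz|niz] := pselect (dom i z); last by rewrite /gl !(globalize_out r0 rK)// expr0n !mul0r.
    rewrite /gl !(globalize_dom r0 rK)// /G /cutoff/= coordK// (real_funE _ rk) -/(rv k z).
    by rewrite -rmorphXn/= -!rmorphM/=; congr (_%:C); ring.
  have -> : G = (fun x => \sum_j (x 0 j - x0 0 j) * q j x) by apply/funext.
  rewrite /gl (globalize_sum r0 rK); last by move=> j; exact: sM.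
  rewrite mulr_sumr; apply: eq_bigr => j _.
  by rewrite evM; exact: (globalizeM r0 rK z (sx j) (sq j)).
- move=> j; apply: CinfPext => z; rewrite evM ev_sum.
  have E : q j = (fun x => \sum_l (x 0 l - x0 0 l) * a j l x) by apply/funext.
  rewrite [in LHS]E /gl (globalize_sum r0 rK); last by move=> l; exact: sM.
  rewrite mulr_sumr; apply: eq_bigr => l _.
  by rewrite evM; exact: (globalizeM r0 rK z (sx l) (sa j l)).
split; first by move=> j l; rewrite /gl globalize_dom.
move=> v.
pose psi (x : 'rV[R]_n) := \sum_j \sum_l v 0 j * (v 0 l * a j l x).
have spsi : smooth_on setT psi.
  apply: smooth_on_sum openT _ => j; apply: smooth_on_sum openT _ => l m.
  apply: (@CkM _ _ _ _ (cst (v 0 j))) openT _ _; first exact: Ck_cst.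
  by apply: (@CkM _ _ _ _ (cst (v 0 l))) openT _ _; [exact: Ck_cst|exact: sa].
(* along the line of direction v, G = t ^ 2 * psi is nonnegative *)
have := @sqr_ge0_near0 R (fun t => psi (x0 + t *: v)) (line_continuous spsi) _.
rewrite scale0r addr0; apply; apply: filterS (near_line v Gge0) => t.
rewrite GE (_ : \sum_j _ = t ^+ 2 * psi (x0 + t *: v))//.
rewrite mulr_sumr; apply: eq_bigr => j _; rewrite qE !mulr_sumr.
by apply: eq_bigr => l _; rewrite !mxE; ring.
Qed.

(** Up to a factor that does not vanish at [p], [k] is a sum of products of two
    functions that do. *)
Lemma min_first_order X k p : real_fun k -> k p = 0 ->
  (\forall q \near p, 0 <= rv k q) -> X k p = 0.
Proof.
move=> rk kp /(min_taylor rk kp)[c [Phi [xi [Q [Ac [a [[c0 Phip _ xip] Qp E _ _]]]]]]].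
have := congr1 (fun f : A => X f p) E.
rewrite /= VecM Vec_sum ev_sum !evE kp mulr0 add0r Phip big1.
  have cn0 : c%:C != 0 by rewrite eq_complex/= gt_eqF.
  by move/eqP; rewrite mulf_eq0 expf_eq0/= (negbTE cn0) => /eqP.
by move=> j _; rewrite VecM !evE Qp xip mulr0 mul0r addr0.
Qed.

(** In [X (X k)], every term of the Taylor formula that keeps a factor [xi_j]
    vanishes at [p]; the remaining ones form the Hessian applied to the vector
    of the [X xi_j]. *)
Lemma min_second_order X k p : real_vec X -> real_fun k -> k p = 0 ->
  (\forall q \near p, 0 <= rv k q) -> 0 <= rv (X (X k)) p.
Proof.
move=> rX rk kp kge0; have Xkp := min_first_order X rk kp kge0.
have [c [Phi [xi [Q [Ac [a [[c0 Phip rxi xip] Qp E EQ [Acp psd]]]]]]]] := min_taylor rk kp kge0.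
have cn0 : c%:C != 0 by rewrite eq_complex/= gt_eqF.
pose v : 'rV[R]_n := \row_j rv (X (xi j)) p.
have vE j : X (xi j) p = (v 0 j)%:C by rewrite mxE [LHS]real_funE//; exact: rX.
have XQ j : X (Q j) p = (\sum_l v 0 l * a j l)%:C.
  have := congr1 (fun f : A => X f p) (EQ j).
  rewrite /= VecM Vec_sum ev_sum !evE Qp mulr0 add0r Phip => H.
  apply: (mulfI cn0); rewrite H rmorph_sum mulr_sumr; apply: eq_bigr => l _.
  by rewrite VecM !evE xip mul0r addr0 vE Acp -!rmorphM/=; congr (_%:C); ring.
have := congr1 (fun f : A => X (X f) p) E.
rewrite /= !VecM !VecD !VecM !Vec_sum ev_sum !evE kp Xkp Phip !(mulr0, add0r) => H.
have {}H : c%:C ^+ 3 * X (X k) p = 2 * (\sum_j \sum_l v 0 j * (v 0 l * a j l))%:C.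
  rewrite H rmorph_sum mulr_sumr; apply: eq_bigr => j _.
  rewrite VecM VecD !VecM !evE Qp xip !(mulr0, mul0r, addr0, add0r) vE XQ.
  rewrite -mulr_sumr rmorphM/=; ring.
have : c%:C ^+ 3 * X (X k) p = (c ^+ 3 * rv (X (X k)) p)%:C.
  by rewrite [X (X k) p]real_funE; [rewrite -rmorphXn -rmorphM|exact/rX/rX].
rewrite H (_ : 2 = 2%:C) -?rmorphM/=; last by apply/eqP; rewrite eq_complex/= addr0 !eqxx.
move=> /(congr1 (@complex.Re R))/= E2.
by rewrite -(pmulr_rge0 _ (exprn_gt0 3 c0)) -E2 mulr_ge0.
Qed.

Lemma max_first_order X h p : real_fun h ->
  (\forall q \near p, rv h q <= rv h p) -> X h p = 0.
Proof.
move=> rh hmax; pose k := (rv h p)%:C%:Cst - h.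
have rk : real_fun k by apply: real_funB.
have kp : k p = 0 by rewrite /k evB evC (real_funE p rh) subrr.
have := @min_first_order X k p rk kp _; rewrite /k VecB VecC sub0r evN.
move=> H; apply/eqP; rewrite -oppr_eq0; apply/eqP; apply: H.
by apply: filterS hmax => q; rewrite rvB rvC subr_ge0.
Qed.

Lemma max_second_order X h p : real_vec X -> real_fun h ->
  (\forall q \near p, rv h q <= rv h p) -> rv (X (X h)) p <= 0.
Proof.
move=> rX rh hmax; pose k := (rv h p)%:C%:Cst - h.
have rk : real_fun k by apply: real_funB.
have kp : k p = 0 by rewrite /k evB evC (real_funE p rh) subrr.
have := @min_second_order X k p rX rk kp _.
rewrite /k VecB VecC sub0r VecN rvN oppr_ge0; apply.
by apply: filterS hmax => q; rewrite rvB rvC subr_ge0.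
Qed.

End LocalMax.

(** * Coordinate vector fields with compact support *)

Section CoordinateField.
Variables (R : realType) (n : nat) (M : manifold R n).
Local Notation A := (Cinf M).
Variables (i : chart M) (c : 'rV[R]_n) (r : R).
Hypotheses (r0 : 0 < r) (rK : cball c r `<=` chart_image i).
Variable k : 'I_n.
Local Notation phi := (bumpf c r).
Local Notation e := (delta_mx 0 k).

(** On the chart this is [phi^2 * 'D_e g] ([liftE]), written in terms of
    functions that are smooth on the whole coordinate space: [phi * 'D_e g]
    is ['D_e (phi * g) - g * 'D_e phi]. *)
Let lift (g : 'rV[R]_n -> R) :=
  (phi \* 'D_e (cutoff c r g)) \- (cutoff c r g \* 'D_e phi).

Let reF (f : A) := fun y => complex.Re (f (param i y)).
Let imF (f : A) := fun y => complex.Im (f (param i y)).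

Let lift_smooth g : smooth_on (chart_image i) g -> smooth_on setT (lift g).
Proof.
move=> sg; have sc := cutoff_smooth r0 rK sg; have sp := @bumpf_smooth R n c r.
move=> m; apply: (CkB openT).
  exact: (CkM openT (sp m) (smooth_on_D k sc m)).
exact: (CkM openT (sc m) (smooth_on_D k sp m)).
Qed.

Let smooth_derivable g y : smooth_on (chart_image i) g -> chart_image i y -> derivable g y e.
Proof. by move=> sg yi; have [_ /(_ k)[d _]] := sg 1%N; exact: d. Qed.

Let liftE g y : smooth_on (chart_image i) g -> chart_image i y -> lift g y = phi y ^+ 2 * 'D_e g y.
Proof.
move=> sg yi; rewrite /lift /= /cutoff.
have dp : derivable phi y e.
  by have [_ /(_ k)[d _]] := @bumpf_smooth R n c r 1%N; exact: d.
rewrite (@deriveM _ _ phi g)//; last exact: smooth_derivable.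
by rewrite /GRing.scale/=; ring.
Qed.

Definition coord_der (f : A) : A :=
  globalize i c r (lift (reF f)) + 'i%C%:Cst * globalize i c r (lift (imF f)).

Lemma coord_derE f p : dom i p -> coord_der f p =
  (phi (coord i p) ^+ 3 * 'D_e (reF f) (coord i p))%:C +
  'i%C * (phi (coord i p) ^+ 3 * 'D_e (imF f) (coord i p))%:C.
Proof.
move=> ip; have pi := coord_chart_image ip.
have sR := Re_smooth f i; have sI := Im_smooth f i.
rewrite /coord_der evD evM evC !(globalize_dom r0 rK)//; try exact: lift_smooth.
by rewrite !liftE//; congr (_%:C + _ * _%:C); ring.
Qed.

Lemma coord_der_out f p : ~ dom i p -> coord_der f p = 0.
Proof.
move=> ip; have sR := Re_smooth f i; have sI := Im_smooth f i.
rewrite /coord_der evD evM evC !(globalize_out r0 rK)//; try exact: lift_smooth.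
by rewrite mulr0 addr0.
Qed.

Let dR f y : chart_image i y -> is_derive y e (reF f) ('D_e (reF f) y).
Proof. by move=> yi; apply: DeriveDef => //; apply: smooth_derivable => //; exact: Re_smooth. Qed.
Let dI f y : chart_image i y -> is_derive y e (imF f) ('D_e (imF f) y).
Proof. by move=> yi; apply: DeriveDef => //; apply: smooth_derivable => //; exact: Im_smooth. Qed.

Lemma coord_der_subproof : coord_der \in @der_pred R n M.
Proof.
apply/asboolP; split=> [[a b] f g|f g]; apply: CinfPext => p.
  have [ip|nip] := pselect (dom i p); last first.
    by rewrite coord_der_out// evD evM !coord_der_out// mulr0 addr0.
  have yi := coord_chart_image ip; rewrite coord_derE// evD evM evC !coord_derE//; set y := coord i p in yi *.
  have -> : 'D_e (reF ((a +i* b)%:Cst * f + g)) y =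
      a * 'D_e (reF f) y - b * 'D_e (imF f) y + 'D_e (reF g) y.
    have -> : reF ((a +i* b)%:Cst * f + g) = (a *: reF f - b *: imF f) + reF g.
      apply/funext => z; rewrite !fctE /reF /imF !evE.
      by case: (f _) (g _) => ? ? [].
    have := is_deriveD (is_deriveB (is_deriveZ a (dR f yi)) (is_deriveZ b (dI f yi))) (dR g yi).
    by move=> [_ ->].
  have -> : 'D_e (imF ((a +i* b)%:Cst * f + g)) y =
      a * 'D_e (imF f) y + b * 'D_e (reF f) y + 'D_e (imF g) y.
    have -> : imF ((a +i* b)%:Cst * f + g) = (a *: imF f + b *: reF f) + imF g.
      apply/funext => z; rewrite !fctE /reF /imF !evE.
      by case: (f _) (g _) => ? ? [].
    have := is_deriveD (is_deriveD (is_deriveZ a (dI f yi)) (is_deriveZ b (dR f yi))) (dI g yi).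
    by move=> [_ ->].
  by apply/eqP; rewrite eq_complex/=; apply/andP; split; apply/eqP; ring.
have [ip|nip] := pselect (dom i p); last first.
  by rewrite coord_der_out// evD !evM !coord_der_out// mulr0 mul0r addr0.
have yi := coord_chart_image ip; rewrite coord_derE// evD !evM !coord_derE//.
set y := coord i p in yi *.
have ev (h : A) : h p = reF h y +i* imF h y by rewrite /reF /imF /y coordK//; case: (h p).
rewrite (ev f) (ev g).
have -> : 'D_e (reF (f * g)) y =
    reF f y * 'D_e (reF g) y + reF g y * 'D_e (reF f) y -
    (imF f y * 'D_e (imF g) y + imF g y * 'D_e (imF f) y).
  have -> : reF (f * g) = reF f * reF g - imF f * imF g.
    apply/funext => z; rewrite !fctE /reF /imF !evE.
    by case: (f _) (g _) => ? ? [].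
  have := is_deriveB (is_deriveM (dR f yi) (dR g yi)) (is_deriveM (dI f yi) (dI g yi)).
  by move=> [_ ->].
have -> : 'D_e (imF (f * g)) y =
    reF f y * 'D_e (imF g) y + imF g y * 'D_e (reF f) y +
    (imF f y * 'D_e (reF g) y + reF g y * 'D_e (imF f) y).
  have -> : imF (f * g) = reF f * imF g + imF f * reF g.
    apply/funext => z; rewrite !fctE /reF /imF !evE.
    by case: (f _) (g _) => ? ? [].
  have := is_deriveD (is_deriveM (dR f yi) (dI g yi)) (is_deriveM (dI f yi) (dR g yi)).
  by move=> [_ ->].
by apply/eqP; rewrite eq_complex/=; apply/andP; split; apply/eqP; ring.
Qed.

Definition coord_vec : Vec M := MkVec coord_der_subproof.

(** [coord_vec] carries [phi^3] and [globalize] carries [phi]; the derivative of the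
    latter does not contribute as [T] vanishes at the point. *)
Lemma coord_vec_globalize (T : 'rV[R]_n -> R) p : smooth_on setT T -> dom i p ->
  T (coord i p) = 0 ->
  coord_vec (globalize i c r T) p = (phi (coord i p) ^+ 4 * 'D_e T (coord i p))%:C.
Proof.
move=> sT ip T0; rewrite -[LHS]/(coord_der (globalize i c r T) p) coord_derE//; have yi := coord_chart_image ip.
set y := coord i p in yi T0 *.
have H z : chart_image i z -> globalize i c r T (param i z) = (phi z * T z)%:C.
  by move=> zi; have [zd zE] := chart_image_param zi; rewrite (globalize_dom r0 rK)// zE.
have -> : 'D_e (imF (globalize i c r T)) y = 0.
  rewrite -(derive_cst (0 : R) y e); apply: near_eq_derive.
  by apply: filterS (near_chart_image yi) => z /H; rewrite /imF => ->.
have -> : 'D_e (reF (globalize i c r T)) y = 'D_e (phi \* T) y.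
  by apply: near_eq_derive; apply: filterS (near_chart_image yi) => z /H; rewrite /reF => ->.
have dp : derivable phi y e.
  by have [_ /(_ k)[d _]] := @bumpf_smooth R n c r 1%N; exact: d.
have dT : derivable T y e by have [_ /(_ k)[d _]] := sT 1%N; exact: d.
rewrite (@deriveM _ _ phi T)// T0 /GRing.scale/= mul0r addr0 !mulr0 addr0.
by rewrite mulrA -exprSr.
Qed.

End CoordinateField.

(** * Maxima on a compact manifold *)

Section CompactManifold.
Variables (R : realType) (n : nat) (M : manifold R n).
Local Notation A := (Cinf M).
Hypothesis cM : compact [set: M].
Implicit Types (f g u h al : A) (p q : M) (X : Vec M).

Lemma exists_max (K : set M) f : closed K -> K !=set0 ->
  exists2 p, K p & forall q, K q -> rv f q <= rv f p.
Proof.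
move=> cK K0; have kK : compact K := subclosed_compact cK cM (@subsetT _ K).
have cf : {within K, continuous (rv f)}.
  by apply: continuous_subspaceT; exact: rv_continuous.
have [p /set_mem Kp H] := compact_EVT_max K0 kK cf.
by exists p => // q Kq; apply: H; exact/mem_set.
Qed.

Lemma bounded_rv f : exists2 C, 0 < C & forall p, `|rv f p| <= C.
Proof.
have [p0|H] := pselect (exists p : M, True); last first.
  by exists 1 => // p; exfalso; apply: H; exists p.
have T0 : [set: M] !=set0 by have [p _] := p0; exists p.
have [p _ Hp] := exists_max f (@closedT _) T0.
have [q _ Hq] := exists_max (- f) (@closedT _) T0.
exists (`|rv f p| + `|rv f q| + 1); first by rewrite ltr_wpDl ?addr_ge0.
move=> z; have := Hp z I; have := Hq z I; rewrite !rvN => h1 h2.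
have := ler_norm (rv f p); have := ler_norm (- rv f q); rewrite normrN => h3 h4.
have a0 : 0 <= `|rv f p| by []. have b0 : 0 <= `|rv f q| by [].
by rewrite ler_norml; apply/andP; split; lra.
Qed.

(** The derivative of [y + N f^2] along [X] is [f], since [X f = 0].  It
    vanishes at a maximum, where the value is thus that of [y]: so [y + N f^2]
    is at most the maximum of [y], for every [N], and [f = 0]. *)
Lemma nilpotent_derivative X y f : real_fun y -> real_fun f ->
  X y = f -> X f = 0 -> f = 0.
Proof.
move=> ry rf Xy Xf; apply: real_eq => // p; rewrite [RHS]/=.
apply: contrapT => fp.
have [C C0 HC] := bounded_rv y.
have f2 : 0 < rv f p ^+ 2 by rewrite exprn_even_gt0//; apply/eqP.
(* N is such that y + N f^2 exceeds C at p *)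
pose N := (2 * C + 1) / rv f p ^+ 2.
pose h := y + N%:C%:Cst * (f * f).
have rh : real_fun h by apply: real_funD => //; apply: real_funM => //; exact: real_funM.
have [q _ Hq] := exists_max h (@closedT _) (ex_intro _ p I : [set: M] !=set0).
have Xh : X h q = 0 by apply: max_first_order => //; apply: nearW => z; exact: Hq.
have fq : f q = 0.
  by rewrite -Xh /h VecD VecZ VecM Xf mul0r mulr0 addr0 mulr0 addr0 Xy.
have := Hq p I; rewrite !rvD !rvM//.
have -> : rv f q = 0 by rewrite /rv fq.
have -> : rv (N%:C%:Cst : A) p = N by [].
rewrite mulr0 mulr0 addr0 -expr2 /N divfK ?gt_eqF// => H.
have := HC p; have := HC q; rewrite !ler_norml => /andP[_ h1] /andP[h2 _].
by clear -C0 H h1 h2; lra.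
Qed.

Definition locally_constant f p := \forall q \near p, rv f q = rv f p.

Lemma locally_constant_open f : open (locally_constant f).
Proof.
rewrite openE => p /nbhs_interior; apply: filterS => q qV.
have := nbhs_singleton qV => E; near=> z.
by rewrite E; near: z.
Unshelve. all: by end_near. Qed.

(** The interior ball of Hopf's argument.  Take a maximum [q0] of [al] on the
    closed set of points where [al] is not locally constant.  In a ball around
    [q0] in a chart, [al <= m := al q0]; and there are points [c] near [q0]
    with [al c < m].  The largest ball around [c] in which [al < m] has a point
    [q] with [al q = m] on its boundary.  The ball whose diameter is the segment
    from [c] to [q] touches the set {al = m} at [q] only, and [tau] is a
    defining function of it. *)
Lemma touching_function al : real_fun al ->
  ~ (forall p, locally_constant al p) ->
  exists (q : M) (tau : A) (X : Vec M),
   [/\ real_fun tau /\ tau q = 0, X tau q <> 0,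
    \forall z \near q, rv al z <= rv al q &
    \forall z \near q, z <> q -> rv tau z <= 0 -> rv al z < rv al q].
Proof.
move=> ra /existsNP[p0 np0].
have [q0 q0V q0max] := exists_max al (open_closedC (@locally_constant_open al))
  (ex_intro _ p0 np0).
set m := rv al q0 in q0max.
have [i iq0] := dom_cover q0; have [r r0 rK] := chart_ball iq0.
set x0 := coord i q0 in rK.
pose a x := rv al (param i x).
pose U := [set x | dist2 x x0 < r ^+ 2].
have UK : U `<=` cball x0 r.
  by move=> x /ltW xU; apply: norm_le_dist2 xU; exact: ltW.
have Ucod x : U x -> chart_image i x by move=> /UK /rK.
have phi0 x : U x -> 0 < bumpf x0 r x.
  by move=> xU; rewrite /bumpf /flat subr_gt0 xU expr0 mul1r expR_gt0.
pose G := cutoff x0 r a.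
have cG : continuous G.
  by apply/smooth_continuous/(cutoff_smooth r0 rK); exact: Re_smooth.
have cphi : continuous (bumpf x0 r) by apply/smooth_continuous/bumpf_smooth.
(* the level sets of a in terms of functions that are continuous everywhere *)
have GE x s : U x -> (G x - s * bumpf x0 r x = 0) <-> (a x = s).
  move=> xU; rewrite /G /cutoff/= mulrC -mulrBl; split=> [/eqP|->].
    by rewrite mulf_eq0 (gt_eqF (phi0 x xU)) orbF subr_eq0 => /eqP.
  by rewrite subrr mul0r.
have ax0 : a x0 = m by rewrite /a coordK.
have cdist (c : 'rV[R]_n) : continuous (fun x : 'rV[R]_n => dist2 x c).
  apply: smooth_continuous; apply: dist2_smooth; exact: openT.
(* If a y > m, then a is locally constant at the points of value a y; so the
   last point of that value on the segment from y to x0 is not the last one. *)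
have aU y : U y -> a y <= m.
  move=> yU; rewrite leNgt; apply/negP => ym.
  pose s (t : R) := y + t *: (x0 - y).
  have sU t : 0 <= t <= 1 -> U (s t).
    move=> /andP[t0 t1]; rewrite /U/=; apply: le_lt_trans yU.
    have -> : dist2 (s t) x0 = (1 - t) ^+ 2 * dist2 y x0.
      by rewrite /dist2 mulr_sumr; apply: eq_bigr => l _; rewrite /s !mxE; ring.
    rewrite ler_piMl ?dist2_ge0// exprn_ile1 ?subr_ge0//.
    by rewrite lerBlDr lerDl.
  have cs : continuous s.
    move=> t; apply: cvgD; first exact: cvg_cst.
    by apply: cvgZr_tmp; exact: cvg_id.
  pose H t := G (s t) - a y * bumpf x0 r (s t).
  have cH : continuous H.
    move=> t; apply: cvgB; first exact: continuous_comp (cs t) (cG (s t)).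
    apply: cvgM; first exact: cvg_cst.
    exact: continuous_comp (cs t) (cphi (s t)).
  pose S := `[0, 1]%classic `&` H @^-1` [set 0].
  have clS : closed S.
    apply: closedI; first exact: itv_closed.
    apply: preimage_closed; first by move=> t _; exact: cH.
    exact: closed_eq.
  have kS : compact S by apply: subclosed_compact clS (@segment_compact _ 0 1) _ => t [].
  have inS t : 0 <= t <= 1 -> S t <-> a (s t) = a y.
    move=> t01; split=> [[_ /=]|E]; first by move/GE; apply; exact: sU.
    by split; [rewrite /= in_itv|apply/GE => //; exact: sU].
  have S0 : S !=set0.
    by exists 0; apply/inS; rewrite ?lexx ?ler01// /s scale0r addr0.
  have cid : {within S, continuous (id : R -> R)}.
    by apply: continuous_subspaceT => t; exact: cvg_id.
  have [t1 /set_mem St1 t1max] := compact_EVT_max S0 kS cid.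
  have t01 : 0 <= t1 <= 1 by have [] := St1; rewrite /= in_itv.
  have az : a (s t1) = a y by apply/inS.
  have t11 : t1 < 1.
    rewrite lt_neqAle; case/andP: t01 => _ ->; rewrite andbT; apply/eqP => E.
    by move: ym; rewrite -az E /s scale1r addrC subrK ax0 ltxx.
  have lc : locally_constant al (param i (s t1)).
    apply: contrapT => /q0max; rewrite -/(a (s t1)) az.
    by rewrite leNgt ym.
  have : \forall x \near s t1, a x = a (s t1).
    by apply: (near_param (P := fun q => rv al q = a (s t1))) => //; exact/Ucod/sU.
  move/(near_line (x0 - y)) => /nbhs_ballP[d /= d0 Bd].
  pose t2 := Num.min (d / 2) (1 - t1).
  have t20 : 0 < t2 by rewrite lt_min subr_gt0 t11 divr_gt0.
  have St2 : S (t1 + t2).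
    apply/inS.
      case/andP: t01 => t10 _; rewrite addr_ge0 ?(ltW t20)//= -lerBrDl.
      by rewrite ge_min lexx orbT.
    have -> : s (t1 + t2) = s t1 + t2 *: (x0 - y).
      by rewrite /s scalerDl addrA.
    rewrite Bd// /ball/= sub0r normrN gtr0_norm//.
    by apply: le_lt_trans (_ : d / 2 < d); [rewrite ge_min lexx|rewrite ltr_pdivrMr// ltr_pMr// ltr1n].
  by have := t1max _ (mem_set St2); rewrite leNgt ltrDl t20.
(* the radius r / 2 keeps the ball around c through x0 inside U *)
have [c [cx0 ac]] : exists c, dist2 c x0 < (r / 2) ^+ 2 /\ a c < m.
  apply: contrapT => /forallNP nc; apply: q0V.
  have near_x0 : \forall x \near x0, dist2 x x0 < (r / 2) ^+ 2.
    have := @cvgr_lt R _ _ (nbhs_filter x0) (fun x : 'rV[R]_n => dist2 x x0) _ (cdist x0 x0) ((r / 2) ^+ 2).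
    by rewrite dist2xx; apply; rewrite exprn_gt0// divr_gt0.
  apply: filterS2 (near_dom iq0) (near_coord iq0 near_x0) => z iz xz.
  have xU : U (coord i z).
    apply: lt_trans xz _; rewrite ltr_pXn2r ?nnegrE ?divr_ge0 ?(ltW r0)//.
    by rewrite ltr_pdivrMr// ltr_pMr// ltr1n.
  have E : rv al z = a (coord i z) by rewrite /a coordK.
  apply/eqP; rewrite E eq_le aU//= leNgt; apply/negP => lt.
  by apply: (nc (coord i z)).
pose D := dist2 x0 c.
have DE : D = dist2 c x0 by apply: eq_bigr => l _; rewrite -sqrrN opprB.
have DU x : dist2 x c <= D -> U x.
  move=> xD; rewrite /U/=.
  apply: (@le_lt_trans _ _ (2 * dist2 x c + 2 * dist2 c x0)).
    rewrite /dist2 !mulr_sumr -big_split/=; apply: ler_sum => l _.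
    rewrite -subr_ge0 (_ : _ - _ = (x 0 l - c 0 l - (c 0 l - x0 0 l)) ^+ 2) ?sqr_ge0//.
    by ring.
  have -> : r ^+ 2 = 2 * (r / 2) ^+ 2 + 2 * (r / 2) ^+ 2 by field.
  by move: xD cx0; rewrite -DE; lra.
pose K := [set x | dist2 x c <= D] `&` [set x | G x - m * bumpf x0 r x = 0].
have kK : compact K.
  apply: subclosed_compact (@cball_compact _ _ x0 r) _; last by move=> x [/DU/UK].
  apply: closedI.
    by apply: (@preimage_closed _ _ (fun x : 'rV[R]_n => dist2 x c) [set t | t <= D]) => [x _|]; [exact: cdist|exact: closed_le].
  have cH : continuous (fun x => G x - m * bumpf x0 r x).
    move=> x; apply: (@cvgB _ _ _ _ _ G _ _ _ (cG x)).
    exact: (@cvgM _ _ _ _ (cst m) _ _ _ (cvg_cst m) (cphi x)).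
  apply: (@preimage_closed _ _ (fun x => G x - m * bumpf x0 r x) [set 0]) => [x _|]; last exact: closed_eq.
  exact: cH.
have K0 : K !=set0.
  exists x0; split; first exact: lexx.
  by apply/GE => //; rewrite /U/= dist2xx exprn_gt0.
have [q /set_mem[qD qm] qmin] := @compact_EVT_min _ R (fun x : 'rV[R]_n => dist2 x c) K K0 kK
  (continuous_subspaceT (@cdist c)).
have qU := DU _ qD; have aq : a q = m by apply/GE.
have strict x : dist2 x c < dist2 q c -> a x < m.
  move=> xq; have xD : dist2 x c <= D by apply: le_trans (ltW xq) qD.
  have xU := DU _ xD; rewrite lt_neqAle aU// andbT; apply/eqP => xm.
  have xK : K x by split => //; apply/GE.
  by have := qmin _ (mem_set xK); rewrite leNgt xq.
(* T is <x - q, x - c>, negative inside the ball of diameter [c, q] *)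
pose T (x : 'rV[R]_n) := \sum_l ((x 0 l - q 0 l) ^+ 2 - (x 0 l - q 0 l) * (c 0 l - q 0 l)).
have TE x : dist2 x c = 2 * T x - dist2 x q + dist2 q c.
  by rewrite /dist2 /T mulr_sumr -sumrB -big_split/=; apply: eq_bigr => l _; ring.
have Tstrict x : x <> q -> T x <= 0 -> a x < m.
  move=> xq Tx; apply: strict; rewrite TE.
  suff : 0 < dist2 x q by lra.
  rewrite lt_neqAle dist2_ge0 andbT eq_sym; apply/eqP => d0; apply: xq.
  apply/subr0_eq/eqP; rewrite -normr_le0; apply: norm_le_dist2 => //.
  by rewrite d0 expr0n.
have sT : smooth_on setT T.
  apply: smooth_on_sum openT _ => l j.
  have S1 : Ck j setT (fun x : 'rV[R]_n => x 0 l - q 0 l).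
    by apply: CkB; [exact: openT|exact: smooth_on_coord|exact: Ck_cst].
  have := CkB openT (CkM openT S1 S1) (CkM openT S1 (@Ck_cst _ _ j setT (c 0 l - q 0 l))).
  by apply: Ck_eq; [exact: openT|move=> x _ /=; rewrite expr2].
have Tq : T q = 0 by rewrite /T big1// => l _; rewrite subrr expr0n mul0r subrr.
have [k qk] : exists k, c 0 k - q 0 k != 0.
  apply: contrapT => /forallNP nk; have : c = q.
    apply/rowP => l; apply/subr0_eq/eqP/negPn/negP; exact: nk.
  by move=> cq; move: ac; rewrite cq aq ltxx.
have [iq qE] := chart_image_param (Ucod _ qU).
have [r' r'0 r'K] := chart_ball iq; rewrite qE in r'K.
exists (param i q), (globalize i q r' T), (coord_vec r'0 r'K k); split.
- by split; [exact: globalize_real|rewrite (globalize_dom r'0 r'K)// qE Tq mulr0].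
- rewrite coord_vec_globalize// qE //.
  have -> : 'D_(delta_mx 0 k) T q = - (c 0 k - q 0 k).
    have E : (fun t : R => T (q + t *: delta_mx 0 k)) =
        (id : R -> R) * (id : R -> R) - (c 0 k - q 0 k) *: (id : R -> R).
      apply/funext => t; rewrite !fctE /T (bigD1 k)//= big1 ?addr0.
        by rewrite !mxE !eqxx /GRing.scale/=; ring.
      by move=> l lk; rewrite !mxE (negbTE lk) andbF mulr0; ring.
    have d : is_derive (0 : R) (1 : R) (fun t : R => T (q + t *: delta_mx 0 k)) (- (c 0 k - q 0 k)).
      rewrite E; have di := is_derive_id (0 : R) (1 : R).
      apply: is_derive_eq (is_deriveB (is_deriveM di di) (is_deriveZ _ di)) _.
      by rewrite /GRing.scale/=; ring.
    by have [_ ->] := derive_line d.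
  move=> /(congr1 (@complex.Re R))/= /eqP.
  rewrite mulf_eq0 expf_eq0/= oppr_eq0 (negbTE qk) orbF.
  by rewrite gt_eqF// bumpf_gt0.
- have H : \forall x \near q, U x.
    have := @cvgr_lt R _ _ (nbhs_filter q) (fun x : 'rV[R]_n => dist2 x x0) _ (cdist x0 q) (r ^+ 2) qU.
    by [].
  have H' : nbhs (coord i (param i q)) U by rewrite qE.
  apply: filterS2 (near_dom iq) (near_coord iq H') => z iz xU.
  by rewrite -/(a q) aq -(coordK iz); exact: aU.
have cb : continuous (bumpf q r') by apply/smooth_continuous/bumpf_smooth.
have near_phi : \forall x \near q, 0 < bumpf q r' x.
  have := @cvgr_gt R _ _ (nbhs_filter q) (bumpf q r') _ (cb q) 0.
  by apply; exact: bumpf_gt0.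
rewrite -qE in near_phi; apply: filterS2 (near_dom iq) (near_coord iq near_phi).
rewrite qE => z iz phiz zq.
rewrite {1}/rv (globalize_dom r'0 r'K)//= pmulr_rle0// => Tz.
rewrite -/(a q) aq -(coordK iz); apply: Tstrict => // E.
by apply: zq; rewrite -E coordK.
Qed.

End CompactManifold.

(** * The Dorfman bracket *)

Section Sections.
Variables (R : realType) (n : nat) (M : manifold R n).
Local Notation A := (Cinf M).
Local Notation Vec := (Vec M).
Local Notation Form1 := (Form1 M).
Local Notation Sec := (Sec M).
Implicit Types (c u v w : A) (X Y Z W : Vec) (a b : Form1) (e f g : Sec).

Lemma VecPext X Y : (forall u, X u = Y u) -> X = Y.
Proof. by move=> XY; apply/val_inj/funext. Qed.
Lemma Form1Pext a b : (forall X, a X = b X) -> a = b.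
Proof. by move=> ab; apply/val_inj/funext. Qed.
Lemma SecPext e e' : (forall u, e.1 u = e'.1 u) -> (forall X, e.2 X = e'.2 X) -> e = e'.
Proof.
by case: e e' => [X a] [Y b] /= XY ab; rewrite (VecPext XY) (Form1Pext ab).
Qed.

Lemma vD X Y u : (X + Y) u = X u + Y u. Proof. by []. Qed.
Lemma vN X u : (- X) u = - X u. Proof. by []. Qed.
Lemma vZ c X u : (c *: X) u = c * X u. Proof. by []. Qed.
Lemma v0 u : (0 : Vec) u = 0. Proof. by []. Qed.
Lemma fD a b X : (a + b) X = a X + b X. Proof. by []. Qed.
Lemma fN a X : (- a) X = - a X. Proof. by []. Qed.
Lemma fZ c a X : (c *: a) X = c * a X. Proof. by []. Qed.
Lemma f0 X : (0 : Form1) X = 0. Proof. by []. Qed.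

Lemma form_D a X Y : a (X + Y) = a X + a Y.
Proof. by have := Form1P a 1 X Y; rewrite !scale1r. Qed.
Lemma form_0 a : a 0 = 0.
Proof. by apply: (addrI (a 0)); rewrite -form_D !addr0. Qed.
Lemma form_Z a c X : a (c *: X) = c * a X.
Proof. by have := Form1P a c X 0; rewrite form_0 !addr0. Qed.
Lemma form_N a X : a (- X) = - a X.
Proof. by rewrite -scaleN1r form_Z mulN1r. Qed.

Lemma dfunE u X : dfun u X = X u. Proof. by []. Qed.
Lemma lieE X a Y : lie X a Y = X (a Y) - a (comm X Y). Proof. by []. Qed.
Lemma commE X Y u : comm X Y u = X (Y u) - Y (X u). Proof. by []. Qed.

Lemma sD1 e e' : (e + e').1 = e.1 + e'.1. Proof. by []. Qed.
Lemma sD2 e e' : (e + e').2 = e.2 + e'.2. Proof. by []. Qed.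
Lemma sN1 e : (- e).1 = - e.1. Proof. by []. Qed.
Lemma sN2 e : (- e).2 = - e.2. Proof. by []. Qed.
Lemma sZ1 c e : (c *: e).1 = c *: e.1. Proof. by []. Qed.
Lemma sZ2 c e : (c *: e).2 = c *: e.2. Proof. by []. Qed.
Lemma s01 : (0 : Sec).1 = 0. Proof. by []. Qed.
Lemma s02 : (0 : Sec).2 = 0. Proof. by []. Qed.
Lemma dsec1 u : (dsec u).1 = 0. Proof. by []. Qed.
Lemma dsec2 u : (dsec u).2 = dfun u. Proof. by []. Qed.

Definition secE := (sD1, sD2, sN1, sN2, sZ1, sZ2, s01, s02, dsec1, dsec2,
  vD, vN, vZ, v0, fD, fN, fZ, f0, form_D, form_0, form_Z, form_N, dfunE).
Definition vecE := (VecD, VecN, VecM, VecZ, VecC, Vec0, Vec1).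

Local Notation half := ((2^-1)%:Cst : A).
Local Notation ii := ('i%C%:Cst : A).

Lemma half_two : half * 2 = 1.
Proof. by apply: CinfPext => p; rewrite evM evC -[(2 : A)]/(1 + 1) evD ev1 mulVf// pnatr_eq0. Qed.

Lemma half_half : half + half = 1.
Proof. by rewrite -half_two mulr_natr mulr2n. Qed.

Lemma ii2 : ii * ii = -1.
Proof. by apply: CinfPext => p; rewrite evM !evC -expr2 sqr_i. Qed.

(** The Dorfman bracket differs from the Courant bracket by an exact section
    ([courantE]), but unlike it satisfies the Leibniz rule and acts on sections
    by derivations of the pairing; so it is used for symmetries. *)
Definition dorfman (e f : Sec) : Sec :=
  (comm e.1 f.1, lie e.1 f.2 - lie f.1 e.2 + dfun (e.2 f.1)).

Lemma dorfman1 e f : (dorfman e f).1 = comm e.1 f.1. Proof. by []. Qed.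
Lemma dorfman2 e f X : (dorfman e f).2 X =
  e.1 (f.2 X) - f.2 (comm e.1 X) - (f.1 (e.2 X) - e.2 (comm f.1 X)) + X (e.2 f.1).
Proof. by []. Qed.

Definition dE := (dorfman1, dorfman2, secE, lieE, commE).

Lemma courantE e f : courant e f = dorfman e f - dsec (pairing e f).
Proof.
apply: SecPext => [u|X].
  by rewrite sD1 sN1 dsec1 subr0.
have -> : (courant e f).2 = lie e.1 f.2 - lie f.1 e.2
    - half *: (dfun (f.2 e.1) - dfun (e.2 f.1)) by [].
rewrite ?dE /pairing VecZ ?vecE.
set P := X (e.2 f.1); set Q := X (f.2 e.1).
have E : P = half * P + half * P by rewrite -mulrDl half_half mul1r.
by rewrite {2}E; ring.
Qed.

Lemma pairingC e f : pairing e f = pairing f e.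
Proof. by rewrite /pairing addrC. Qed.
Lemma pairingDl e f g : pairing (e + f) g = pairing e g + pairing f g.
Proof. by rewrite /pairing !secE; ring. Qed.
Lemma pairingZl c e f : pairing (c *: e) f = c * pairing e f.
Proof. by rewrite /pairing !secE; ring. Qed.
Lemma pairingNl e f : pairing (- e) f = - pairing e f.
Proof. by rewrite /pairing !secE; ring. Qed.
Lemma pairingDr e f g : pairing g (e + f) = pairing g e + pairing g f.
Proof. by rewrite ![pairing g _]pairingC pairingDl. Qed.
Lemma pairingZr c e f : pairing f (c *: e) = c * pairing f e.
Proof. by rewrite ![pairing f _]pairingC pairingZl. Qed.
Lemma pairingNr e f : pairing f (- e) = - pairing f e.
Proof. by rewrite ![pairing f _]pairingC pairingNl. Qed.
Definition pairE := (pairingDl, pairingZl, pairingNl, pairingDr, pairingZr, pairingNr).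

Lemma pairing_dsec e u : 2 * pairing e (dsec u) = e.1 u.
Proof. by rewrite /pairing mulrA (mulrC 2) half_two mul1r ?dE add0r. Qed.

Lemma pairing_dsec2 u v : pairing (dsec u) (dsec v) = 0.
Proof. by rewrite /pairing ?(dE, vecE); ring. Qed.

Lemma pairing_nondeg e : (forall f, pairing e f = 0) -> e = 0.
Proof.
move=> H; apply: SecPext => [u|X].
  by rewrite -pairing_dsec H mulr0.
have := H (X, 0); rewrite /pairing (_ : (X, 0).1 = X)// (_ : (X, 0).2 = 0)// f0 addr0.
move=> /(congr1 ( *%R 2)).
by rewrite mulrA (mulrC 2) half_two mul1r mulr0.
Qed.

Lemma dsecD u v : dsec (u + v) = dsec u + dsec v.
Proof. by apply: SecPext => [w|X]; rewrite ?(dE, vecE) ?addr0. Qed.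
Lemma dsecN u : dsec (- u) = - dsec u.
Proof. by apply: SecPext => [w|X]; rewrite ?(dE, vecE) ?oppr0. Qed.
Lemma dsecZ (c : R[i]) u : dsec (c%:Cst * u) = c%:Cst *: dsec u.
Proof. by apply: SecPext => [w|X]; rewrite ?(dE, vecE) ?mulr0 ?mul0r ?add0r. Qed.
Lemma dsec0 : dsec 0 = 0 :> Sec.
Proof. by apply: SecPext => [w|X]; rewrite ?(dE, vecE). Qed.

Lemma commC X Y : comm X Y = - comm Y X.
Proof. by apply: VecPext => f; rewrite secE !commE; ring. Qed.
Lemma comm_jac X Y Z : comm (comm X Y) Z = comm X (comm Y Z) - comm Y (comm X Z).
Proof. by apply: VecPext => f; rewrite !secE !commE !vecE; ring. Qed.

Lemma dorfmanDl e f g : dorfman (e + f) g = dorfman e g + dorfman f g.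
Proof.
apply: SecPext => [u|X].
  by rewrite ?(dE, vecE); ring.
rewrite ?(dE, vecE).
have cD Y : comm (e.1 + f.1) Y = comm e.1 Y + comm f.1 Y.
  by apply: VecPext => h; rewrite ?(dE, vecE); ring.
by rewrite ?cD ?(dE, vecE); ring.
Qed.

Lemma dorfmanDr e f g : dorfman g (e + f) = dorfman g e + dorfman g f.
Proof.
apply: SecPext => [u|X].
  by rewrite ?(dE, vecE); ring.
rewrite ?(dE, vecE).
have cD Y : comm (e.1 + f.1) Y = comm e.1 Y + comm f.1 Y.
  by apply: VecPext => h; rewrite ?(dE, vecE); ring.
by rewrite ?cD ?(dE, vecE); ring.
Qed.

Lemma dorfmanZl (c : R[i]) e f : dorfman (c%:Cst *: e) f = c%:Cst *: dorfman e f.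
Proof.
apply: SecPext => [u|X].
  by rewrite ?(dE, vecE); ring.
rewrite ?(dE, vecE).
have cZ Y : comm (c%:Cst *: e.1) Y = c%:Cst *: comm e.1 Y.
  by apply: VecPext => h; rewrite ?(dE, vecE); ring.
by rewrite ?cZ ?(dE, vecE); ring.
Qed.

Lemma dorfmanZr (c : R[i]) e f : dorfman e (c%:Cst *: f) = c%:Cst *: dorfman e f.
Proof.
apply: SecPext => [u|X].
  by rewrite ?(dE, vecE); ring.
rewrite ?(dE, vecE).
have cZ Y : comm (c%:Cst *: f.1) Y = c%:Cst *: comm f.1 Y.
  by apply: VecPext => h; rewrite ?(dE, vecE); ring.
by rewrite ?cZ ?(dE, vecE); ring.
Qed.

Lemma dorfmanNl e f : dorfman (- e) f = - dorfman e f.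
Proof. by rewrite -scaleN1r -Cst1 -CstN dorfmanZl CstN Cst1 scaleN1r. Qed.
Lemma dorfmanNr e f : dorfman e (- f) = - dorfman e f.
Proof. by rewrite -scaleN1r -Cst1 -CstN dorfmanZr CstN Cst1 scaleN1r. Qed.
Definition dorfE := (dorfmanDl, dorfmanDr, dorfmanNl, dorfmanNr, dorfmanZl, dorfmanZr).

Lemma dorfman_dsecl u e : dorfman (dsec u) e = 0.
Proof.
apply: SecPext => [v|X].
  by rewrite ?(dE, vecE) ?subr0.
rewrite ?(dE, vecE).
have c0 : comm 0 X = 0 by apply: VecPext => h; rewrite ?(dE, vecE) ?subr0.
by rewrite ?c0 ?(dE, vecE); ring.
Qed.

Lemma dorfman_dsecr e u : dorfman e (dsec u) = dsec (e.1 u).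
Proof.
apply: SecPext => [v|X].
  by rewrite ?(dE, vecE) ?subr0.
rewrite ?(dE, vecE).
have c0 : comm 0 X = 0 by apply: VecPext => h; rewrite ?(dE, vecE) ?subr0.
by rewrite ?c0 ?(dE, vecE); ring.
Qed.

Lemma dorfman_sym e f : dorfman e f + dorfman f e = dsec (2 * pairing e f).
Proof.
apply: SecPext => [v|X].
  by rewrite ?(dE, vecE); ring.
have -> : 2 * pairing e f = e.2 f.1 + f.2 e.1.
  by rewrite /pairing mulrA (mulrC 2) half_two mul1r.
by rewrite ?(dE, vecE); ring.
Qed.

Lemma dorfman_pairing e f g :
  e.1 (pairing f g) = pairing (dorfman e f) g + pairing f (dorfman e g).
Proof.
by rewrite /pairing ?(dE, vecE) (commC g.1 f.1) ?(dE, vecE); ring.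
Qed.

Lemma dorfman_leibniz e f g :
  dorfman e (dorfman f g) = dorfman (dorfman e f) g + dorfman f (dorfman e g).
Proof.
apply: SecPext => [v|X].
  by rewrite ?(dE, vecE); ring.
rewrite ?(dE, vecE) ?comm_jac ?(dE, vecE).
ring.
Qed.

End Sections.

(** * Complex conjugation *)

Section Conjugation.
Variables (R : realType) (n : nat) (M : manifold R n).
Local Notation A := (Cinf M).
Local Notation Vec := (Vec M).
Local Notation Form1 := (Form1 M).
Local Notation Sec := (Sec M).
Implicit Types (u v w : A) (X Y Z W : Vec) (a b : Form1) (e f g : Sec).
Local Notation half := ((2^-1)%:Cst : A).
Local Notation ii := ('i%C%:Cst : A).

Lemma conjA_subproof u : (fun p => conjc (u p)) \in @smooth_pred R n M.
Proof.
apply/asboolP => i; have oU := @open_codom _ _ M i.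
have [sr si] := CinfP u i; split=> k.
  by apply: (Ck_eq oU) (sr k) => x _; case: (u _).
apply: (Ck_eq oU) (CkB oU (@Ck_cst _ _ k _ 0) (si k)) => x _ /=.
by case: (u _) => ? ?; rewrite /= sub0r.
Qed.
Definition conjA u : A := MkCinf (conjA_subproof u).

Lemma conjAE u p : conjA u p = conjc (u p). Proof. by []. Qed.
Lemma conjAD u v : conjA (u + v) = conjA u + conjA v.
Proof. by apply: CinfPext => p; rewrite !(conjAE, evE) rmorphD. Qed.
Lemma conjAN u : conjA (- u) = - conjA u.
Proof. by apply: CinfPext => p; rewrite !(conjAE, evE) rmorphN. Qed.
Lemma conjAM u v : conjA (u * v) = conjA u * conjA v.
Proof. by apply: CinfPext => p; rewrite !(conjAE, evE) rmorphM. Qed.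
Lemma conjAC (c : R[i]) : conjA c%:Cst = (conjc c)%:Cst.
Proof. exact: CinfPext. Qed.
Lemma conjAK u : conjA (conjA u) = u.
Proof. by apply: CinfPext => p; rewrite !conjAE conjcK. Qed.
Lemma conjA_half : conjA half = half.
Proof.
by rewrite conjAC fmorphV rmorph_nat.
Qed.
Lemma conjA_ii : conjA ii = - ii.
Proof. by rewrite conjAC -CstN; congr (_ %:Cst); apply/eqP; rewrite eq_complex/= oppr0 !eqxx. Qed.
Definition cjE := (conjAD, conjAN, conjAM, conjAK).

Lemma real_funP u : real_fun u <-> conjA u = u.
Proof.
split=> [ru|E p].
  by apply: CinfPext => p; rewrite conjAE (real_funE p ru) /= oppr0.
have := congr1 (fun h : A => complex.Im (h p)) E => /=.
by case: (u p) => a b /= => H; lra.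
Qed.

Definition ReA u : A := half * (u + conjA u).
Definition ImA u : A := - (half * ii) * (u - conjA u).

Lemma ReA_real u : real_fun (ReA u).
Proof. by apply/real_funP; rewrite /ReA !cjE conjA_half; ring. Qed.
Lemma ImA_real u : real_fun (ImA u).
Proof. by apply/real_funP; rewrite /ImA !cjE conjA_half conjA_ii; ring. Qed.

Lemma splitA u : u = ReA u + ii * ImA u.
Proof.
rewrite /ReA /ImA; have h2 := half_half M.
have -> : half * (u + conjA u) + ii * (- (half * ii) * (u - conjA u)) =
  half * ((u + conjA u) - (ii * ii) * (u - conjA u)) by ring.
by rewrite ii2 mulN1r opprK addrACA subrr addr0 mulrDr -mulrDl h2 mul1r.
Qed.

Lemma real_split u v u' v' : real_fun u -> real_fun v -> real_fun u' -> real_fun v' ->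
  u + ii * v = u' + ii * v' -> u = u' /\ v = v'.
Proof.
move=> r_u r_v r_u' r_v' E.
have H p : (rv u p +i* rv v p) = (rv u' p +i* rv v' p).
  have : (u + ii * v) p = (u' + ii * v') p by rewrite E.
  rewrite !(evD, evM, evC) (real_funE p r_u) (real_funE p r_v) (real_funE p r_u') (real_funE p r_v').
  move/eqP; rewrite eq_complex/= !(mul0r, mulr0, subr0, addr0, add0r, mul1r) => /andP[/eqP h1 /eqP h2].
  by rewrite /rv h1 h2.
by split; apply: real_eq => // p; case: (H p).
Qed.

Lemma conjV_subproof X : (fun u => conjA (X (conjA u))) \in @der_pred R n M.
Proof.
apply/asboolP; split=> [c u v|u v].
  by rewrite !cjE conjAC VecD VecZ !cjE conjAC conjcK.
by rewrite !cjE VecM !cjE.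
Qed.
Definition conjV X : Vec := MkVec (conjV_subproof X).

Lemma conjVE X u : conjV X u = conjA (X (conjA u)). Proof. by []. Qed.
Lemma conjVK X : conjV (conjV X) = X.
Proof. by apply: VecPext => u; rewrite !conjVE !conjAK. Qed.
Lemma conjVD X Y : conjV (X + Y) = conjV X + conjV Y.
Proof. by apply: VecPext => u; rewrite !(conjVE, secE, cjE). Qed.
Lemma conjVN X : conjV (- X) = - conjV X.
Proof. by apply: VecPext => u; rewrite !(conjVE, secE, cjE). Qed.
Lemma conjVZ u X : conjV (u *: X) = conjA u *: conjV X.
Proof. by apply: VecPext => v; rewrite !(conjVE, secE, cjE). Qed.

Lemma real_vecP X : real_vec X <-> conjV X = X.
Proof.
split=> [rX|E u ru].
  apply: VecPext => u; rewrite conjVE.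
  have rR := ReA_real u; have rI := ImA_real u.
  have cu : conjA u = ReA u - ii * ImA u.
    by rewrite {1}(splitA u) cjE conjAM conjA_ii (proj1 (real_funP _) rR) (proj1 (real_funP _) rI) mulNr.
  rewrite cu VecB VecZ cjE conjAN conjAM conjA_ii.
  rewrite (proj1 (real_funP _) (rX _ rR)) (proj1 (real_funP _) (rX _ rI)).
  by rewrite mulNr opprK -VecZ -VecD -splitA.
apply/real_funP; rewrite -{2}E conjVE.
by rewrite (proj1 (real_funP u) ru).
Qed.

Lemma conjF_subproof a : (fun X => conjA (a (conjV X))) \in @form1_pred R n M.
Proof.
apply/asboolP => u X Y; rewrite conjVD conjVZ form_D form_Z !cjE.
by [].
Qed.
Definition conjF a : Form1 := MkForm1 (conjF_subproof a).
Lemma conjFE a X : conjF a X = conjA (a (conjV X)). Proof. by []. Qed.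
Lemma conjFK a : conjF (conjF a) = a.
Proof. by apply: Form1Pext => X; rewrite !conjFE conjVK conjAK. Qed.
Lemma conjFD a b : conjF (a + b) = conjF a + conjF b.
Proof. by apply: Form1Pext => X; rewrite !(conjFE, secE, cjE). Qed.
Lemma conjFN a : conjF (- a) = - conjF a.
Proof. by apply: Form1Pext => X; rewrite !(conjFE, secE, cjE). Qed.
Lemma conjFZ u a : conjF (u *: a) = conjA u *: conjF a.
Proof. by apply: Form1Pext => X; rewrite !(conjFE, secE, cjE). Qed.

Lemma splitV X : exists X1 X2, [/\ real_vec X1, real_vec X2 & X = X1 + ii *: X2].
Proof.
exists (half *: (X + conjV X)), (- (half * ii) *: (X - conjV X)); split.
- by apply/real_vecP; rewrite conjVZ conjVD conjVK conjA_half addrC.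
- apply/real_vecP; rewrite conjVZ conjVD conjVN conjVK cjE conjAM conjA_half conjA_ii.
  by apply: VecPext => u; rewrite !secE; ring.
apply: VecPext => u; rewrite !secE.
have -> : half * (X u + conjV X u) + ii * (- (half * ii) * (X u - conjV X u)) =
  half * ((X u + conjV X u) - (ii * ii) * (X u - conjV X u)) by ring.
by rewrite ii2 mulN1r opprK addrACA subrr addr0 mulrDr -mulrDl half_half mul1r.
Qed.

Lemma real_form1P a : real_form1 a <-> conjF a = a.
Proof.
split=> [ra|E X rX].
  apply: Form1Pext => X; rewrite conjFE.
  have [X1 [X2 [r1 r2 ->]]] := splitV X.
  rewrite conjVD conjVZ (proj1 (real_vecP _) r1) (proj1 (real_vecP _) r2) conjA_ii.
  rewrite !(form_D, form_Z) !cjE conjA_ii.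
  by rewrite (proj1 (real_funP _) (ra _ r1)) (proj1 (real_funP _) (ra _ r2)) opprK.
apply/real_funP; rewrite -{2}E conjFE.
by rewrite (proj1 (real_vecP X) rX).
Qed.

Definition conjS e : Sec := (conjV e.1, conjF e.2).

Lemma real_secP e : real_sec e <-> conjS e = e.
Proof.
split=> [[/real_vecP r1 /real_form1P r2]|E].
  by case: e r1 r2 => X a /= r1 r2; rewrite /conjS /= r1 r2.
by split; [apply/real_vecP|apply/real_form1P]; rewrite -{2}E.
Qed.

Lemma conjSK e : conjS (conjS e) = e.
Proof. by case: e => X a; rewrite /conjS /= conjVK conjFK. Qed.
Lemma conjSD e f : conjS (e + f) = conjS e + conjS f.
Proof. by congr (_, _); [exact: conjVD|exact: conjFD]. Qed.
Lemma conjSN e : conjS (- e) = - conjS e.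
Proof. by congr (_, _); [exact: conjVN|exact: conjFN]. Qed.
Lemma conjSZ u e : conjS (u *: e) = conjA u *: conjS e.
Proof. by congr (_, _); [exact: conjVZ|exact: conjFZ]. Qed.
Lemma conjS_dsec u : conjS (dsec u) = dsec (conjA u).
Proof.
apply: SecPext => [v|X].
  have -> : (conjS (dsec u)).1 v = conjA 0 by [].
  by apply: CinfPext => p; rewrite conjAE evE conjc0.
have -> : (conjS (dsec u)).2 X = conjA (conjV X u) by [].
by rewrite conjVE conjAK.
Qed.

Lemma conj_comm X Y : conjV (comm X Y) = comm (conjV X) (conjV Y).
Proof. by apply: VecPext => u; rewrite conjVE !commE !conjVE !cjE. Qed.

Lemma conjS1 e : (conjS e).1 = conjV e.1. Proof. by []. Qed.
Lemma conjS2 e : (conjS e).2 = conjF e.2. Proof. by []. Qed.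

Lemma conj_dorfman e f : conjS (dorfman e f) = dorfman (conjS e) (conjS f).
Proof.
apply: SecPext => [u|X].
  by rewrite conjS1 !dorfman1 conj_comm.
rewrite conjS2 conjFE !dorfman2 !conjS1 !conjS2 !conjFE !conjVE !cjE.
by rewrite !conj_comm !conjVK.
Qed.

Lemma conj_pairing e f : pairing (conjS e) (conjS f) = conjA (pairing e f).
Proof. by rewrite /pairing !conjS1 !conjS2 !conjFE !conjVK !cjE conjA_half. Qed.

Lemma splitS e : exists e1 e2, [/\ real_sec e1, real_sec e2 & e = e1 + ii *: e2].
Proof.
exists (half *: (e + conjS e)), (- (half * ii) *: (e - conjS e)); split.
- by apply/real_secP; rewrite conjSZ conjSD conjSK conjA_half addrC.
- apply/real_secP; rewrite conjSZ conjSD conjSN conjSK cjE conjAM conjA_half conjA_ii.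
  by apply: SecPext => u; rewrite !secE; ring.
have E x y : half * (x + y) + ii * (- (half * ii) * (x - y)) = x.
  have -> : half * (x + y) + ii * (- (half * ii) * (x - y)) =
    half * ((x + y) - (ii * ii) * (x - y)) by ring.
  by rewrite ii2 mulN1r opprK addrACA subrr addr0 mulrDr -mulrDl half_half mul1r.
by apply: SecPext => u; rewrite !secE E.
Qed.

End Conjugation.

(** * Generalized complex structures *)

Section GeneralizedComplex.
Variables (R : realType) (n : nat) (M : manifold R n).
Local Notation A := (Cinf M).
Local Notation Sec := (Sec M).
Implicit Types (u v w : A) (a b e f g : Sec).
Local Notation half := ((2^-1)%:Cst : A).
Local Notation ii := ('i%C%:Cst : A).

Lemma half_split (V : lmodType A) (x : V) : half *: x + half *: x = x.
Proof. by rewrite -scalerDl half_half scale1r. Qed.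

Lemma ii_scale (V : lmodType A) (x : V) : ii *: (ii *: x) = - x.
Proof. by rewrite scalerA ii2 scaleN1r. Qed.

Lemma two_inj (V : lmodType A) (x : V) : x = - x -> x = 0.
Proof.
move=> E; rewrite -(half_split x) {2}E scalerN subrr; by [].
Qed.

Section OneStructure.
Variable J : {linear Sec -> Sec}.
Hypothesis gJ : generalized_complex J.

Lemma JZ u e : J (u *: e) = u *: J e. Proof. exact: linearZ. Qed.
Lemma JD e f : J (e + f) = J e + J f. Proof. exact: linearD. Qed.
Lemma JN e : J (- e) = - J e. Proof. exact: linearN. Qed.
Lemma JB e f : J (e - f) = J e - J f. Proof. exact: linearB. Qed.

Lemma J_conj e : J (conjS e) = conjS (J e).
Proof.
have [[rJ _ _] _ _] := gJ; have [e1 [e2 [r1 r2 ->]]] := splitS e.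
have c1 := proj1 (real_secP _) r1; have c2 := proj1 (real_secP _) r2.
have d1 := proj1 (real_secP _) (rJ _ r1); have d2 := proj1 (real_secP _) (rJ _ r2).
by rewrite conjSD conjSZ !JD !JZ conjSD conjSZ c1 c2 d1 d2.
Qed.

Lemma JJ e : J (J e) = - e. Proof. by have [_ ->] := gJ. Qed.

Lemma J_orth e f : pairing (J e) (J f) = pairing e f.
Proof. by have [[_ -> _] _ _] := gJ. Qed.

Lemma J_skew e f : pairing (J e) f = - pairing e (J f).
Proof. by rewrite -[LHS]J_orth JJ pairingNl. Qed.

Lemma J_real e : real_sec e -> real_sec (J e).
Proof. by have [[rJ _ _] _ _] := gJ; exact: rJ. Qed.

Local Notation L := (eigenL J).
Local Notation Lb := (eigenLbar J).

Lemma L_conj e : L e -> Lb (conjS e).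
Proof.
rewrite /eigenL /eigenLbar /= => Le; rewrite J_conj Le conjSN conjSZ conjA_ii.
by rewrite scaleNr opprK.
Qed.

Lemma Lb_conj e : Lb e -> L (conjS e).
Proof.
rewrite /eigenL /eigenLbar /= => Le; rewrite J_conj Le conjSZ conjA_ii.
by rewrite scaleNr.
Qed.

Lemma L_isotropic e f : L e -> L f -> pairing e f = 0.
Proof.
rewrite /eigenL /= => Le Lf; apply: (two_inj (V := A^o)).
rewrite -[LHS]J_orth Le Lf !pairE.
by transitivity ((ii * ii) * pairing e f); [ring|rewrite ii2 mulN1r].
Qed.

Lemma Lb_isotropic e f : Lb e -> Lb f -> pairing e f = 0.
Proof.
rewrite /eigenLbar /= => Le Lf; apply: (two_inj (V := A^o)).
rewrite -[LHS]J_orth Le Lf !pairE.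
by transitivity ((ii * ii) * pairing e f); [ring|rewrite ii2 mulN1r].
Qed.

Lemma L_dorfman e f : L e -> L f -> L (dorfman e f).
Proof.
move=> Le Lf; have [_ _ inv] := gJ; have := inv e f Le Lf.
by rewrite courantE L_isotropic// dsec0 subr0.
Qed.

Lemma Lb_dorfman e f : Lb e -> Lb f -> Lb (dorfman e f).
Proof.
move=> Le Lf; rewrite -(conjSK (dorfman e f)); apply: L_conj.
by rewrite conj_dorfman; apply: L_dorfman; exact: Lb_conj.
Qed.

Definition piL e := half *: (e + ii *: J e).
Definition piLb e := half *: (e - ii *: J e).

Lemma piL_in e : L (piL e).
Proof.
rewrite /eigenL /piL /= JZ JD JZ JJ.
by apply: SecPext => z; rewrite !secE; ring: (ii2 M).
Qed.

Lemma piLb_in e : Lb (piLb e).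
Proof.
rewrite /eigenLbar /piLb /= JZ JB JZ JJ.
by apply: SecPext => z; rewrite !secE; ring: (ii2 M).
Qed.

Lemma piLDpiLb e : piL e + piLb e = e.
Proof. by rewrite /piL /piLb -scalerDr addrACA subrr addr0 scalerDr half_split. Qed.

Lemma piLb_id e : Lb e -> piLb e = e.
Proof.
rewrite /eigenLbar /piLb /= => ->; rewrite ii_scale opprK scalerDr.
exact: half_split.
Qed.

Lemma piLb_L e : L e -> piLb e = 0.
Proof. by rewrite /eigenL /piLb /= => ->; rewrite scalerN ii_scale !opprK subrr scaler0. Qed.

Lemma piLbD e f : piLb (e + f) = piLb e + piLb f.
Proof. by rewrite /piLb JD; apply: SecPext => z; rewrite !secE; ring. Qed.
Lemma piLbN e : piLb (- e) = - piLb e.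
Proof. by rewrite /piLb JN; apply: SecPext => z; rewrite !secE; ring. Qed.
Lemma piLbZ u e : piLb (u *: e) = u *: piLb e.
Proof. by rewrite /piLb JZ; apply: SecPext => z; rewrite !secE; ring. Qed.

Lemma L_D e f : L e -> L f -> L (e + f).
Proof. by rewrite /eigenL /= JD => -> ->; rewrite scalerDr opprD. Qed.
Lemma L_N e : L e -> L (- e).
Proof. by rewrite /eigenL /= JN => ->; rewrite scalerN. Qed.
Lemma Lb_D e f : Lb e -> Lb f -> Lb (e + f).
Proof. by rewrite /eigenLbar /= JD => -> ->; rewrite scalerDr. Qed.

Lemma dbar0E u : dbar0 J u = piLb (dsec u). Proof. by []. Qed.

(** The derivative of [J] along the infinitesimal symmetry [dorfman e] of the
    Courant algebroid vanishes. *)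
Definition preserves e := forall f, dorfman e (J f) = J (dorfman e f).

Lemma preservesP e : (forall f, L f -> L (dorfman e f)) ->
  (forall f, Lb f -> Lb (dorfman e f)) -> preserves e.
Proof.
move=> eL eLb f; move: (piLDpiLb f) (piL_in f) (piLb_in f).
move: (piL f) (piLb f) => f1 f2 <- Lf1 Lf2; rewrite JD !dorfE JD.
have := eL _ Lf1; have := eLb _ Lf2; move: Lf1 Lf2; rewrite /eigenL /eigenLbar /=.
by move=> -> -> -> ->; rewrite !dorfE.
Qed.

Lemma preserves_L e f : preserves e -> L f -> L (dorfman e f).
Proof. by move=> pe; rewrite /eigenL /= => Lf; rewrite -pe Lf !dorfE. Qed.

Lemma preservesD e f : preserves e -> preserves f -> preserves (e + f).
Proof. by move=> pe pf g; rewrite !dorfE pe pf JD. Qed.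
Lemma preservesZ (c : R[i]) e : preserves e -> preserves (c%:Cst *: e).
Proof. by move=> pe g; rewrite !dorfE pe JZ. Qed.
Lemma preserves_conj e : preserves e -> preserves (conjS e).
Proof.
move=> pe f; have := congr1 (@conjS _ _ _) (pe (conjS f)).
by rewrite conj_dorfman -J_conj conjSK -J_conj conj_dorfman conjSK.
Qed.
Lemma preserves_dorfman e f : preserves e -> preserves f -> preserves (dorfman e f).
Proof.
move=> pe pf g; have H h : dorfman (dorfman e f) h =
  dorfman e (dorfman f h) - dorfman f (dorfman e h) by rewrite (dorfman_leibniz e f h) addrK.
by rewrite !H pf !pe pf JB.
Qed.
Lemma preserves_dsec u : preserves (dsec u).
Proof. by move=> f; rewrite !dorfman_dsecl linear0. Qed.

Lemma dorfman_sym2 e f : dorfman f e = dsec (2 * pairing e f) - dorfman e f.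
Proof. by rewrite -dorfman_sym addrC addKr. Qed.

(** On isotropic sections the Courant and Dorfman brackets agree, and the
    compatibility of the Dorfman bracket with the pairing applies. *)
Lemma dbar1E a e f : Lb a -> L e -> L f ->
  dbar1 J a e f = - 2 * pairing (dorfman a e) f.
Proof.
move=> La Le Lf; rewrite /dbar1.
have c2 : 2%:R = 2%:Cst :> A.
  by apply: CinfPext => p; rewrite -[(2%:R : A)]/(1 + 1).
rewrite courantE (L_isotropic Le Lf) dsec0 subr0 c2 (VecZ e.1 2 (pairing a f)) (VecZ f.1 2 (pairing a e)) -c2.
rewrite dorfman_pairing -(pairing_dsec f (pairing a e)) (dorfman_sym2 a e).
rewrite pairingDl pairingNl c2 dsecZ -c2 pairingZl (pairingC (dsec _)).
ring.
Qed.

(** An isotropic [L] complementary to an isotropic subbundle is its own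
    orthogonal. *)
Lemma L_maximal e : (forall f, L f -> pairing e f = 0) -> L e.
Proof.
move=> H; rewrite -(piLDpiLb e) (_ : piLb e = 0) ?addr0; first exact: piL_in.
apply: pairing_nondeg => f; rewrite -(piLDpiLb f) pairingDr.
rewrite (Lb_isotropic (piLb_in e) (piLb_in f)) addr0.
have := H _ (piL_in f); rewrite -{1}(piLDpiLb e) pairingDl.
by rewrite (L_isotropic (piL_in e) (piL_in f)) add0r.
Qed.

(** [\bar\partial a = 0] says that [dorfman a] maps [L] to its orthogonal [L];
    [\bar L] is mapped to itself by involutivity, as [a] lies in [\bar L]. *)
Lemma ker_dbarP a : ker_dbar J a <-> Lb a /\ preserves a.
Proof.
split=> [[La H]|[La pa]]; split => //.
  apply: preservesP => f Lf; last exact: Lb_dorfman.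
  apply: L_maximal => g Lg; have := H f g Lf Lg; rewrite dbar1E// => E.
  have := congr1 ( *%R half) E; rewrite mulr0 mulrA mulrN half_two mulN1r.
  by move/eqP; rewrite oppr_eq0 => /eqP.
move=> e f Le Lf; rewrite dbar1E// L_isotropic ?mulr0//.
exact: preserves_L.
Qed.

(** [piLb e] differs from [e] by a section of [L], so that it preserves [L]
    as [e] does; it preserves [\bar L] by involutivity. *)
Lemma preserves_piLb e : real_sec e -> preserves e -> preserves (piLb e).
Proof.
move=> re pe; apply: preservesP => f Lf; last exact/Lb_dorfman/Lf/piLb_in.
have -> : dorfman (piLb e) f = dorfman e f - dorfman (piL e) f.
  move: (piLDpiLb e); move: (piL e) (piLb e) => e1 e2 <-.
  by rewrite dorfmanDl addrC addKr.
by apply: L_D; [exact: preserves_L|apply: L_N; apply: L_dorfman => //; exact: piL_in].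
Qed.

Lemma piLb_conj e : real_sec e -> conjS (piLb e) = piL e.
Proof.
move=> re; have ce := proj1 (real_secP _) re.
by rewrite /piLb /piL conjSZ conjSD conjSN conjSZ -J_conj ce conjA_half conjA_ii scaleNr opprK.
Qed.

Lemma preserves_of_piLb e : real_sec e -> preserves (piLb e) -> preserves e.
Proof.
move=> re pe; rewrite -(piLDpiLb e) -piLb_conj//.
by apply: preservesD => //; exact: preserves_conj.
Qed.

(** Up to a multiple of the exact section [dsec u], which acts trivially,
    [J (dsec u)] is a section of [L], and also a section of [\bar L]; so it
    preserves both by involutivity. *)
Lemma preserves_J_dsec u : preserves (J (dsec u)).
Proof.
have E1 : J (dsec u) = 2 *: (ii *: piLb (dsec u)) - ii *: dsec u.
  have -> : 2 *: (ii *: piLb (dsec u)) = ii *: (dsec u - ii *: J (dsec u)).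
    by rewrite /piLb !scalerA; congr (_ *: _); rewrite mulrAC (mulrC 2) half_two mul1r.
  by rewrite scalerBr ii_scale opprK addrAC subrr add0r.
have E2 : J (dsec u) = - (2 *: (ii *: piL (dsec u))) + ii *: dsec u.
  have -> : 2 *: (ii *: piL (dsec u)) = ii *: (dsec u + ii *: J (dsec u)).
    by rewrite /piL !scalerA; congr (_ *: _); rewrite mulrAC (mulrC 2) half_two mul1r.
  by rewrite scalerDr ii_scale opprD opprK addrAC addNr add0r.
have c2 : 2 = 2%:Cst :> A.
  by apply: CinfPext => p; rewrite -[(2%:R : A)]/(1 + 1).
apply: preservesP => f Lf.
  move: E2 (piL_in (dsec u)); move: (piL (dsec u)) => l E2 Ll.
  rewrite E2 c2 !dorfE dorfman_dsecl scaler0 addr0.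
  have := L_dorfman Ll Lf; rewrite /eigenL /= => H.
  by rewrite JN !JZ H; apply: SecPext => z; rewrite !secE; ring.
move: E1 (piLb_in (dsec u)); move: (piLb (dsec u)) => l E1 Ll.
rewrite E1 c2 !dorfE dorfman_dsecl scaler0 subr0.
have := Lb_dorfman Ll Lf; rewrite /eigenLbar /= => H.
by rewrite !JZ H; apply: SecPext => z; rewrite !secE; ring.
Qed.

Lemma preserves_dbar0 u : preserves (dbar0 J u).
Proof.
apply: preservesZ; apply: preservesD; first exact: preserves_dsec.
rewrite -scaleNr -CstN; apply: preservesZ; exact: preserves_J_dsec.
Qed.

Lemma dorfman_dbar0 a u : preserves a -> dorfman a (dbar0 J u) = dbar0 J (a.1 u).
Proof. by move=> pa; rewrite /dbar0 !dorfE pa dorfman_dsecr. Qed.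

Lemma dbar0_dorfman b u : Lb b -> preserves b ->
  dorfman (dbar0 J u) b = - dbar0 J (b.1 u).
Proof.
move=> Lb_b pb; rewrite dorfman_sym2 dorfman_dbar0//.
by rewrite dbar0E Lb_isotropic ?mulr0 ?dsec0 ?sub0r//; exact: piLb_in.
Qed.

End OneStructure.
End GeneralizedComplex.

(** * Holomorphic functions on a generalized Kahler manifold *)

(** The inequality is not assumed at [t = 0], and adding its values at [t] and
    [- t] removes the linear term. *)
Lemma quadratic_ge0 (R : realFieldType) (c b d : R) :
  (forall t, t != 0 -> 0 < c + t *+ 2 * b + t ^+ 2 * d) -> 0 <= c.
Proof.
move=> H; rewrite leNgt; apply/negP => c0.
have e0 : 0 < `|d| + 1 by rewrite ltr_wpDl.
pose t := Num.min 1 (- c / (`|d| + 1)).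
have t0 : 0 < t by rewrite lt_min ltr01 divr_gt0 ?oppr_gt0.
have t1 : t <= 1 by rewrite ge_min lexx.
have tc : t * (`|d| + 1) <= - c by rewrite -ler_pdivlMr// ge_min lexx orbT.
have H1 := H t (lt0r_neq0 t0).
have tn : - t != 0 by rewrite oppr_eq0 lt0r_neq0.
have H2 := H (- t) tn; rewrite sqrrN mulNrn mulNr in H2.
have H3 : t ^+ 2 * d <= t * `|d|.
  apply: le_trans (_ : t ^+ 2 * `|d| <= _).
    by rewrite ler_wpM2l ?ler_norm// exprn_ge0// ltW.
  by rewrite ler_wpM2r// expr2 ler_piMl// ltW.
move: tc H1 H2 H3; rewrite mulrDr mulr1.
move: (t * `|d|) (t ^+ 2 * d) (t *+ 2 * b) t0 => x1 x2 x3.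
by clear; move: t => t; lra.
Qed.

Section Kahler.
Variables (R : realType) (n : nat) (M : manifold R n).
Local Notation A := (Cinf M).
Local Notation Sec := (Sec M).
Implicit Types (u v w : A) (X Y : Vec M) (a b e f g : Sec) (p q y : M).
Local Notation half := ((2^-1)%:Cst : A).
Local Notation ii := ('i%C%:Cst : A).

Variables J Jp : {linear Sec -> Sec}.
Hypothesis gK : generalized_kahler J Jp.
Hypothesis cM : compact [set: M].

Let gJ : generalized_complex J. Proof. by have [] := gK. Qed.
Let gJp : generalized_complex Jp. Proof. by have [] := gK. Qed.
Let Jcomm e : J (Jp e) = Jp (J e). Proof. by have [_ _ ->] := gK. Qed.

Lemma real_secD e f : real_sec e -> real_sec f -> real_sec (e + f).
Proof. by move=> /real_secP re /real_secP rf; apply/real_secP; rewrite conjSD re rf. Qed.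
Lemma real_secN e : real_sec e -> real_sec (- e).
Proof. by move=> /real_secP re; apply/real_secP; rewrite conjSN re. Qed.
Lemma real_secZ u e : real_fun u -> real_sec e -> real_sec (u *: e).
Proof. by move=> /real_funP ru /real_secP re; apply/real_secP; rewrite conjSZ ru re. Qed.
Lemma real_dsec u : real_fun u -> real_sec (dsec u).
Proof. by move=> /real_funP ru; apply/real_secP; rewrite conjS_dsec ru. Qed.
Lemma real_pairing e f : real_sec e -> real_sec f -> real_fun (pairing e f).
Proof. by move=> /real_secP re /real_secP rf; apply/real_funP; rewrite -conj_pairing re rf. Qed.

Definition metric e := - J (Jp e).
Definition gram e f := pairing (metric e) f.

Lemma metric_real e : real_sec e -> real_sec (metric e).
Proof. by move=> re; apply/real_secN/(J_real gJ)/(J_real gJp). Qed.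
Lemma metricD e f : metric (e + f) = metric e + metric f.
Proof. by rewrite /metric (JD Jp) (JD J) opprD. Qed.
Lemma metricZ u e : metric (u *: e) = u *: metric e.
Proof. by rewrite /metric (JZ Jp) (JZ J) scalerN. Qed.
Lemma metricK e : metric (metric e) = e.
Proof. by rewrite /metric (JN Jp) (JN J) opprK Jcomm (JJ gJ) (JN Jp) (JJ gJp) opprK. Qed.
Lemma gram_sym e f : gram e f = gram f e.
Proof.
rewrite /gram /metric [LHS]pairingNl (J_skew gJ) opprK (J_skew gJp).
by rewrite [RHS]pairingNl (pairingC (J _)) Jcomm.
Qed.

Lemma gramDl e f g : gram (e + f) g = gram e g + gram f g.
Proof. by rewrite /gram metricD pairingDl. Qed.
Lemma gramZl u e g : gram (u *: e) g = u * gram e g.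
Proof. by rewrite /gram metricZ pairingZl. Qed.
Lemma gramDr e f g : gram g (e + f) = gram g e + gram g f.
Proof. by rewrite /gram pairingDr. Qed.
Lemma gramZr u e g : gram g (u *: e) = u * gram g e.
Proof. by rewrite /gram pairingZr. Qed.

Lemma gram_real e f : real_sec e -> real_sec f -> real_fun (gram e f).
Proof. by move=> re rf; apply: real_pairing => //; exact: metric_real. Qed.

Lemma gram_metric e f : gram (metric e) f = pairing e f.
Proof. by rewrite /gram metricK. Qed.

Lemma gram_gt0 e p : real_sec e -> ~ sec_vanish p e -> 0 < rv (gram e e) p.
Proof.
move=> re nv; have [_ _ _ pos] := gK; have := pos p e re nv.
by rewrite -/(metric e) -/(gram e e) (real_funE p (gram_real re re)) ltcR.
Qed.

(** The metric is known to be positive only on sections that do not vanish at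
    [p].  If [e] vanishes at [p] and some section [z] does not, then no
    [e + t z] with [t != 0] does, and [t] tends to 0. *)
Lemma gram_ge0 e p : real_sec e -> 0 <= rv (gram e e) p.
Proof.
move=> re; have [ve|ne] := pselect (sec_vanish p e); last exact/ltW/gram_gt0.
have [[z [rz nz]]|allv] := pselect (exists z, real_sec z /\ ~ sec_vanish p z); last first.
  have vz z : real_sec z -> sec_vanish p z.
    by move=> rz; apply: contrapT => nz; apply: allv; exists z.
  rewrite /rv /gram /pairing evM evD.
  have [_ ->] := vz _ re; have [_ ->] := vz _ (metric_real re).
  by rewrite addr0 mulr0.
have H (t : R) : t != 0 -> 0 < rv (gram e e) p + t *+ 2 * rv (gram e z) p + t ^+ 2 * rv (gram z z) p.
  move=> t0; have rt : real_fun (t%:C%:Cst : A) by exact: real_funC.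
  have rvt u : rv (t%:C%:Cst * u) p = t * rv u p by rewrite rvM.
  have := @gram_gt0 (e + t%:C%:Cst *: z) p (real_secD re (real_secZ rt rz)) _.
  rewrite gramDl gramZl !gramDr !gramZr (gram_sym z e) !rvD !rvt !rvD !rvt.
  have -> : t *+ 2 = t + t by rewrite mulr2n.
  rewrite expr2 mulrDr mulrDl !addrA -mulrA; apply; case: ve => v1 v2 [w1 w2]; apply: nz.
  have tn0 : t%:C != 0 by rewrite eq_complex/= negb_and t0.
  split=> [u|X].
    have := w1 u; have := v1 u; rewrite !secE evD evM evC => -> /eqP.
    by rewrite add0r mulf_eq0 (negbTE tn0) => /eqP.
  have := w2 X; have := v2 X; rewrite !secE evD evM evC => -> /eqP.
  by rewrite add0r mulf_eq0 (negbTE tn0) => /eqP.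
exact: quadratic_ge0 H.
Qed.

(** [piL J (piL Jp e)] is a common (-i)-eigensection of [J] and [Jp]; the vector
    parts of these sections are the antiholomorphic fields of the complex
    structure [I_+], so that these equations are the Cauchy-Riemann equations
    of [I_+]. *)
Definition holomorphic u := forall e, (piL J (piL Jp e)).1 u = 0.

(** The antiholomorphic section of a real [e] is, up to a factor, the one with
    the real part [e + metric e] and the imaginary part [J e + Jp e]: these are
    the real Cauchy-Riemann equations. *)
Lemma holomorphicP al be e : real_fun al -> real_fun be ->
  holomorphic (al + ii * be) -> real_sec e ->
  (e + metric e).1 al = (J e + Jp e).1 be /\
  (e + metric e).1 be = - (J e + Jp e).1 al.
Proof.
move=> ra rb hf re; have := hf e.
have -> : piL J (piL Jp e) = (half * half) *: ((e + metric e) + ii *: (J e + Jp e)).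
  rewrite /piL /metric (JZ J) (JD J) (JZ J).
  by apply: SecPext => z; rewrite !secE; ring: (ii2 M).
rewrite sZ1 vZ => /(congr1 ( *%R (2 * 2))); rewrite mulr0 mulrA.
rewrite (_ : 2 * 2 * (half * half) = 1) ?mul1r; last first.
  by rewrite mulrACA (mulrC 2) half_two mul1r.
rewrite sD1 sZ1 vD vZ !VecD !VecZ.
set P := (e + metric e).1; set Q := (J e + Jp e).1 => E.
have rP : real_vec P by have [] := real_secD re (metric_real re).
have rQ : real_vec Q by have [] := real_secD (J_real gJ re) (J_real gJp re).
have r1 : real_fun (P al - Q be) by apply: real_funB; [exact: rP|exact: rQ].
have r2 : real_fun (P be + Q al) by apply: real_funD; [exact: rP|exact: rQ].
have r0 := @real_fun0 R n M.
have [|h1 h2] := real_split r1 r2 r0 r0.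
  by rewrite mulr0 addr0 -E; ring: (ii2 M).
by split; [apply/subr0_eq|apply/eqP; rewrite -addr_eq0 h2].
Qed.

(** By the Cauchy-Riemann equations, twice either side is, up to sign, the
    pairing of one differential with the image of the other by the
    skew-symmetric [J + Jp]. *)
Lemma holomorphic_gram al be : real_fun al -> real_fun be ->
  holomorphic (al + ii * be) ->
  gram (dsec al) (dsec al) = gram (dsec be) (dsec be).
Proof.
move=> ra rb hf.
have [h1 _] := holomorphicP ra rb hf (real_dsec ra).
have [_ h2] := holomorphicP ra rb hf (real_dsec rb).
have two_gram u : 2 * gram (dsec u) (dsec u) = (dsec u + metric (dsec u)).1 u.
  by rewrite sD1 vD dsec1 v0 add0r -pairing_dsec.
have : 2 * gram (dsec al) (dsec al) = 2 * gram (dsec be) (dsec be).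
  rewrite !two_gram h1 h2 -!pairing_dsec -mulrN; congr (2 * _).
  rewrite !pairingDl (J_skew gJ) (J_skew gJp) opprD.
  by rewrite !(pairingC (dsec al)).
by move/(congr1 ( *%R half)); rewrite !mulrA half_two !mul1r.
Qed.

Lemma rv_real_gt0_near u q : 0 < rv u q -> \forall z \near q, 0 < rv u z.
Proof.
by move=> u0; have := @cvgr_gt R M _ (nbhs_filter q) (rv u) _ (@rv_continuous _ _ _ u q) 0 u0.
Qed.

(** Hopf's argument, at a point [q] where the ball {tau < 0} touches the set
    {al = m} from outside it.  Let [v] and [w] be the vector fields of
    [holomorphicP] for [e = dsec tau], so that [v tau = 2 N] with
    [N = G(dtau, dtau)], and [w tau = 0].  The barrier
    [h = lam tau^2 - tau] is negative for small [tau > 0], so on the boundary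
    of a small neighbourhood [K] of [q] the function [k = al + eps h] is less
    than its value [m] at [q], for small [eps]; it has a maximum at an
    interior point [y].  There [d al = - eps kap d tau], where
    [dh = kap dtau]; and [comm v w be + eps (v v + w w) h <= 0].  As
    [G(dbe, dbe) = G(dal, dal) = eps^2 kap^2 N], the first term is at least
    [- eps (E + kap^2 N)] by the Cauchy-Schwarz inequality, where [E] is the
    squared length of the field [comm v w].  So [eps F <= 0] with
    [F = (v v + w w) h - E - kap^2 N].  But [(v v + w w) h] contains
    [8 lam N^2], so that [F > 0] near [q] for large [lam]. *)
Lemma holomorphic_locally_constant al be : real_fun al -> real_fun be ->
  holomorphic (al + ii * be) -> forall p, locally_constant al p.
Proof.
move=> ra rb hf; apply: contrapT => /(touching_function cM ra).
move=> [q [tau [X0 [[rtau tauq] X0tau almax alstrict]]]].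
set m := rv al q in almax alstrict.
pose e0 := dsec tau; have re0 : real_sec e0 := real_dsec rtau.
pose N := gram e0 e0.
pose v := (e0 + metric e0).1; pose w := (J e0 + Jp e0).1.
have rv_v : real_vec v by have [] := real_secD re0 (metric_real re0).
have rv_w : real_vec w by have [] := real_secD (J_real gJ re0) (J_real gJp re0).
have [val vbe] := holomorphicP ra rb hf re0.
rewrite -/v -/w in val vbe.
have vtau : v tau = 2 * N.
  by rewrite /v sD1 vD dsec1 v0 add0r -pairing_dsec.
have wtau : w tau = 0.
  rewrite /w -pairing_dsec pairingDl.
  have E (K : {linear Sec -> Sec}) : generalized_complex K -> pairing (K e0) e0 = 0.
    move=> gc; apply: (two_inj (V := A^o)).
    by rewrite [LHS](J_skew gc) pairingC.
  by rewrite !E// addr0 mulr0.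
pose D := v (v tau) + w (w tau).
pose ec : Sec := (comm v w, 0).
have rec : real_sec ec.
  split=> [u ru|X rX]; last exact: real_fun0.
  by rewrite commE; apply: real_funB; [exact/rv_v/rv_w|exact/rv_w/rv_v].
pose E := gram (metric ec) (metric ec).
have rN : real_fun N by exact: gram_real.
have rD : real_fun D.
  by apply: real_funD; [exact/rv_v/rv_v|exact/rv_w/rv_w].
have rE : real_fun E by apply: gram_real; exact: metric_real.
have Nq : 0 < rv N q.
  apply: gram_gt0 => // -[_ vt]; apply: X0tau.
  by have := vt X0; rewrite dsec2 dfunE.
(* the value at q, where kap = -1, of F is 8 lam N ^ 2 - D - E - N *)
pose lam := (`|rv D q| + `|rv E q| + rv N q + 1) / (8 * rv N q ^+ 2).
have lam0 : 0 < lam.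
  apply: divr_gt0; last by rewrite mulr_gt0// exprn_gt0.
  by rewrite ltr_wpDl// ?addr_ge0// ltW.
pose lamA : A := lam%:C%:Cst.
have rlam : real_fun lamA by exact: real_funC.
have twoA : (2 : A) = 2%:C%:Cst.
  apply: CinfPext => z; rewrite -[(2%:R : A)]/(1 + 1) evD ev1 evC.
  by apply/eqP; rewrite eq_complex/= addr0 !eqxx.
have r2 : real_fun (2 : A) by rewrite twoA; exact: real_funC.
pose h := lamA * (tau * tau) - tau.
pose kap := 2 * lamA * tau - 1.
have rh : real_fun h by apply: real_funB => //; do 2!apply: real_funM => //.
have rkap : real_fun kap.
  by apply: real_funB => //; do 2!apply: real_funM => //.
have Xh X : X h = kap * X tau.
  by rewrite /h /kap /lamA VecB VecZ VecM; ring.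
pose F := kap * D + 2 * lamA * (2 * N) * (2 * N) - E - kap * kap * N.
have Fq : 0 < rv F q.
  have tq : rv tau q = 0 by rewrite /rv tauq.
  have rv2 z : rv (2 : A) z = 2 by rewrite twoA.
  have rv1 z : rv (1 : A) z = 1 by [].
  have kq : rv kap q = - 1.
    by rewrite /kap rvB rvM ?tq ?mulr0 ?sub0r//; exact: real_funM.
  rewrite /F !rvB rvD (rvM _ _ rkap) (rvM _ _ (real_funM rkap rkap)) (rvM _ _ rkap) kq.
  have rlN : real_fun (2 * lamA * (2 * N)) by do 2!apply: real_funM => //.
  rewrite (rvM _ _ rlN) (rvM _ _ (real_funM r2 rlam)) !(rvM _ _ r2) !rv2.
  rewrite (_ : rv lamA q = lam)//.
  have -> : 2 * lam * (2 * rv N q) * (2 * rv N q) = lam * (8 * rv N q ^+ 2) by ring.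
  rewrite divfK; last by rewrite gt_eqF// mulr_gt0// exprn_gt0.
  have := ler_norm (rv D q); have := ler_norm (rv E q).
  by clear; lra.
have near1 : \forall z \near q, 0 < rv (1 - lamA * tau) z.
  apply: rv_real_gt0_near; rewrite rvB (rvM _ _ rlam).
  have -> : rv tau q = 0 by rewrite /rv tauq.
  by rewrite mulr0 subr0 /rv ev1 /=.
pose Om := [set z | [/\ 0 < rv F z, 0 < rv (1 - lamA * tau) z, rv al z <= m &
  z <> q -> rv tau z <= 0 -> rv al z < m]].
have Omq : nbhs q Om.
  apply: filterS2 (filterI (rv_real_gt0_near Fq) near1) (filterI almax alstrict).
  by move=> z [? ?] [? ?].
have [B Bq BOm] : filter_from (nbhs q) closure Om.
  exact: (compact_regular (@hausdorff_points _ _ M) cM filterT Omq).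
pose K := closure B.
have cK : closed K by exact: closed_closure.
have Kq : nbhs q K by apply: filterS Bq; exact: subset_closure.
(* On the part of the boundary where tau <= 0, al is less than m by a positive
   amount, by compactness; on the part where tau > 0, h is negative. *)
have [eps eps0 epsP] : exists2 eps, 0 < eps & forall z, K z -> ~ nbhs z K ->
    rv al z + eps * rv h z < m.
  have [C C0 HC] := bounded_rv cM h.
  pose T := (K `&` ~` K°) `&` [set z | rv tau z <= 0].
  have cT : closed T.
    apply: closedI; first by apply: closedI => //; apply: open_closedC; exact: open_interior.
    apply: (@preimage_closed _ _ (rv tau) [set t | t <= 0]); last exact: closed_le.
    by move=> z _; exact: rv_continuous.
  have pos z : Om z -> 0 < rv tau z -> rv h z < 0.
    move=> [_ z1 _ _] tz; rewrite /h rvB (rvM _ _ rlam) (rvM _ _ rtau).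
    rewrite mulrA -[X in _ - X]mul1r -mulrBl pmulr_llt0// subr_lt0.
    by move: z1; rewrite rvB (rvM _ _ rlam) subr_gt0.
  have [T0|nT] := pselect (T !=set0).
    have [t Tt tmax] := exists_max cM al cT T0.
    have tm : rv al t < m.
      have [[Kt nt] tt] := Tt; have [_ _ _ st] := BOm _ Kt; apply: st => // tq.
      by apply: nt; rewrite tq.
    exists ((m - rv al t) / (2 * C)).
      by rewrite divr_gt0 ?subr_gt0// mulr_gt0.
    move=> z Kz nz; have Oz := BOm _ Kz; have [tz|tz] := leP (rv tau z) 0.
      have zt : rv al z <= rv al t by apply: tmax.
      have hz : (m - rv al t) / (2 * C) * rv h z <= (m - rv al t) / (2 * C) * C.
        rewrite ler_pM2l ?divr_gt0 ?subr_gt0 ?mulr_gt0//.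
        by apply: le_trans (HC z); exact: ler_norm.
      have : (m - rv al t) / (2 * C) * C = (m - rv al t) / 2.
        by field; rewrite gt_eqF.
      by clear -tm zt hz; lra.
    have [_ _ az _] := Oz; have hz := pos _ Oz tz.
    rewrite -[ltRHS]addr0; apply: ler_ltD => //.
    by rewrite pmulr_rlt0// divr_gt0 ?subr_gt0 ?mulr_gt0.
  exists 1 => // z Kz nz; have Oz := BOm _ Kz; rewrite mul1r.
  have tz : 0 < rv tau z.
    by rewrite ltNge; apply/negP => tz; apply: nT; exists z.
  have [_ _ az _] := Oz; have hz := pos _ Oz tz.
  by rewrite -[ltRHS]addr0; apply: ler_ltD.
pose epsA : A := eps%:C%:Cst.
have reps : real_fun epsA by exact: real_funC.
pose k := al + epsA * h.
have rk : real_fun k by apply: real_funD => //; exact: real_funM.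
have kE z : rv k z = rv al z + eps * rv h z by rewrite rvD rvM.
have [y Ky ymax] := exists_max cM k cK (ex_intro _ q (nbhs_singleton Kq)).
have ky : m <= rv k y.
  have tq : rv tau q = 0 by rewrite /rv tauq.
  have hq : rv h q = 0.
    by rewrite /h rvB (rvM _ _ rlam) (rvM _ _ rtau) tq !mulr0 subr0.
  by have := ymax q (nbhs_singleton Kq); rewrite [rv k q]kE hq mulr0 addr0.
have yint : nbhs y K.
  by apply: contrapT => /(epsP _ Ky); rewrite -kE ltNge ky.
have kmax : \forall z \near y, rv k z <= rv k y by apply: filterS yint => z /ymax.
have [Fy _ _ _] := BOm _ Ky.
have first X : X al y = - (epsA * kap * X tau) y.
  have := max_first_order X rk kmax; rewrite /k VecD VecZ Xh evD => /eqP.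
  by rewrite addr_eq0 => /eqP ->; rewrite mulrA.
have metric_der (a b : A) : (metric (dsec a)).1 b = 2 * gram (dsec a) (dsec b).
  by rewrite /gram pairing_dsec.
have ek_real : real_fun (epsA * kap) by exact: real_funM.
have two_cancel (x z : A) : (2 * x) y = (2 * z) y -> x y = z y.
  by rewrite !evM twoA evC; apply: mulfI; rewrite eq_complex/= pnatr_eq0.
have gram_al : (gram (dsec al) (dsec al)) y = (epsA * kap * (epsA * kap * N)) y.
  have E1 : (2 * gram (dsec al) e0) y = - (epsA * kap * (2 * N)) y.
    by rewrite gram_sym -metric_der first metric_der.
  apply: two_cancel; rewrite -metric_der first metric_der evM E1.
  by rewrite mulrN opprK -evM; congr (Cinf_fun _ y); ring.
have gram_be : rv (gram (dsec be) (dsec be)) y = (eps * rv kap y) ^+ 2 * rv N y.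
  rewrite -(holomorphic_gram ra rb hf) /rv gram_al -/(rv _ _).
  by rewrite (rvM _ _ ek_real) (rvM _ _ ek_real) (rvM _ _ reps) /= expr2 mulrA.
have lapl_al : v (v al) + w (w al) = comm v w be.
  by rewrite commE val -[w al]opprK -vbe VecN.
have lapl_h : v (v h) + w (w h) = kap * D + 2 * lamA * (2 * N) * (2 * N).
  have Xkap X : X kap = 2 * lamA * X tau.
    by rewrite /kap VecB Vec1 subr0 twoA /lamA -CstM VecZ.
  by rewrite !Xh !VecM !Xkap wtau vtau /D wtau vtau; ring.
have lapl_k : rv (comm v w be) y + eps * rv (kap * D + 2 * lamA * (2 * N) * (2 * N)) y <= 0.
  have h1 := max_second_order rv_v rk kmax; have h2 := max_second_order rv_w rk kmax.
  have : rv (v (v k) + w (w k)) y <= 0.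
    by rewrite rvD -[leRHS]addr0; exact: lerD.
  have -> : v (v k) + w (w k) = comm v w be + epsA * (v (v h) + w (w h)).
    have YYk Y : Y (Y k) = Y (Y al) + epsA * Y (Y h).
      by rewrite /k /epsA VecD VecZ VecD VecZ.
    by rewrite !YYk -lapl_al; ring.
  by rewrite rvD (rvM _ _ reps) lapl_h.
(* Cauchy-Schwarz: the squared length of eps * (comm v w) + dbe *)
have cs : 0 <= eps ^+ 2 * rv E y + eps * rv (comm v w be) y + (eps * rv kap y) ^+ 2 * rv N y.
  have rm := metric_real rec; have rbe := real_dsec rb.
  have cbE : 2 * pairing ec (dsec be) = comm v w be by rewrite pairing_dsec.
  have EQ : gram (epsA *: metric ec + dsec be) (epsA *: metric ec + dsec be) =
      epsA * (epsA * E) + epsA * comm v w be + gram (dsec be) (dsec be).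
    rewrite !gramDl !gramDr !gramZl !gramZr -/E (gram_sym (dsec be)) gram_metric -cbE.
    by ring.
  have := gram_ge0 y (real_secD (real_secZ reps rm) rbe); rewrite EQ.
  move: gram_be rE; move: (comm v w be : A) (gram (dsec be) (dsec be)) (E) => cb gb E' gbE rE'.
  rewrite (rvD (epsA * (epsA * E') + epsA * cb)) (rvD (epsA * (epsA * E'))).
  by rewrite (rvM _ _ reps) (rvM E' _ reps) (rvM cb _ reps) gbE [eps ^+ 2]expr2 -[eps * eps * _]mulrA.
have FE : rv F y = rv (kap * D + 2 * lamA * (2 * N) * (2 * N)) y - rv E y - rv kap y ^+ 2 * rv N y.
  rewrite /F; move: (kap * D + _) => S.
  by rewrite (rvB (S - E)) (rvB S) (rvM N _ (real_funM rkap rkap)) (rvM kap _ rkap) expr2.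
have : 0 < eps ^+ 2 * rv F y by rewrite mulr_gt0// exprn_gt0.
have : eps * (rv (comm v w be) y + eps * rv (kap * D + 2 * lamA * (2 * N) * (2 * N)) y) <= 0.
  by rewrite pmulr_rle0.
rewrite FE; move: cs; rewrite exprMn !expr2.
move: (rv (comm v w be) y) (rv (kap * D + _) y) (rv E y) (rv kap y) (rv N y) => x1 x2 x3 x4 x5.
clear; move=> h1 h2 h3.
have : eps * (x1 + eps * x2) - eps * eps * (x2 - x3 - x4 * x4 * x5) =
  eps * eps * x3 + eps * x1 + eps * eps * (x4 * x4) * x5 by ring.
by lra.
Qed.

(** The imaginary part has a zero gradient because the real part has one, by
    [holomorphic_gram]. *)
Lemma holomorphic_constant u : holomorphic u -> forall X, X u = 0.
Proof.
move=> hu X; have ra := ReA_real u; have rb := ImA_real u.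
have hf : holomorphic (ReA u + ii * ImA u) by rewrite -splitA.
have Xal Y : Y (ReA u) = 0.
  apply: CinfPext => p; apply: max_first_order => //.
  have := holomorphic_locally_constant ra rb hf p.
  by apply: filterS => q ->.
have Xbe Y : Y (ImA u) = 0.
  apply: CinfPext => p; apply: contrapT => Yp.
  have : 0 < rv (gram (dsec (ImA u)) (dsec (ImA u))) p.
    apply: gram_gt0; first exact: real_dsec.
    by move=> [_ /(_ Y)]; rewrite dsec2 dfunE => /Yp.
  rewrite -(holomorphic_gram ra rb hf).
  have -> : gram (dsec (ReA u)) (dsec (ReA u)) = half * (metric (dsec (ReA u))).1 (ReA u).
    by rewrite -pairing_dsec mulrA half_two mul1r.
  by rewrite Xal mulr0 /rv ev0 ltxx.
by rewrite (splitA u) VecD VecZ Xal Xbe mulr0 addr0.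
Qed.

(** On common (-i)-eigensections of [J] and [Jp], [Jp (dbar0 J u)] pairs like
    [i d u], so the hypothesis makes [s - i u] holomorphic, hence [ds = i du].
    Then [Jp] acts as [i] on the component of [du] in [\bar L_J] and, [u] being
    real, as [- i] on the component in [L_J]: it acts on [du] as [J] does,
    and [G(du, du) = <du, du> = 0]. *)
Lemma exact_hamiltonian u s : real_fun u -> Jp (dbar0 J u) = dbar0 J s ->
  forall X, X u = 0.
Proof.
move=> ru Es.
have hol : holomorphic (s - ii * u).
  move=> e; set l := piL J (piL Jp e).
  have Jl : eigenL J l by exact: piL_in.
  have Jpl : eigenL Jp l.
    move: (piL_in gJp e); rewrite /l; move: (piL Jp e) => x Hx.
    have {}Hx : Jp x = - (ii *: x) := Hx.
    rewrite /eigenL /piL /= (JZ Jp) (JD Jp) (JZ Jp) -Jcomm Hx (JN J) (JZ J).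
    by apply: SecPext => z; rewrite !secE; ring.
  have pl h : pairing l (dsec h) = pairing l (dbar0 J h).
    rewrite -{1}(piLDpiLb J (dsec h)) pairingDr (L_isotropic gJ Jl (piL_in gJ _)).
    by rewrite add0r.
  rewrite VecB VecZ -!pairing_dsec !pl -Es.
  have -> : pairing l (Jp (dbar0 J u)) = ii * pairing l (dbar0 J u).
    by rewrite -[LHS]opprK -(J_skew gJp) (Jpl : Jp l = _) pairingNl pairingZl opprK.
  ring.
have Xs X : X s = ii * X u.
  have := holomorphic_constant hol X; rewrite VecB VecZ => /eqP.
  by rewrite subr_eq0 => /eqP.
have ds : dsec s = ii *: dsec u.
  apply: SecPext => [z|X]; first by rewrite sZ1 !dsec1 vZ !v0 mulr0.
  by rewrite sZ2 !dsec2 fZ !dfunE Xs.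
have E1 : Jp (piLb J (dsec u)) = ii *: piLb J (dsec u).
  by rewrite -!dbar0E Es dbar0E ds piLbZ.
have ce : conjS (dsec u) = dsec u by apply/real_secP; exact: real_dsec.
have E2 : Jp (piL J (dsec u)) = - (ii *: piL J (dsec u)).
  have := congr1 (@conjS _ _ _) E1; rewrite -(J_conj gJp) conjSZ conjA_ii.
  by rewrite (piLb_conj gJ)//; [rewrite scaleNr|exact: real_dsec].
have JpE : Jp (dsec u) = J (dsec u).
  rewrite -{1}(piLDpiLb J (dsec u)) (JD Jp) E1 E2 /piL /piLb.
  rewrite -[RHS](half_split (J (dsec u))).
  by apply: SecPext => z; rewrite !secE; ring: (ii2 M).
move=> X; apply: CinfPext => p; apply: contrapT => Xp.
have : 0 < rv (gram (dsec u) (dsec u)) p.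
  apply: gram_gt0; first exact: real_dsec.
  by move=> [_ /(_ X)]; rewrite dsec2 dfunE => /Xp.
by rewrite /gram /metric JpE (JJ gJ) opprK pairing_dsec2 /rv ev0 ltxx.
Qed.

End Kahler.

(** * A sufficient condition for reductivity *)

Section LieAlgebra.
Variables (K : fieldType) (V : lmodType K) (br : V -> V -> V) (g : set V).
Hypothesis lie : lie_algebra br g.
Hypothesis skew : forall x y, g x -> g y -> br x y = - br y x.
Hypothesis ad_nil : forall x y, g x -> g y -> br x (br x y) = 0 -> br x y = 0.
Implicit Types (x y z : V) (h : set V).

Let g0 : g 0. Proof. by have [[]] := lie. Qed.
Let gD x y : g x -> g y -> g (x + y).
Proof. by move=> gx gy; have [[_ gl] _ _ _ _] := lie; rewrite -(scale1r x); exact: gl. Qed.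
Let gbr x y : g x -> g y -> g (br x y). Proof. by have [_ H _ _ _] := lie; exact: H. Qed.
Let brDl x y z : g x -> g y -> g z -> br (x + y) z = br x z + br y z.
Proof.
move=> gx gy gz; have [_ _ H _ _] := lie.
by have := H 1 x y z gx gy gz; rewrite !scale1r.
Qed.
Let br0l z : g z -> br 0 z = 0.
Proof.
move=> gz; have := brDl g0 g0 gz; rewrite addr0 => E.
by apply: (addrI (br 0 z)); rewrite -E addr0.
Qed.
Let brZl a x z : g x -> g z -> br (a *: x) z = a *: br x z.
Proof.
move=> gx gz; have [_ _ H _ _] := lie.
by have := H a x 0 z gx g0 gz; rewrite addr0 br0l// addr0.
Qed.
Let gZ a x : g x -> g (a *: x).
Proof. by move=> gx; have [[_ gl] _ _ _ _] := lie; rewrite -[a *: x]addr0; exact: gl. Qed.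
Let jac x y z : g x -> g y -> g z -> br x (br y z) + br y (br z x) + br z (br x y) = 0.
Proof. by have [_ _ _ _ H] := lie; exact: H. Qed.

Lemma span_subspace (S : set V) : subspace (span S).
Proof.
split=> [h [h0 _] _ //|a x y Sx Sy h sh Sh].
by have [_ hl] := sh; apply: hl; [exact: Sx|exact: Sy].
Qed.

Lemma span_sub (S : set V) : S `<=` span S.
Proof. by move=> x Sx h _; exact. Qed.

Lemma derived_br h x y : h x -> h y -> derived br h (br x y).
Proof. by move=> hx hy; apply: span_sub; exists x => //; exists y. Qed.

Lemma ideal_br h x y : ideal br g h -> h x -> g y -> h (br x y).
Proof.
move=> [hg [h0 hl] hI] hx gy; rewrite skew//; last exact: hg.
by rewrite -scaleN1r -[_ *: _]addr0; apply: hl => //; exact: hI.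
Qed.

Lemma derived_ideal h : ideal br g h -> ideal br g (derived br h).
Proof.
move=> hi; have [hg [h0 hl] hI] := hi.
have dg : derived br h `<=` g.
  move=> x; apply; first by have [] := lie.
  by move=> _ [y hy [z hz <-]]; apply: gbr; exact: hg.
split=> //; first exact: span_subspace.
move=> z x gz; pose B := [set x | g x /\ derived br h (br z x)].
suff : derived br h `<=` B by move=> H /H[].
have [d0 dl] := span_subspace [set br x y | x in h & y in h].
move=> {}x; apply.
  split; first by split=> //; rewrite skew// br0l// oppr0.
  move=> a u v [gu du] [gv dv]; split; first by apply: gD => //; exact: gZ.
  have -> : br z (a *: u + v) = a *: br z u + br z v.
    rewrite skew//; last by apply: gD => //; exact: gZ.
    by rewrite brDl ?brZl//; [rewrite (skew gu gz) (skew gv gz) scalerN opprD !opprK|exact: gZ].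
  exact: dl.
move=> _ [u hu [v hv <-]]; have gu := hg _ hu; have gv := hg _ hv.
split; first exact: gbr.
have hvz : h (br v z) by exact: ideal_br.
have hzu : h (br z u) by exact: hI.
have -> : br z (br u v) = (- 1) *: br u (br v z) + - br v (br z u).
  by rewrite scaleN1r -opprD; apply/eqP; rewrite -addr_eq0 addrC; apply/eqP; exact: jac.
apply: (dl); first exact: derived_br.
by rewrite -scaleN1r -[_ *: _]addr0; apply: dl => //; exact: derived_br.
Qed.

(** For [y] in an abelian ideal, [ad_y] maps [g] to the ideal, which [ad_y]
    kills. *)
Lemma abelian_ideal_central h : ideal br g h -> derived br h `<=` [set 0] ->
  h `<=` center br g.
Proof.
move=> hi hab y hy; have [hg _ hI] := hi; split=> [|x gx]; first exact: hg.
apply: ad_nil => //; first exact: hg.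
by apply: hab; apply: derived_br => //; exact: ideal_br.
Qed.

(** An ideal that is nilpotent of class two is abelian, as the squares of the
    [ad_u] vanish on it. *)
Lemma derived_central h : ideal br g h -> derived br h `<=` center br g ->
  derived br h `<=` [set 0].
Proof.
move=> [hg _ _] hc x; apply.
  by split=> // a u v -> ->; rewrite scaler0 addr0.
move=> _ [u hu [v hv <-]]; apply: ad_nil; try exact: hg.
have [gc cc] := hc _ (derived_br hu hv).
by rewrite skew ?cc ?oppr0//; exact: hg.
Qed.

(** By induction on the derived length, the derived ideal of [h] is central; so
    it is 0, and [h] is an abelian ideal. *)
Lemma solvable_ideal_central h : ideal br g h -> solvable br h -> h `<=` center br g.
Proof.
move=> + [k]; elim: k h => [|k IH] h hi hk.
  move=> x /hk ->; split=> // y gy; exact: br0l.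
apply: abelian_ideal_central => //; apply: derived_central => //.
by apply: IH; [exact: derived_ideal|rewrite -iterSr].
Qed.

Lemma center_ideal : ideal br g (center br g).
Proof.
split=> [x []//| |x y gx [gy cy]].
  split; first by split=> // y gy; exact: br0l.
  move=> a x y [gx cx] [gy cy]; split; first by apply: gD => //; exact: gZ.
  move=> z gz; rewrite brDl// ?brZl// ?cx ?cy ?scaler0 ?addr0//; exact: gZ.
rewrite skew// cy// oppr0; split=> // z gz; exact: br0l.
Qed.

Lemma reductive_ad_nil : reductive br g.
Proof.
exists (center br g) => //; split; first exact: center_ideal.
  exists 1%N => /= x; apply; first by split=> // a u v -> ->; rewrite scaler0 addr0.
  by move=> _ [u [gu cu] [v [gv _] <-]]; exact: cu.
exact: solvable_ideal_central.
Qed.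

End LieAlgebra.

(** * Reduced automorphisms and the Poisson bracket *)

Section ReducedAutomorphisms.
Variables (R : realType) (n : nat) (M : manifold R n).
Local Notation A := (Cinf M).
Local Notation Sec := (Sec M).
Variables J Jp : {linear Sec -> Sec}.
Hypothesis gK : generalized_kahler J Jp.
Hypothesis cM : compact [set: M].
Implicit Types (u v w : A) (a b e f : Sec).

Let gJ : generalized_complex J. Proof. by have [] := gK. Qed.
Let gJp : generalized_complex Jp. Proof. by have [] := gK. Qed.
Let Jcomm e : J (Jp e) = Jp (J e). Proof. by have [_ _ ->] := gK. Qed.

(** [red] is the component of the Hamiltonian section [ham] in [\bar L_J]
    ([redE]), and [pb] is the Poisson bracket. *)
Let ham u := Jp (dsec u).
Let red u := Jp (dbar0 J u).
Let pb u v := (ham u).1 v.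

Let redE u : red u = piLb J (ham u).
Proof.
by rewrite /red /ham dbar0E /piLb (JZ Jp) (JB Jp) (JZ Jp) Jcomm.
Qed.

Let potential u := real_fun u /\ preserves J (ham u).

Let ham_real u : real_fun u -> real_sec (ham u).
Proof. by move=> ru; apply: (J_real gJp); exact: real_dsec. Qed.

(** A real section and its component in [\bar L_J] are symmetries of [J] at the
    same time, as the component in [L_J] is conjugate to the other one. *)
Let potentialP u : (reduced J Jp `&` @real_fun R n M) u <-> potential u.
Proof.
split=> [[ku ru]|[ru pu]]; split => //.
  have [_] := proj1 (ker_dbarP gJ _) ku; rewrite -/(red u) redE.
  by apply: preserves_of_piLb => //; exact: ham_real.
apply/(ker_dbarP gJ); rewrite -/(red u) redE; split; first exact: piLb_in.
by apply: preserves_piLb => //; exact: ham_real.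
Qed.

Let red_ker u : potential u -> eigenLbar J (red u) /\ preserves J (red u).
Proof.
by move=> [ru pu]; rewrite redE; split; [exact: piLb_in|apply: preserves_piLb => //; exact: ham_real].
Qed.

Let dorfman_ham u v : potential u -> dorfman (ham u) (ham v) = ham (pb u v).
Proof.
move=> pu; rewrite {2}/ham (preserves_J_dsec gJp u (dsec v)) dorfman_dsecr.
by [].
Qed.

Let pb_potential u v : potential u -> potential v -> potential (pb u v).
Proof.
move=> pu pv; have [[ru Pu] [rv Pv]] := (pu, pv); split.
  by have [r1 _] := ham_real ru; exact: r1.
by rewrite -dorfman_ham//; exact: preserves_dorfman.
Qed.

Let pb_skew u v : pb u v = - pb v u.
Proof.
rewrite /pb -!pairing_dsec (J_skew gJp) mulrN; congr (- (2 * _)).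
by rewrite pairingC.
Qed.

(** This is the expression of the vector part of [dorfman (ham u) (ham v)] as a
    commutator of fields. *)
Let pb_jac u v w : potential u -> pb u (pb v w) = pb (pb u v) w + pb v (pb u w).
Proof.
move=> pu; rewrite {3}/pb -dorfman_ham// dorfman1 commE.
by rewrite subrK.
Qed.

(** With [l] the component of [ham u] in [L_J], the component of the bracket is
    [dorfman (ham u) (red v)], the sum of [dorfman (red u) (red v)] and of
    [dorfman l (red v)].  The last one lies in [\bar L_J], as the other two do,
    and [- dorfman (red v) l] in [L_J]; their difference being exact, it is
    [\bar\partial] of the pairing. *)
Let cl_bracket u v : potential u -> potential v ->
  cl J (dorfman (red u) (red v)) = cl J (red (pb u v)).
Proof.
move=> pu pv; have [Lu Pu] := red_ker pu; have [Lv Pv] := red_ker pv.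
have [ru Hu] := pu.
pose l := conjS (red u).
have Ll : eigenL J l by exact: Lb_conj.
have lE : dorfman (ham u) (red v) = dorfman (red u) (red v) + dorfman l (red v).
  rewrite -dorfmanDl /l; congr (dorfman _ _).
  by rewrite redE (piLb_conj gJ (ham_real ru)) addrC piLDpiLb.
have E1 : dorfman (ham u) (red v) = red (pb u v).
  rewrite !redE -dorfman_ham// /piLb.
  by rewrite dorfmanZr dorfmanDr dorfmanNr dorfmanZr Hu.
have E2 : piLb J (dorfman l (red v)) = dbar0 J (2 * pairing (red v) l).
  rewrite (dorfman_sym2 (red v) l) piLbD piLbN (piLb_L (preserves_L Pv Ll)) subr0.
  by [].
have E3 : eigenLbar J (dorfman l (red v)).
  have -> : dorfman l (red v) = red (pb u v) + - dorfman (red u) (red v).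
    by rewrite -E1 lE addrAC subrr add0r.
  apply: (Lb_D (J := J)); first by have [] := red_ker (pb_potential pu pv).
  have := Lb_dorfman gJ Lu Lv; rewrite /eigenLbar /= => H.
  by rewrite (JN J) H scalerN.
apply/clP/asboolP; exists (- (2 * pairing (red v) l)).
rewrite -E1 lE opprD addrA subrr add0r -(piLb_id E3) E2 dbar0E.
by rewrite dbar0E dsecN piLbN.
Qed.

Lemma cl0 : cl J 0 = 0.
Proof. by apply: (addrI (cl J 0)); rewrite -clD !addr0. Qed.

Let exactP e : exact J e <-> exists u, e = dbar0 J u.
Proof. by split=> [/asboolP|H]; last exact/asboolP. Qed.

(** The representatives chosen by [brQ] differ from [red u] and [red v] by exact
    sections, whose brackets with symmetries in [\bar L_J] are exact. *)
Let brQ_red u v : potential u -> potential v ->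
  brQ J (cl J (red u)) (cl J (red v)) = cl J (red (pb u v)).
Proof.
move=> pu pv; have [Lu Pu] := red_ker pu; have [Lv Pv] := red_ker pv.
rewrite /brQ; set x := cl J (red u); set y := cl J (red v).
have [p xE] : exists p, repr x = red u + dbar0 J p.
  have /clP/exactP[p E] := cl_repr x; exists p.
  by rewrite -E addrC subrK.
have [q yE] : exists q, repr y = red v + dbar0 J q.
  have /clP/exactP[q E] := cl_repr y; exists q.
  by rewrite -E addrC subrK.
have Lp : eigenLbar J (dbar0 J p) by exact: piLb_in.
have Lq : eigenLbar J (dbar0 J q) by exact: piLb_in.
have Lx : eigenLbar J (repr x) by rewrite xE; exact: Lb_D.
have Ly : eigenLbar J (repr y) by rewrite yE; exact: Lb_D.
rewrite courantE (Lb_isotropic gJ Lx Ly) dsec0 subr0 -cl_bracket//.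
have Py : preserves J (red v + dbar0 J q).
  by apply: preservesD => //; exact: preserves_dbar0.
rewrite xE yE dorfmanDl (dbar0_dorfman gJ p (Lb_D Lv Lq) Py) dorfmanDr.
rewrite (dorfman_dbar0 _ Pu); apply/clP/exactP.
exists ((red u).1 q - (red v + dbar0 J q).1 p).
by rewrite dbar0B addrAC (addrC (dorfman _ _)) addrK.
Qed.

Let redD u v : red (u + v) = red u + red v.
Proof. by rewrite /red !dbar0E dsecD piLbD (JD Jp). Qed.
Let redZ (c : R[i]) u : red (c%:Cst * u) = c%:Cst *: red u.
Proof. by rewrite /red dbar0Z (JZ Jp). Qed.
Let red0 : red 0 = 0.
Proof. by rewrite -Cst0 -[0%:Cst]mul1r -Cst1 Cst0 mulr0 -(mul0r 0) -Cst0 redZ Cst0 scale0r. Qed.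
Let hamD u v : ham (u + v) = ham u + ham v.
Proof. by rewrite /ham dsecD (JD Jp). Qed.
Let hamZ (c : R[i]) u : ham (c%:Cst * u) = c%:Cst *: ham u.
Proof. by rewrite /ham dsecZ (JZ Jp). Qed.

Let potential0 : potential 0.
Proof.
split; first exact: real_fun0.
by rewrite /ham dsec0 linear0 -(dsec0 M); exact: preserves_dsec.
Qed.

Let potential_lin (r : R) u v : potential u -> potential v ->
  potential (r%:C%:Cst * u + v).
Proof.
move=> [ru pu] [rv pv]; split.
  by apply: real_funD => //; apply: real_funM => //; exact: real_funC.
by rewrite hamD hamZ; apply: preservesD => //; exact: preservesZ.
Qed.

Let g0RP x : g0R J Jp x <-> exists2 u, potential u & x = cl J (red u).
Proof.
split=> [[u /potentialP pu <-]|[u pu ->]]; first by exists u.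
by exists u => //; exact/potentialP.
Qed.

Let cl_lin (r : R) u v : r *: cl J (red u) + cl J (red v) = cl J (red (r%:C%:Cst * u + v)).
Proof. by rewrite redD redZ clD -SecQ_scaleE. Qed.

Lemma g0R_subspace : subspace (g0R J Jp).
Proof.
split; first by apply/g0RP; exists 0 => //; rewrite red0 cl0.
move=> r x y /g0RP[u pu ->] /g0RP[v pv ->]; rewrite cl_lin; apply/g0RP.
by exists (r%:C%:Cst * u + v) => //; exact: potential_lin.
Qed.

Lemma g0R_br x y : g0R J Jp x -> g0R J Jp y -> g0R J Jp (brQ J x y).
Proof.
move=> /g0RP[u pu ->] /g0RP[v pv ->]; rewrite brQ_red//; apply/g0RP.
by exists (pb u v) => //; exact: pb_potential.
Qed.

Let pb_lin (r : R) u v w : pb (r%:C%:Cst * u + v) w = r%:C%:Cst * pb u w + pb v w.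
Proof. by rewrite /pb hamD hamZ. Qed.

Lemma g0R_lie_algebra : lie_algebra (brQ J) (g0R J Jp).
Proof.
split.
- exact: g0R_subspace.
- exact: g0R_br.
- move=> r x y z /g0RP[u pu ->] /g0RP[v pv ->] /g0RP[w pw ->].
  by rewrite cl_lin !brQ_red//; [rewrite cl_lin pb_lin|exact: potential_lin].
- move=> x /g0RP[u pu ->]; rewrite brQ_red//.
  have -> : pb u u = 0 by apply: (two_inj (V := A^o)); exact: pb_skew.
  by rewrite red0 cl0.
move=> x y z /g0RP[u pu ->] /g0RP[v pv ->] /g0RP[w pw ->].
have P := pb_potential; rewrite !brQ_red//; try exact: P.
rewrite -!clD -!redD (_ : _ + _ = 0) ?red0 ?cl0//.
rewrite (pb_jac v w pu) (pb_skew v (pb w u)) (pb_skew w u) (pb_skew w (pb u v)).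
have -> : pb (- pb u w) v = - pb (pb u w) v.
  by rewrite pb_skew [in RHS]pb_skew /pb VecN.
rewrite (pb_skew v (pb u w)); ring.
Qed.

Lemma g0R_lie_subalgebra : lie_subalgebra (brQ J) (g0 J Jp) (g0R J Jp).
Proof.
split; [|exact: g0R_subspace|exact: g0R_br].
by move=> _ [u [ku ru] <-]; exists u.
Qed.

Lemma g0R_skew x y : g0R J Jp x -> g0R J Jp y -> brQ J x y = - brQ J y x.
Proof.
move=> /g0RP[u pu ->] /g0RP[v pv ->]; rewrite !brQ_red//.
apply/eqP; rewrite -addr_eq0 -clD -redD pb_skew addNr red0 cl0.
by [].
Qed.

(** The classes vanish only modulo [\bar\partial] of all complex functions, so
    the first step ([exact_hamiltonian]) recovers from the class of [red w] the
    vanishing of [dw]; the rest concerns real functions and a single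
    derivation. *)
Lemma g0R_ad_nil x y : g0R J Jp x -> g0R J Jp y ->
  brQ J x (brQ J x y) = 0 -> brQ J x y = 0.
Proof.
move=> /g0RP[u pu ->] /g0RP[v pv ->].
have puv := pb_potential pu pv; have puuv := pb_potential pu puv.
rewrite !brQ_red//; set f := pb u v; set w := pb u f.
rewrite -cl0 => /clP/exactP[s]; rewrite subr0 => Es.
have [ru _] := pu; have [rf _] := puv; have [rw _] := puuv.
have Xw := exact_hamiltonian gK cM rw Es.
have [rv _] := pv.
have w0 : w = 0 := @nilpotent_derivative _ _ _ cM (ham u).1 f w rf rw erefl (Xw _).
have f0 : f = 0 := @nilpotent_derivative _ _ _ cM (ham u).1 v f rv rf erefl w0.
by rewrite f0 red0.
Qed.

End ReducedAutomorphisms.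

Theorem proposition5p9 (R : realType) (n : nat) (M : manifold R n)
    (J Jpsi : {linear Sec M -> Sec M}) :
  compact [set: M] ->
  generalized_kahler J Jpsi ->
  symplectic_type Jpsi ->
  [/\ lie_algebra (brQ J) (g0R J Jpsi),
      lie_subalgebra (brQ J) (g0 J Jpsi) (g0R J Jpsi)
    & reductive (brQ J) (g0R J Jpsi)].
Proof.
move=> cM gK _; split; first exact: g0R_lie_algebra.
  exact: g0R_lie_subalgebra.
apply: reductive_ad_nil; first exact: g0R_lie_algebra.
  exact: g0R_skew.
exact: g0R_ad_nil.
Qed.
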